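(* There exists an integer $d\ge 2$ such that every $P_5$-free graph $G$ satisfies $\alpha(G)\,\omega(G)^d\ge |G|$.
   Context: All graphs are finite, simple. $P_5$ is the path on five vertices; a graph is $P_5$-free if it has no induced subgraph isomorphic to $P_5$. $|G|$ denotes the number of vertices of $G$, $\alpha(G)$ the maximum size of a stable set, and $\omega(G)$ the maximum size of a clique. *)

(* Defs.v *)
From mathcomp Require Import all_boot.

Set Implicit Arguments.
Unset Strict Implicit.
Unset Printing Implicit Defensive.

Record sgraph := SGraph {
  vertex :> finType;
  adj : rel vertex;
  adj_sym : symmetric adj;
  adj_irr : irreflexive adj
}.

(* The requirement "=" on adjacency (rather than implication) is what makes
   the image of f an induced copy of H. *)
Definition contains_induced (G H : sgraph) : Prop :=
  exists f : H -> G,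
    injective f /\ forall x y : H, adj (f x) (f y) = adj x y.

Definition path_adj (n : nat) : rel 'I_n :=
  fun i j => (i.+1 == j :> nat) || (j.+1 == i :> nat).

Lemma path_adj_sym n : symmetric (@path_adj n).
Proof. by move=> i j; rewrite /path_adj orbC. Qed.

Lemma path_adj_irr n : irreflexive (@path_adj n).
Proof. by move=> i; rewrite /path_adj orbb gtn_eqF. Qed.

(* n is the number of vertices, not of edges. *)
Definition path_graph (n : nat) : sgraph :=
  SGraph (@path_adj_sym n) (@path_adj_irr n).

Definition P5_free (G : sgraph) : Prop := ~ contains_induced G (path_graph 5).

Definition stable (G : sgraph) (A : {set G}) : bool :=
  [forall x in A, forall y in A, ~~ adj x y].

Definition clique (G : sgraph) (A : {set G}) : bool :=
  [forall x in A, forall y in A, (x != y) ==> adj x y].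

Definition alpha (G : sgraph) : nat := \max_(A : {set G} | stable A) #|A|.

Definition omega (G : sgraph) : nat := \max_(A : {set G} | clique A) #|A|.

(* Main.v *)
Require Import Defs.
From Stdlib Require Import Classical.
From mathcomp Require Import all_boot zify.

Set Implicit Arguments.
Unset Strict Implicit.
Unset Printing Implicit Defensive.

(** Take a counterexample [G] with as few vertices as possible, for a fixed large exponent [d]; write
    [n], [al], [w] for its order, stability number and clique number. Then [al * w ^ d < n], while
    every proper subset [U] has at most [alf U * omg U ^ d] vertices. So a subset of size
    [n / 2 ^ (q d)] has clique number above [w / 2 ^ q]; in particular there are no two large sets
    that are complete to each other. The only property of [P5]-free graphs that is used is: no
    vertex is mixed on two connected sets that are anticomplete to each other.

    First, [G] is dense. Two anticomplete connected sets cannot both be large: enlarged as far as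
    possible, they are separated from the rest by vertices complete to one of them, and minimality
    then bounds their size. Hence removing the closed neighbourhood of a connected set leaves, up to
    a tiny remainder, one component. This gives the dichotomy that almost every vertex has few
    non-neighbours, or some non-neighbourhood is large and sparse; the latter contradicts
    minimality.

    Second, density improves itself. Fix the finest scale [p] at which some large [S] has all
    non-degrees at most [|S| / 2 ^ (16 p)]. At this scale every half of [S] contains a set [A] with
    clique number above [w / 2 ^ p] which all but [|S| / 2 ^ (p + 1)] vertices of [S] are complete
    to, and [2 ^ p] successive such sets give a clique larger than [w]. To find [A], start inside
    the set of non-neighbours of a vertex [v] and shrink: every step divides the number of
    neighbours of [v] not complete to the current set by [2 ^ g] at the cost of a factor at most
    [2 ^ (256 g)] in its size. *)

(** * Connected sets, cliques and stable sets *)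

(** The exponent [d] is a budget: size losses are written as powers of two and compared with
    multiples of [d]. A fixed loss such as [2 ^ 800] is negligible against [2 ^ d], and at scale [p]
    so is a loss [2 ^ (c * p)] with [c] well below [d]. The value [100 * 100] leaves room for the
    largest demands: [7 * 1400] and [19 * 520] for density, and about [256 * 18 + 633] for the
    shrinking. The obstacle in the second half is that the neighbours of [v] not complete to the
    current set must fall by a factor near [2 ^ (2 * p)] with [p] unbounded, while the total size
    loss stays within [2 ^ (p * d)]. Hence a step may gain any exponent [g] but must pay linearly in
    [g]. Pure pairs gain 1; families of [2 ^ a] pairwise complete sets gain [a - 1]; if neither
    exists, a very dense subset gains an exponent proportional to its own density. The finest scale
    guarantees that non-neighbourhoods inside large sets are never too small to shrink into. *)

Section Connectivity.
Variables (T : finType) (r : rel T).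
Hypothesis r_sym : symmetric r.
Implicit Types (A B C U : {set T}) (x y z : T).

(** Cut form of connectivity, over an arbitrary relation because it is applied both to [adj] and to
    [nadj], adjacency in the complement. The empty set counts as connected, so [remainder] and
    [giant_sub] may answer with [set0]. *)
Definition conn (A : {set T}) : Prop :=
  forall B : {set T}, B \subset A -> B != set0 -> B != A ->
  exists b c, [/\ b \in B, c \in A, c \notin B & r b c].

Definition rin (U : {set T}) := [rel a b | [&& a \in U, b \in U & r a b]].

Definition component (U : {set T}) x := [set y | connect (rin U) x y].

Lemma rin_sym U : symmetric (rin U).
Proof. by move=> a b /=; rewrite r_sym; case: (a \in U); case: (b \in U). Qed.

Lemma mem_comp U x : x \in component U x.
Proof. by rewrite inE connect0. Qed.

Lemma comp_closed U x y z :
  x \in U -> y \in component U x -> z \in U -> r y z -> z \in component U x.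
Proof.
rewrite !inE => xU xy zU yz; apply: (connect_trans xy).
have yU : y \in U.
  case/connectP: xy => p; elim/last_ind: p => [_ -> //|p w _].
  by rewrite rcons_path last_rcons => /andP[_ /and3P[_ wU _]] ->.
by apply: connect1; rewrite /= yU zU yz.
Qed.

Lemma comp_sub U x : x \in U -> component U x \subset U.
Proof.
move=> xU; apply/subsetP=> y; rewrite inE => /connectP[p].
elim/last_ind: p => [_ -> //|p w _].
by rewrite rcons_path last_rcons => /andP[_ /and3P[_ wU _]] ->.
Qed.

Lemma comp_eq U x y : y \in component U x -> component U y = component U x.
Proof.
rewrite inE => xy; apply/setP=> z; rewrite !inE; apply/idP/idP => H.
  exact: connect_trans H.
by apply: connect_trans H; rewrite (sym_connect_sym (@rin_sym U)).
Qed.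

Lemma connect_exit U (B : {set T}) x y : connect (rin U) x y -> x \in B -> y \notin B ->
  exists b c, [/\ b \in B, c \notin B, connect (rin U) x b, connect (rin U) x c & r b c].
Proof.
case/connectP=> p; elim: p x => [|z p IH] x /=.
  by move=> _ -> ->.
case/andP=> xz pz Hy xB yB.
case zB: (z \in B); last first.
  exists x, z; rewrite xB zB connect0; split => //; first exact: connect1.
  by case/and3P: xz.
have [b [c [bB cB zb zc bc]]] := IH z pz Hy zB yB.
have xz' : connect (rin U) x z by apply: connect1.
by exists b, c; split => //; apply: connect_trans xz' _.
Qed.

Lemma comp_conn U x : conn (component U x).
Proof.
move=> B sB /set0Pn[b bB] nB.
have /subsetPn[c cC cB] : ~~ (component U x \subset B).
  by apply: contraNN nB => s; rewrite eqEsubset sB.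
have xb : b \in component U x by apply: (subsetP sB).
have bc : connect (rin U) b c by move: cC; rewrite -(comp_eq xb) inE.
have [b' [c' [b'B c'B bb' bc' R]]] := connect_exit bc bB cB.
exists b', c'; split => //.
by rewrite -(comp_eq xb) inE.
Qed.

Lemma conn_sub_comp U A x : conn A -> A \subset U -> x \in A -> A \subset component U x.
Proof.
move=> cA sAU xA; set B := A :&: component U x.
have [E|nE] := eqVneq B A; first by rewrite -E subsetIr.
have [] := cA B; rewrite ?subsetIl //.
  by apply/set0Pn; exists x; rewrite inE xA mem_comp.
move=> b [c [bB cA' cB bc]].
case/negP: cB; rewrite inE cA' /=.
move: bB; rewrite inE => /andP[bA bC].
apply: (@comp_closed U x b) => //; first exact: (subsetP sAU).
exact: (subsetP sAU).
Qed.

Lemma conn1 x : conn [set x].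
Proof.
move=> B; rewrite subset1 => /orP[/eqP->|/eqP->]; rewrite eqxx //.
Qed.

Lemma conn0 : conn set0.
Proof. by move=> B; rewrite subset0 => /eqP->; rewrite eqxx. Qed.

Lemma connU A B a b : conn A -> conn B -> a \in A -> b \in B -> (a == b) || r a b ->
  conn (A :|: B).
Proof.
move=> cA cB aA bB ab C sC C0 nC.
case: (boolP (A \subset C)) => AC.
  case: (boolP (B \subset C)) => BC.
    by case/eqP: nC; apply/eqP; rewrite eqEsubset sC subUset AC BC.
  have aC : a \in C by apply: (subsetP AC).
  case: (boolP (b \in C)) => bC.
    have [] := cB (B :&: C); rewrite ?subsetIl //.
    - by apply/set0Pn; exists b; rewrite inE bB.
    - by apply: contraNneq BC => <-; rewrite subsetIr.
    move=> x [y [xx yB yC xy]]; exists x, y; split => //.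
    - by move: xx; rewrite inE => /andP[].
    - by rewrite inE yB orbT.
    - by move: yC; rewrite inE yB.
  exists a, b; split => //; first by rewrite inE bB orbT.
  by case/orP: ab => // /eqP E; move: bC; rewrite -E aC.
case: (boolP (A :&: C == set0)) => AC0.
  have CB : C \subset B.
    apply/subsetP=> x xC; have := subsetP sC x xC; rewrite inE => /orP[xA|//].
    by move/eqP/setP/(_ x): AC0; rewrite !inE xA xC.
  case: (boolP (b \in C)) => bC.
    exists b, a; split => //; rewrite ?inE ?aA //.
      by apply/negP=> aC; move/eqP/setP/(_ a): AC0; rewrite !inE aA aC.
    rewrite r_sym; case/orP: ab => // /eqP E.
    by move/eqP/setP/(_ b): AC0; rewrite !inE -E aA E bC.
  have [] := cB C => //.
    by apply: contraNneq bC => ->.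
  move=> x [y [xx yB yC xy]]; exists x, y; split => //.
  by rewrite inE yB orbT.
have [] := cA (A :&: C); rewrite ?subsetIl //.
  by apply: contraNneq AC => <-; rewrite subsetIr.
move=> x [y [xx yA yC xy]]; exists x, y; split => //.
- by move: xx; rewrite inE => /andP[].
- by rewrite inE yA.
- by move: yC; rewrite inE yA.
Qed.

Lemma conn2 x y : r x y -> conn [set x; y].
Proof.
by move=> xy; apply: (@connU _ _ x y); rewrite ?inE ?xy ?orbT //; apply: conn1.
Qed.

Lemma connU1 A a x : conn A -> a \in A -> r a x -> conn (x |: A).
Proof.
move=> cA aA ax; rewrite setUC; apply: (@connU _ _ a x) => //; first exact: conn1.
  by rewrite inE.
by rewrite ax orbT.
Qed.

Lemma connUnb A B : conn A -> (forall b, b \in B -> exists2 a, a \in A & r a b) ->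
  conn (A :|: B).
Proof.
move=> cA H C sC C0 nC.
case: (boolP (A \subset C)) => AC.
  have /subsetPn[b bAB bC] : ~~ (A :|: B \subset C).
    by apply: contraNN nC => s; rewrite eqEsubset sC.
  move: (bAB); rewrite inE => /orP[bA|bB]; first by rewrite (subsetP AC) in bC.
  have [a aA ab] := H b bB; exists a, b; split => //; exact: (subsetP AC).
case: (boolP (A :&: C == set0)) => AC0.
  case/set0Pn: C0 => c cC.
  have := subsetP sC c cC; rewrite inE => /orP[cA'|cB].
    by move/eqP/setP/(_ c): AC0; rewrite !inE cA' cC.
  have [a aA ac] := H c cB; exists c, a; split => //; rewrite ?inE ?aA // 1?r_sym //.
  by apply/negP=> aC; move/eqP/setP/(_ a): AC0; rewrite !inE aA aC.
have [] := cA (A :&: C); rewrite ?subsetIl //.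
  by apply: contraNneq AC => <-; rewrite subsetIr.
move=> x [y [xx yA yC xy]]; exists x, y; split => //.
- by move: xx; rewrite inE => /andP[].
- by rewrite inE yA.
- by move: yC; rewrite inE yA.
Qed.

Lemma conn_exit A (P : pred T) x y : conn A -> x \in A -> P x -> y \in A -> ~~ P y ->
  exists b c, [/\ b \in A, P b, c \in A, ~~ P c & r b c].
Proof.
move=> cA xA Px yA Py.
have [] := cA [set z in A | P z].
- by apply/subsetP=> z; rewrite inE => /andP[].
- by apply/set0Pn; exists x; rewrite inE xA.
- by apply: contraNneq Py => /setP/(_ y); rewrite inE yA /= => ->.
move=> b [c []]; rewrite !inE => /andP[bA Pb] cA'; rewrite cA' /= => Pc bc.
by exists b, c.
Qed.

End Connectivity.

(** * Clique and stability numbers of vertex sets, and mixed vertices *)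

Section Graph.
Variable G : sgraph.
Implicit Types (A B C S U W K L : {set G}) (x y z v w : G).
Local Notation e := (@adj G).

Definition nadj : rel G := [rel x y | (x != y) && ~~ adj x y].

Lemma nadj_sym : symmetric nadj.
Proof. by move=> x y; rewrite /nadj /= eq_sym adj_sym. Qed.

Definition anti A B := forall a b, a \in A -> b \in B -> ~~ adj a b.
Definition full A B := forall a b, a \in A -> b \in B -> adj a b.
Definition mixed z A := exists a b, [/\ a \in A, b \in A, adj z a & ~~ adj z b].
Definition com A := [set x | [forall a in A, adj x a]].
Definition nb A := [set x | [exists a in A, adj x a]].
Definition nN v := [set x | nadj v x].
Definition N v := [set x | adj v x].
(** Relative to a vertex set, so that minimality can be used throughout without passing to induced
    subgraphs. *)
Definition alf A := \max_(S : {set G} | (S \subset A) && stable S) #|S|.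
Definition omg A := \max_(S : {set G} | (S \subset A) && clique S) #|S|.

Lemma anti_sym A B : anti A B -> anti B A.
Proof. by move=> H a b aA bB; rewrite adj_sym; apply: H. Qed.
Lemma full_sym A B : full A B -> full B A.
Proof. by move=> H a b aA bB; rewrite adj_sym; apply: H. Qed.
Lemma antiS A B A' B' : anti A B -> A' \subset A -> B' \subset B -> anti A' B'.
Proof. by move=> H /subsetP s1 /subsetP s2 a b /s1 aA /s2; apply: H. Qed.
Lemma fullS A B A' B' : full A B -> A' \subset A -> B' \subset B -> full A' B'.
Proof. by move=> H /subsetP s1 /subsetP s2 a b /s1 aA /s2; apply: H. Qed.

Lemma comP A x : reflect (forall a, a \in A -> adj x a) (x \in com A).
Proof. by rewrite inE; apply: forall_inP. Qed.
Lemma nbP A x : reflect (exists2 a, a \in A & adj x a) (x \in nb A).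
Proof. by rewrite inE; apply: exists_inP. Qed.
Lemma in_N v x : (x \in N v) = adj v x. Proof. by rewrite inE. Qed.
Lemma in_nN v x : (x \in nN v) = (v != x) && ~~ adj v x. Proof. by rewrite inE. Qed.
Lemma nNC v x : (x \in nN v) = (v \in nN x).
Proof. by rewrite !in_nN eq_sym adj_sym. Qed.

Lemma comS A B : A \subset B -> com B \subset com A.
Proof. by move=> /subsetP s; apply/subsetP=> x /comP H; apply/comP=> a /s; apply: H. Qed.
Lemma com_full A : full (com A) A.
Proof. by move=> a b /comP H; apply: H. Qed.

Lemma full_disjoint A B : full A B -> [disjoint A & B].
Proof.
move=> H; rewrite -setI_eq0; apply/eqP/setP=> x; rewrite !inE.
by apply/negP=> /andP[xA xB]; have := H _ _ xA xB; rewrite adj_irr.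
Qed.

Lemma clique_le A K : K \subset A -> clique K -> #|K| <= omg A.
Proof. by move=> s c; apply: (@leq_bigmax_cond _ (fun S : {set G} => (S \subset A) && clique S) (fun S => #|S|)); rewrite s c. Qed.
Lemma stable_le A K : K \subset A -> stable K -> #|K| <= alf A.
Proof. by move=> s c; apply: (@leq_bigmax_cond _ (fun S : {set G} => (S \subset A) && stable S) (fun S => #|S|)); rewrite s c. Qed.

Lemma clique0 : clique (set0 : {set G}).
Proof. by apply/forall_inP=> x; rewrite inE. Qed.
Lemma stable0 : stable (set0 : {set G}).
Proof. by apply/forall_inP=> x; rewrite inE. Qed.

Lemma omg_ex A : exists K : {set G}, [/\ K \subset A, clique K & #|K| = omg A].
Proof.
have H : (set0 \subset A) && clique (set0 : {set G}) by rewrite sub0set clique0.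
have H1 : 0 < #|[pred S : {set G} | (S \subset A) && clique S]| by apply/card_gt0P; exists set0.
have [K /andP[s c] E] := eq_bigmax_cond (fun S : {set G} => #|S|) H1.
by exists K; split.
Qed.
Lemma alf_ex A : exists K : {set G}, [/\ K \subset A, stable K & #|K| = alf A].
Proof.
have H : (set0 \subset A) && stable (set0 : {set G}) by rewrite sub0set stable0.
have H1 : 0 < #|[pred S : {set G} | (S \subset A) && stable S]| by apply/card_gt0P; exists set0.
have [K /andP[s c] E] := eq_bigmax_cond (fun S : {set G} => #|S|) H1.
by exists K; split.
Qed.

Lemma omgS A B : A \subset B -> omg A <= omg B.
Proof.
move=> s; have [K [sK cK <-]] := omg_ex A.
by apply: clique_le => //; apply: subset_trans s.
Qed.
Lemma alfS A B : A \subset B -> alf A <= alf B.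
Proof.
move=> s; have [K [sK cK <-]] := alf_ex A.
by apply: stable_le => //; apply: subset_trans s.
Qed.

Lemma cliqueP K : reflect (forall x y, x \in K -> y \in K -> x != y -> adj x y) (clique K).
Proof.
apply: (iffP forall_inP) => [H x y xK yK|H x xK].
  by have /forall_inP/(_ y yK)/implyP := H x xK.
by apply/forall_inP=> y yK; apply/implyP; apply: H.
Qed.
Lemma stableP K : reflect (forall x y, x \in K -> y \in K -> ~~ adj x y) (stable K).
Proof.
apply: (iffP forall_inP) => [H x y xK yK|H x xK].
  by have /forall_inP/(_ y yK) := H x xK.
by apply/forall_inP=> y yK; apply: H.
Qed.

Lemma omgU A B : full A B -> omg A + omg B <= omg (A :|: B).
Proof.
move=> H; have [K [sK /cliqueP cK <-]] := omg_ex A.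
have [L [sL /cliqueP cL <-]] := omg_ex B.
have KL : full K L by apply: fullS H _ _.
rewrite -cardsUI; have /eqP -> : K :&: L == set0 by rewrite setI_eq0 full_disjoint.
rewrite cards0 addn0; apply: clique_le; first exact: setUSS.
apply/cliqueP=> x y; rewrite !inE => /orP[xK|xL] /orP[yK|yL] xy.
- exact: cK.
- exact: KL.
- by rewrite adj_sym; apply: KL.
- exact: cL.
Qed.
Lemma alfU A B : anti A B -> [disjoint A & B] -> alf A + alf B <= alf (A :|: B).
Proof.
move=> H dAB; have [K [sK /stableP cK <-]] := alf_ex A.
have [L [sL /stableP cL <-]] := alf_ex B.
have KL : anti K L by apply: antiS H _ _.
rewrite -cardsUI; have /eqP -> : K :&: L == set0.
  by rewrite setI_eq0; apply: disjointWl sK _; apply: disjointWr sL _.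
rewrite cards0 addn0; apply: stable_le; first exact: setUSS.
apply/stableP=> x y; rewrite !inE => /orP[xK|xL] /orP[yK|yL].
- exact: cK.
- exact: KL.
- by rewrite adj_sym; apply: KL.
- exact: cL.
Qed.

Lemma omg0 : omg set0 = 0.
Proof.
by have [K [sK _ <-]] := omg_ex set0; move: sK; rewrite subset0 => /eqP->; rewrite cards0.
Qed.
Lemma omg_gt0 A : A != set0 -> 0 < omg A.
Proof.
case/set0Pn=> x xA; rewrite -(cards1 x); apply: clique_le; first by rewrite sub1set.
by apply/cliqueP=> y z; rewrite !inE => /eqP-> /eqP->; rewrite eqxx.
Qed.

Lemma conn_nonadj A x y : conn e A -> x \in A -> y \in A -> x != y ->
  exists2 z, z \in A & adj x z.
Proof.
move=> cA xA yA xy.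
have [] := conn_exit (P := pred1 x) cA xA _ yA _; rewrite /= ?eqxx //; first by rewrite eq_sym.
by move=> b [c [bA /eqP -> cA' _ xc]]; exists c.
Qed.

(** In each set connectivity gives an edge with exactly one end adjacent to [z]; together they form
    the induced path [a2 - a1 - z - b1 - b2]. *)
Lemma P5_mixed : P5_free G -> forall z A B, conn e A -> conn e B -> anti A B ->
  mixed z A -> mixed z B -> False.
Proof.
move=> PF z A B cA cB AB [a [a' [aA a'A za za']]] [b [b' [bB b'B zb zb']]].
have [a1 [a2 [a1A /= za1 a2A /= za2 a12]]] := conn_exit (P := adj z) cA aA za a'A za'.
have [b1 [b2 [b1B /= zb1 b2B /= zb2 b12]]] := conn_exit (P := adj z) cB bB zb b'B zb'.
have n1 x y : x \in A -> y \in B -> adj x y = false by move=> xA yB; apply/negbTE/AB.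
have n2 x y : x \in A -> y \in B -> adj y x = false by rewrite adj_sym; apply: n1.
have zA2 : z != a2 by apply/eqP=> E; have := AB _ _ a2A b1B; rewrite -E zb1.
have zB2 : z != b2 by apply/eqP=> E; have := AB _ _ a1A b2B; rewrite -E adj_sym za1.
case: PF; exists (fun i : 'I_5 => nth z [:: a2; a1; z; b1; b2] i).
have irr := @adj_irr G.
have ne x y : adj x y -> x != y by move=> H; apply/eqP=> E; rewrite E irr in H.
(* [anti] does not by itself exclude a common vertex, but such a vertex would have a neighbour in
   the connected set [B]. *)
have neq_AB x y : x \in A -> y \in B -> x != y.
  move=> xA yB; apply/eqP=> E.
  have [E1|E1] := eqVneq y b1.
    have := n1 _ _ xA b2B; rewrite E E1 b12 //.
  have [y' yB' yy'] := conn_nonadj cB yB b1B E1.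
  by have := n1 _ _ xA yB'; rewrite E yy'.
have uq : uniq [:: a2; a1; z; b1; b2].
  rewrite /= !inE !negb_or (eq_sym a2 a1) (ne _ _ a12) (eq_sym a2 z) zA2 (eq_sym a1 z).
  by rewrite (ne _ _ za1) (ne _ _ zb1) zB2 (ne _ _ b12) !neq_AB.
split.
  move=> i j /eqP; rewrite nth_uniq //= => /eqP E; exact: val_inj.
have s (x y : G) : adj x y = adj y x by rewrite adj_sym.
move: za1 zb1 a12 b12 (negbTE za2) (negbTE zb2) => f1 f2 f3 f4 f5 f6.
case=> [[|[|[|[|[|i]]]]] Hi] [[|[|[|[|[|j]]]]] Hj] //=;
  rewrite /path_adj /=; do ?[by rewrite irr | by rewrite n1 | by rewrite n2
    | by rewrite ?f1 ?f2 ?f3 ?f4 ?f5 ?f6 | by rewrite s ?f1 ?f2 ?f3 ?f4 ?f5 ?f6].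
Qed.

End Graph.

(** * Minimal counterexamples *)

Lemma leq_expl a b k : a <= b -> a ^ k <= b ^ k.
Proof. by case: k => [|k] ab; rewrite ?expn0 // leq_exp2r. Qed.

(** Bernoulli's inequality [(1 + k / h) ^ d >= 1 + d * k / h] with denominators cleared. *)
Lemma bernoulli h k d : h ^ d * (h + d * k) <= h * (h + k) ^ d.
Proof.
elim: d => [|d IH]; first by rewrite !expn0; lia.
rewrite !expnS; move: (h ^ d) ((h + k) ^ d) IH => a b IH.
have H : (h + k) * (a * (h + d * k)) <= (h + k) * (h * b) by rewrite leq_mul2l IH orbT.
nia.
Qed.

Lemma bern2 s : 0 < s -> 2 * s ^ s <= s.+1 ^ s.
Proof.
move=> s0; have := bernoulli s 1 s; rewrite addn1 muln1 => H.
have : s * (2 * s ^ s) <= s * s.+1 ^ s by nia.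
by rewrite leq_pmul2l.
Qed.

Record mincex (G : sgraph) (d : nat) : Prop := MinCex {
  mc_d : 100 * 100 <= d;
  mc_M : forall (z : G) (A B : {set G}), conn (@adj G) A -> conn (@adj G) B -> anti A B ->
    mixed z A -> mixed z B -> False;
  mc_min : forall U : {set G}, U != setT -> #|U| <= alf U * omg U ^ d;
  mc_big : alf [set: G] * omg [set: G] ^ d < #|G| }.

Section Basic.
Variables (G : sgraph) (d : nat).
Hypothesis mc : mincex G d.
Implicit Types (A B C S U W Y K L : {set G}) (x y z v : G).
Local Notation e := (@adj G).
Local Notation n := #|G|.
Local Notation al := (alf [set: G]).
Local Notation w := (omg [set: G]).

Lemma d_gt0 : 0 < d. Proof. by have := mc_d mc; lia. Qed.

Lemma mc_n0 : 0 < n. Proof. by have := mc_big mc; lia. Qed.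

Lemma omg_w A : omg A <= w. Proof. exact/omgS/subsetT. Qed.
Lemma alf_al A : alf A <= al. Proof. exact/alfS/subsetT. Qed.

Lemma mc_w0 : 0 < w.
Proof.
apply: omg_gt0; have := mc_n0 => /card_gt0P[x _].
by apply/set0Pn; exists x.
Qed.

Lemma mc_alomg U : U != setT -> #|U| <= al * omg U ^ d.
Proof.
move=> nU; apply: leq_trans (mc_min mc nU) _.
by rewrite leq_mul2r alf_al orbT.
Qed.

Lemma mc_alfw U : U != setT -> #|U| <= alf U * w ^ d.
Proof.
move=> nU; apply: leq_trans (mc_min mc nU) _.
by rewrite leq_mul2l leq_exp2r ?omg_w ?orbT // d_gt0.
Qed.

Lemma omg_lt_neqT U : omg U < w -> U != setT.
Proof. by apply: contraTneq => ->; rewrite ltnn. Qed.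

(** Minimality bounds the size by a [d]-th power of the clique number, so a factor [2 ^ q] lost
    there becomes [2 ^ (q * d)]. *)
Lemma mc_size A q : 0 < q -> omg A * 2 ^ q <= w -> #|A| * 2 ^ (q * d) < n.
Proof.
move=> q0 H.
have nA : A != setT.
  apply: omg_lt_neqT; have q2 : 2 <= 2 ^ q by rewrite -{1}(expn1 2) leq_exp2l.
  have := mc_w0; nia.
have H1 := mc_alomg nA.
apply: leq_ltn_trans (mc_big mc).
apply: (@leq_trans (al * (omg A * 2 ^ q) ^ d)).
  by rewrite expnMn expnM mulnA leq_mul2r H1 orbT.
by rewrite leq_mul2l leq_exp2r ?H ?orbT // d_gt0.
Qed.

Lemma mc_sizeN A q : 0 < q -> n <= #|A| * 2 ^ (q * d) -> w < omg A * 2 ^ q.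
Proof. by move=> q0; rewrite !ltnNge; apply: contraTN => H; rewrite -ltnNge; apply: mc_size. Qed.

(** Losing even a fixed fraction of the clique number is expensive, because
    [(s.+1 / s) ^ d >= 2 ^ (d / s)]. *)
Lemma mc_frac U s q : 0 < s -> s.+1 * omg U <= s * w -> s * q <= d -> #|U| * 2 ^ q <= n.
Proof.
move=> s0 H sq.
have nU : U != setT by apply: omg_lt_neqT; have := mc_w0; nia.
have H1 := mc_alomg nU.
have pw : 2 ^ q * s ^ d <= s.+1 ^ d.
  rewrite -(subnKC sq) !expnD mulnA; apply: leq_mul; last by apply: leq_expl.
  rewrite !expnM -expnMn.
  by apply: leq_expl; apply: bern2.
have : #|U| * 2 ^ q * s ^ d <= n * s ^ d.
  apply: (@leq_trans (al * (s.+1 * omg U) ^ d)).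
    rewrite expnMn; have := leq_mul H1 pw; move: (omg U ^ d) (s ^ d) (s.+1 ^ d) (2 ^ q) => a b c f.
    lia.
  apply: (@leq_trans (al * (s * w) ^ d)).
    by rewrite leq_mul2l leq_exp2r ?H ?orbT // d_gt0.
  rewrite expnMn mulnCA mulnC leq_mul2r; apply/orP; right.
  exact/ltnW/(mc_big mc).
by rewrite leq_pmul2r // expn_gt0 s0.
Qed.

(** Stability numbers add over [U] and the rest [R], so [U] and [Y] together have more than
    [alf U * w ^ d] vertices, whereas [U] alone has at most [alf U * (w - k) ^ d]. By Bernoulli
    these differ by a factor of at least [1 + d * k / w], and the separator [Y] has to supply the
    difference. *)
Lemma mc_gain U Y k : [disjoint U & Y] -> anti U (~: (Y :|: U)) -> omg U + k <= w ->
  #|U| * d * k <= #|Y| * w.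
Proof.
move=> dUY aU Hk.
have [->|U0] := eqVneq U set0; first by rewrite cards0.
case: k Hk => [|k] Hk; first by rewrite muln0.
have nU : U != setT by apply: omg_lt_neqT; lia.
set R := ~: (Y :|: U) in aU *.
have nR : R != setT.
  case/set0Pn: U0 => u uU; apply/negP=> /eqP/setP/(_ u).
  by rewrite !inE uU orbT.
have dUR : [disjoint U & R].
  rewrite -setI_eq0; apply/eqP/setP=> z; rewrite !inE.
  by case: (z \in U); rewrite ?orbT ?andbF.
have HA : alf U + alf R <= al.
  by apply: leq_trans (alfU aU dUR) _; apply: alf_al.
have HR := mc_alfw nR.
have Hn : n = #|Y| + #|U| + #|R|.
  have := cardsC (Y :|: U); rewrite -/R cardsU setIC.
  by rewrite (_ : U :&: Y = set0) ?cards0 ?subn0 //; apply/eqP; rewrite setI_eq0.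
have HB := mc_big mc.
have H1 : alf U * w ^ d < #|Y| + #|U| by nia.
have H2 := mc_min mc nU.
set h := w - k.+1.
have hw : h + k.+1 = w by rewrite /h; lia.
have H3 : #|U| <= alf U * h ^ d.
  apply: leq_trans H2 _; rewrite leq_mul2l leq_exp2r ?d_gt0 //; apply/orP; right.
  by rewrite /h; lia.
have H4 := bernoulli h k.+1 d; rewrite hw in H4.
have H5 : h ^ d <= w ^ d by rewrite leq_exp2r ?d_gt0 //; lia.
have H6 : w * h ^ d + d * k.+1 * h ^ d <= w * w ^ d.
  move: H4 H5; move: (h ^ d) (w ^ d) => a b H4 H5; rewrite -hw.
  have : k.+1 * a <= k.+1 * b by rewrite leq_mul2l H5 orbT.
  by move: (k.+1) H4 => k1; lia.
move: H1 H3 H6; move: (h ^ d) (w ^ d) => a b H1 H3 H6.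
have H7 : alf U * (w * a + d * k.+1 * a) <= alf U * (w * b) by rewrite leq_mul2l H6 orbT.
have H8 : #|U| * (d * k.+1) <= alf U * a * (d * k.+1) by rewrite leq_mul2r H3 orbT.
have H9 : w * (alf U * b) <= w * (#|Y| + #|U|) by rewrite leq_mul2l (ltnW H1) orbT.
have H10 : w * #|U| <= w * (alf U * a) by rewrite leq_mul2l H3 orbT.
nia.
Qed.

Lemma mc_conn : conn e [set: G].
Proof.
move=> B _ B0 nB.
case: (boolP [exists b in B, exists c in ~: B, e b c]) => [|H].
  case/exists_inP=> b bB /exists_inP[c]; rewrite inE => cB bc.
  by exists b, c; split.
have aB : anti B (~: B).
  move=> a b aB bB; apply: contra H => ab; apply/exists_inP; exists a => //.
  by apply/exists_inP; exists b.
have nC : ~: B != setT.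
  by apply: contra B0 => /eqP E; rewrite -(setCK B) E setCT.
have HA : alf B + alf (~: B) <= al.
  apply: leq_trans (alfU aB _) _; last exact: alf_al.
  by rewrite -setI_eq0 setICr.
have := mc_alfw nB; have := mc_alfw nC; have := mc_big mc; have := cardsC B.
nia.
Qed.

Lemma mc_w2 : 1 < w.
Proof.
rewrite ltnNge; apply/negP=> w1.
have H x y : ~~ e x y.
  apply/negP=> xy; have : #|[set x; y]| <= w.
    apply: clique_le; rewrite ?subsetT //; apply/cliqueP=> a b; rewrite !inE.
    by case/orP=> /eqP-> /orP[] /eqP->; rewrite ?eqxx // adj_sym.
  rewrite cards2; case: eqVneq => [E|_]; last by lia.
  by move: xy; rewrite E adj_irr.
have : #|[set: G]| <= al by apply: stable_le => //; apply/stableP.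
rewrite cardsT; have := mc_big mc.
have := mc_w0; have -> : w = 1 by have := mc_w0; lia.
by rewrite exp1n; lia.
Qed.

Lemma mc_nbig : 2 ^ d < n.
Proof.
apply: leq_ltn_trans (mc_big mc).
have a0 : 0 < al.
  rewrite lt0n; apply/eqP=> a0; have /card_gt0P[x _] := mc_n0.
  have : #|[set x]| <= al by apply: stable_le => //; apply/stableP=> y z; rewrite !inE => /eqP-> /eqP->; rewrite adj_irr.
  by rewrite cards1 a0.
apply: (@leq_trans (w ^ d)); last by rewrite leq_pmull.
by rewrite leq_exp2r ?d_gt0 // mc_w2.
Qed.

End Basic.

(** * Averaging and set covers *)

Lemma cards_subset_ex (T : finType) (A : {set T}) k : k <= #|A| ->
  exists2 B : {set T}, B \subset A & #|B| = k.
Proof.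
elim: k => [|k IH] kA; first by exists set0; rewrite ?sub0set ?cards0.
have [B sB cB] := IH (ltnW kA).
have : 0 < #|A :\: B| by rewrite cardsD (setIidPr sB) cB subn_gt0.
case/card_gt0P=> x; rewrite inE => /andP[xB xA].
exists (x |: B); first by rewrite subUset sub1set xA.
by rewrite cardsU1 xB cB.
Qed.

Section Averages.
Variables (I : finType).
Implicit Types (F : I -> nat).

Lemma avg_le F (P : pred I) S : 0 < #|P| -> \sum_(i | P i) F i <= S ->
  exists2 i, P i & #|P| * F i <= S.
Proof.
move=> P0 H; case: (boolP [exists i in P, #|P| * F i <= S]) => [/exists_inP[i Pi]|].
  by exists i.
rewrite negb_exists_in => /forall_inP H1.
have : \sum_(i | P i) S.+1 <= \sum_(i | P i) #|P| * F i.
  by apply: leq_sum => i Pi; rewrite ltnNge H1.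
rewrite sum_nat_const -big_distrr /= leq_pmul2l //; lia.
Qed.

Lemma avg_ge F (P : pred I) S : 0 < S -> S <= \sum_(i | P i) F i ->
  exists2 i, P i & S <= #|P| * F i.
Proof.
move=> S0 H; case: (boolP [exists i in P, S <= #|P| * F i]) => [/exists_inP[i Pi]|].
  by exists i.
rewrite negb_exists_in => /forall_inP H1.
have : \sum_(i | P i) #|P| * F i <= \sum_(i | P i) S.-1.
  by apply: leq_sum => i Pi; have := H1 i Pi; rewrite -ltnNge; lia.
rewrite sum_nat_const -big_distrr /=.
have [P0|P0] := posnP #|P|; last by rewrite leq_pmul2l //; lia.
move: H; rewrite big_pred0 => [|i]; first by lia.
by apply: (card0_eq P0).
Qed.

Lemma markov F (A : {set I}) K S : \sum_(i in A) F i <= S ->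
  #|[set i in A | K <= F i]| * K <= S.
Proof.
move=> H; apply: leq_trans H; rewrite -sum_nat_const.
rewrite [X in _ <= X](bigID (fun i => K <= F i)) /=.
apply: leq_trans (leq_addr _ _); rewrite (eq_bigl _ _ (in_set _)).
by apply: leq_sum => i /andP[].
Qed.

End Averages.

Lemma dblcount (T U : finType) (A : {set T}) (B : {set U}) (r : T -> U -> bool) :
  \sum_(x in A) #|[set y in B | r x y]| = \sum_(y in B) #|[set x in A | r x y]|.
Proof.
have H (V : finType) (C : {set V}) (p : pred V) : #|[set y in C | p y]| = \sum_(y in C) p y.
  by rewrite -sum1dep_card big_mkcondr; apply: eq_bigr => y _; case: (p y).
under eq_bigr => x _ do rewrite H.
rewrite exchange_big /=; apply: eq_bigr => y _; by rewrite H.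
Qed.

Lemma sum_disjoint (T I : finType) (S : {set I}) (Z : I -> {set T}) (E : {set T}) :
  (forall i, i \in S -> Z i \subset E) ->
  (forall i j, i \in S -> j \in S -> i != j -> [disjoint Z i & Z j]) ->
  \sum_(i in S) #|Z i| <= #|E|.
Proof.
move=> H1 H2.
have -> : \sum_(i in S) #|Z i| = \sum_(i in S) #|[set y in E | y \in Z i]|.
  apply: eq_bigr => i iS; congr #|pred_of_set _|; apply/setP=> y; rewrite inE.
  by case yZ: (y \in Z i); rewrite ?andbF // (subsetP (H1 i iS)).
rewrite dblcount -[X in _ <= X]sum1_card; apply: leq_sum => y yE.
rewrite leqNgt; apply/negP=> /card_gt1P[i [j []]].
rewrite !inE => /andP[iS yi] /andP[jS yj] ij.
have := H2 i j iS jS ij; rewrite -setI_eq0 => /eqP/setP/(_ y).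
by rewrite !inE yi yj.
Qed.

Lemma card_bigcup (T I : finType) (P : pred I) (F : I -> {set T}) :
  #|\bigcup_(i | P i) F i| <= \sum_(i | P i) #|F i|.
Proof.
elim/big_rec2: _ => [|j y B _ IHB]; first by rewrite cards0.
by apply: leq_trans (leq_card_setU _ _) _; rewrite leq_add2l.
Qed.

Lemma cover_arith p x y z s N : 0 < p -> s < 24 * p -> y * (2 * p) <= 48 * N ->
  x * (p * p) <= s * N -> z <= x + y -> z * p <= 48 * N.
Proof.
move=> p0 cS H1 H2 H3.
have H4 : s * N <= 24 * p * N by rewrite leq_mul2r ltnW ?orbT.
have : p * (x * p) <= p * (24 * N) by lia.
rewrite leq_pmul2l // => H5.
have : z * p <= (x + y) * p by rewrite leq_mul2r H3 orbT.
lia.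
Qed.

(** * Unions of set families in which large private parts are rare *)

Section Cover.
Variables (T I : finType) (X : I -> {set T}) (N a0 : nat).
(** In both applications private parts are pairwise complete, so [2 ^ a] large ones are excluded by
    [full_family] or by [no_fam]. *)
Hypothesis no_private : forall a (J : {set I}), a0 <= a -> #|J| = 2 ^ a ->
  exists2 i, i \in J & #|X i :\: \bigcup_(j in J :\ i) X j| * 4 ^ a.+2 < N.

Section Level.
Variables (a : nat) (R : {set T}).
Hypothesis a0a : a0 <= a.
Hypothesis small : forall i, #|X i :&: R| * 4 ^ a <= N.

(* Twelve colours make the total monochromatic overlap at most a sixteenth per set, so half of the
   sets keep half of their new part private within their colour. *)
Definition cov (S : {set I}) (f : I -> 'I_12) r :=
  \bigcup_(j in S | (j != r) && (f j == f r)) X j.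

Definition coloured (S : {set I}) (f : I -> 'I_12) (Z : I -> {set T}) :=
  [/\ forall i, i \in S -> Z i \subset X i :&: R,
      forall i, i \in S -> N < #|Z i| * 4 ^ a.+1,
      forall i j, i \in S -> j \in S -> i != j -> [disjoint Z i & Z j] &
      16 * 4 ^ a * (\sum_(r in S) #|Z r :&: cov S f r|) <= #|S| * N].

(** Outside its new part [V], the set [X i :&: R] has at most [3/4 * N / 4 ^ a] elements. The
    earlier [Z r] are disjoint, so one of the twelve colours overlaps [X i] in at most
    [N / (16 * 4 ^ a)]. Only overlaps of old [Z r] with [X i] arise, since [V] avoids all earlier
    sets. *)
Lemma coloured_add S f Z i : coloured S f Z ->
  N < #|(X i :&: R) :\: \bigcup_(j in S) X j| * 4 ^ a.+1 ->
  i \notin S /\ exists f' Z', coloured (i |: S) f' Z'.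
Proof.
case=> H1 H2 H3 H4 Hi.
have iS : i \notin S.
  apply/negP=> iS; move: Hi; rewrite (_ : _ :\: _ = set0) ?cards0 //.
  apply/eqP; rewrite setD_eq0; apply: subset_trans (subsetIl _ _) _.
  exact: (bigcup_sup i).
split=> //; set V := _ :\: _ in Hi.
have ne r : r \in S -> r != i by apply: contraTneq => ->.
pose g c := \sum_(r in S | f r == c) #|Z r :&: X i|.
have sum_g : \sum_(c : 'I_12) g c = \sum_(r in S) #|Z r :&: X i|.
  by rewrite (partition_big f predT).
have sub : \sum_(r in S) #|Z r :&: X i| + #|V| <= #|X i :&: R|.
  rewrite -(cardsID V (X i :&: R)) addnC; apply: leq_add.
    by rewrite (setIidPr (subsetDl _ _)).
  apply: sum_disjoint => [r rS|r r' rS rS' rr'].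
    apply/subsetP=> x; rewrite !inE => /andP[xZ xX].
    have := subsetP (H1 r rS) x xZ; rewrite inE => /andP[xr xR].
    by rewrite xX xR !andbT negbK; apply/bigcupP; exists r.
  have := H3 r r' rS rS' rr'; rewrite -!setI_eq0 => /eqP E.
  apply/eqP/setP=> x; move/setP/(_ x): E; rewrite !inE.
  by case: (x \in Z r); case: (x \in Z r'); rewrite //= ?andbF.
have [c _] : exists2 c, predT c & #|(predT : pred 'I_12)| * g c <= #|X i :&: R| - #|V|.
  apply: avg_le; first by rewrite card_ord.
  by rewrite sum_g; lia.
rewrite card_ord => gc.
exists (fun r => if r == i then c else f r), (fun r => if r == i then V else Z r).
split.
- move=> r; rewrite !inE; case: eqVneq => [-> _|_ /= rS]; first exact: subsetDl.
  exact: H1.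
- by move=> r; rewrite !inE; case: eqVneq => [-> _|_ /= rS] //; apply: H2.
- have dV r : r \in S -> [disjoint V & Z r].
    move=> rS; rewrite -setI_eq0; apply/eqP/setP=> x; rewrite !inE.
    apply/negP=> /andP[/andP[/negP xU _] xZ]; apply: xU; apply/bigcupP; exists r => //.
    by have := subsetP (H1 r rS) x xZ; rewrite inE => /andP[].
  move=> r r'; rewrite !inE; case: (eqVneq r i) => [->|_] /=; case: (eqVneq r' i) => [->|_] //=.
  + by move=> _ rS _; apply: dV.
  + by move=> rS _ _; rewrite disjoint_sym; apply: dV.
  + exact: H3.
rewrite big_setU1 //= eqxx cardsU1 iS add1n mulSn.
have -> : #|V :&: cov (i |: S) (fun r => if r == i then c else f r) i| = 0.
  apply/eqP; rewrite cards_eq0; apply/eqP/setP=> x; rewrite !inE.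
  apply/negP=> /andP[/andP[/negP xU _] /bigcupP[j]]; rewrite !inE.
  case/andP=> /orP[/eqP->|jS]; rewrite ?eqxx // => _ xj.
  by apply: xU; apply/bigcupP; exists j.
rewrite add0n.
have Hs : \sum_(r in S) #|(if r == i then V else Z r) :&:
     cov (i |: S) (fun r => if r == i then c else f r) r| <=
   \sum_(r in S) #|Z r :&: cov S f r| + g c.
  rewrite /g big_mkcondr -big_split /=; apply: leq_sum => r rS.
  rewrite (negbTE (ne r rS)).
  set E := (X in X <= _); have -> : E = #|Z r :&: cov (i |: S) (fun r => if r == i then c else f r) r| by [].
  case: (boolP (f r == c)) => frc.
    rewrite (leq_trans _ (leq_card_setU _ _)) //; apply: subset_leq_card.
    apply/subsetP=> x; rewrite !inE => /andP[xZ /bigcupP[j]]; rewrite xZ !inE.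
    case: (eqVneq j i) => [-> _ ->|ji /= /andP[jS /andP[jr]]]; first by rewrite orbT.
    rewrite (negbTE (ne r rS)) => fj xj; apply/orP; left.
    by apply/bigcupP; exists j; rewrite ?jS ?jr.
  rewrite addn0; apply: subset_leq_card.
  apply/subsetP=> x; rewrite !inE => /andP[xZ /bigcupP[j]]; rewrite xZ !inE.
  rewrite (negbTE (ne r rS)).
  case: (eqVneq j i) => [_|ji /= /andP[jS /andP[jr]]].
    by rewrite /= (eq_sym c) (negbTE frc) !andbF.
  by move=> fj xj; apply/bigcupP; exists j; rewrite ?jS ?jr.
apply: (leq_trans (leq_mul (leqnn _) Hs)).
have sm := small i; move: Hi sub gc H4 sm; rewrite expnS.
move: (\sum_(r in S) #|Z r :&: X i|) => q.
move: #|X i :&: R| #|V| (\sum_(r in S) _) (g c) (4 ^ a) => x v t u p Hi sub gc H4 sm.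
have : 12 * u + v <= x by lia.
move=> K; have K2 : p * (12 * u + v) <= p * x by rewrite leq_mul2l K orbT.
lia.
Qed.

(** Among [24 * 2 ^ a] sets, half have overlap at most [N / (8 * 4 ^ a)], and one colour contains
    [2 ^ a] of these. Their new parts exceed [N / (4 * 4 ^ a)], so each keeps a private part too
    large for [no_private]. *)
Lemma coloured_few S f Z : coloured S f Z -> #|S| < 24 * 2 ^ a.
Proof.
case=> H1 H2 H3 H4; rewrite ltnNge; apply/negP=> big.
pose W r := #|Z r :&: cov S f r|.
pose bad := [set r in S | N.+1 <= 8 * 4 ^ a * W r].
have Hb : #|bad| * N.+1 * 2 <= #|S| * N.
  have : #|bad| * N.+1 <= \sum_(r in S) 8 * 4 ^ a * W r by apply: markov.
  rewrite -big_distrr /=; move: H4; rewrite -/(W _) /W.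
  by move: (\sum_(r in S) _) (4 ^ a) => t p; nia.
have bS : bad \subset S by apply/subsetP=> r; rewrite inE => /andP[].
have Hg : 12 * 2 ^ a <= #|S :\: bad|.
  rewrite cardsD (setIidPr bS); nia.
have p0 : 0 < 2 ^ a by rewrite expn_gt0.
have [c _] : exists2 c : 'I_12, predT c & 12 * 2 ^ a <= #|(predT : pred 'I_12)| * #|[set r in S :\: bad | f r == c]|.
  apply: avg_ge; first by rewrite muln_gt0.
  apply: leq_trans Hg _; rewrite -sum1_card (partition_big f predT) //=.
  by apply: leq_sum => c _; rewrite sum1dep_card.
rewrite card_ord leq_pmul2l // => Hc.
have [J sJ cJ] := cards_subset_ex Hc.
have [i iJ] := no_private a0a cJ; apply/negP; rewrite -leqNgt.
have := subsetP sJ i iJ; rewrite !inE => /andP[/andP[ib iS] /eqP fi].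
rewrite iS /= -leqNgt in ib.
have s1 : Z i :\: cov S f i \subset X i :\: \bigcup_(j in J :\ i) X j.
  apply/subsetP=> x; rewrite !inE => /andP[xc xZ].
  have := subsetP (H1 i iS) x xZ; rewrite inE => /andP[-> _]; rewrite andbT.
  apply: contra xc => /bigcupP[j]; rewrite !inE => /andP[ji jJ] xj.
  have := subsetP sJ j jJ; rewrite !inE => /andP[/andP[_ jS] /eqP fj].
  by apply/bigcupP; exists j; rewrite ?jS ?ji ?fj ?fi ?eqxx.
have := subset_leq_card s1; rewrite cardsD -/(W i).
have := H2 i iS; move: ib; rewrite !expnS.
move: (W i) #|Z i| #|_ :\: _| (4 ^ a) => r z y p; nia.
Qed.

Lemma greedy_cover : exists S : {set I}, #|S| < 24 * 2 ^ a /\ forall i, #|(X i :&: R) :\: \bigcup_(j in S) X j| * 4 ^ a.+1 <= N.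
Proof.
have H k : (exists S f Z, coloured S f Z /\ #|S| = k) \/
   exists S f Z, coloured S f Z /\ forall i, #|(X i :&: R) :\: \bigcup_(j in S) X j| * 4 ^ a.+1 <= N.
  elim: k => [|k [[S [f [Z [H <-]]]]|]].
  - left; exists set0, (fun=> ord0), (fun=> set0); split; last by rewrite cards0.
    by split=> [i|i|i j|]; rewrite ?inE // big_set0 muln0.
  - case: (boolP [exists i, N < #|(X i :&: R) :\: \bigcup_(j in S) X j| * 4 ^ a.+1]).
      case/existsP=> i Hi; have [iS [f' [Z' H']]] := coloured_add H Hi.
      by left; exists (i |: S), f', Z'; rewrite cardsU1 iS.
    rewrite negb_exists => /forallP H'; right; exists S, f, Z; split=> // i.
    by rewrite leqNgt.
  - by right.
have [[S [f [Z [H1 H2]]]]|[S [f [Z [H1 H2]]]]] := H (24 * 2 ^ a).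
  by have := coloured_few H1; rewrite H2 ltnn.
by exists S; split=> //; apply: coloured_few H1.
Qed.

End Level.

(** One level uses fewer than [24 * 2 ^ a] sets of size at most [N / 4 ^ a], hence covers at most
    [24 * N / 2 ^ a] elements, and these bounds sum geometrically. When [k] reaches 0, [4 ^ a]
    exceeds [N] and nothing is left to cover. *)
Lemma cover_level k a R : N <= a + k -> a0 <= a -> (forall i, #|X i :&: R| * 4 ^ a <= N) ->
  #|R :&: \bigcup_i X i| * 2 ^ a <= 48 * N.
Proof.
elim: k a R => [|k IH] a R Nk a0a small.
  have E : R :&: \bigcup_i X i = set0.
    apply/setP=> x; rewrite !inE; apply/negP=> /andP[xR /bigcupP[i _ xi]].
    have := small i; have : 0 < #|X i :&: R| by apply/card_gt0P; exists x; rewrite inE xi.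
    have : a < 4 ^ a by apply: ltn_expl.
    by move: (4 ^ a) => p; nia.
  by rewrite E cards0.
have [S [cS HS]] := greedy_cover a0a small.
set U := \bigcup_(j in S) X j in HS.
have H1 : #|(R :\: U) :&: \bigcup_i X i| * 2 ^ a.+1 <= 48 * N.
  apply: IH; [lia|lia|] => i; rewrite setIDA; exact: HS.
have H2 : #|R :&: U| * 4 ^ a <= #|S| * N.
  apply: (@leq_trans (\sum_(j in S) #|X j :&: R| * 4 ^ a)); last first.
    by rewrite -sum_nat_const; apply: leq_sum.
  rewrite -big_distrl /= leq_mul2r; apply/orP; right.
  rewrite setIC /U; elim/big_rec2: _ => [|j y B _ IHB]; first by rewrite set0I cards0.
  rewrite setIUl; apply: leq_trans (leq_card_setU _ _) _; lia.
have H3 : #|R :&: \bigcup_i X i| <= #|R :&: U| + #|(R :\: U) :&: \bigcup_i X i|.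
  apply: leq_trans _ (leq_card_setU _ _); apply: subset_leq_card.
  by apply/subsetP=> x; rewrite !inE; case: (x \in U); case: (x \in R); rewrite //= ?orbF.
have e4 : 4 ^ a = 2 ^ a * 2 ^ a by rewrite -expnMn.
rewrite e4 in H2; rewrite expnS in H1.
by apply: cover_arith cS H1 H2 H3; rewrite expn_gt0.
Qed.

Lemma cover_bound : (forall i, #|X i| * 4 ^ a0 <= N) -> #|\bigcup_i X i| * 2 ^ a0 <= 48 * N.
Proof.
move=> H; rewrite -[\bigcup_i X i]setTI; apply: (@cover_level N) => //; first lia.
by move=> i; rewrite setIT.
Qed.

End Cover.

(** * Anticomplete connected pairs *)

Lemma geometric_sum (a : nat -> nat) X M : (forall m, m < M -> a m * 2 ^ m.+1 <= X) ->
  \sum_(m < M) a m <= X.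
Proof.
move=> H; suff K : (\sum_(m < M) a m) * 2 ^ M + X <= X * 2 ^ M.
  have : 0 < 2 ^ M by rewrite expn_gt0.
  move: K; move: (\sum_(m < M) a m) (2 ^ M) => s p; nia.
elim: M H => [|M IH] H; first by rewrite big_ord0 expn0 !muln1.
have {}IH := IH (fun m Hm => H m (ltnW Hm)).
have := H M (ltnSn M); rewrite big_ord_recr /= expnS.
move: IH; move: (\sum_(m < M) a m) (2 ^ M) => s p; lia.
Qed.

Section Tough.
Variables (G : sgraph) (d : nat).
Hypothesis mc : mincex G d.
Implicit Types (A B C S U W Y K L Q : {set G}) (x y z v : G).
Local Notation e := (@adj G).
Local Notation n := #|G|.
Local Notation al := (alf [set: G]).
Local Notation w := (omg [set: G]).

Lemma mixedI A x : x \in nb A -> x \notin com A -> mixed x A.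
Proof.
case/nbP=> a aA xa; rewrite inE negb_forall_in => /exists_inP[b bA xb].
by exists a, b; split.
Qed.

Lemma omg_seq (I : eqType) (s : seq I) (P : I -> {set G}) : uniq s ->
  (forall i j, i \in s -> j \in s -> i != j -> full (P i) (P j)) ->
  \sum_(i <- s) omg (P i) <= omg (\bigcup_(i <- s) P i).
Proof.
elim: s => [|i s IH] /=; first by rewrite !big_nil.
case/andP=> is_ us H; rewrite !big_cons.
apply: leq_trans (omgU _).
  by rewrite leq_add2l; apply: IH => // j k js ks; apply: H; rewrite inE ?js ?ks orbT.
move=> x y xi; elim: s is_ {us IH} H => [|j s IH]; first by rewrite big_nil inE.
rewrite inE negb_or => /andP[ij is_] H; rewrite big_cons inE => /orP[yj|ys].
  by apply: (H i j); rewrite ?inE ?eqxx ?orbT.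
apply: IH => // k l ks ls; apply: H.
  by move: ks; rewrite !inE => /orP[->|->]; rewrite ?orbT.
by move: ls; rewrite !inE => /orP[->|->]; rewrite ?orbT.
Qed.

Lemma omg_sum (I : finType) (J : {set I}) (P : I -> {set G}) :
  (forall i j, i \in J -> j \in J -> i != j -> full (P i) (P j)) ->
  \sum_(i in J) omg (P i) <= omg (\bigcup_(i in J) P i).
Proof.
move=> H; rewrite -!big_enum; apply: omg_seq; first exact: enum_uniq.
by move=> i j; rewrite !mem_enum; apply: H.
Qed.

(** Each member has clique number above [w / 2 ^ a], and over pairwise complete sets clique numbers
    add up, here beyond [w]. *)
Lemma full_family (I : finType) (J : {set I}) (P : I -> {set G}) a : 0 < a -> 2 ^ a <= #|J| ->
  (forall i j, i \in J -> j \in J -> i != j -> full (P i) (P j)) ->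
  (forall i, i \in J -> n <= #|P i| * 2 ^ (a * d)) -> False.
Proof.
move=> a0 cJ H1 H2.
have := leq_trans (omg_sum H1) (omg_w (\bigcup_(i in J) P i)).
have : \sum_(i in J) w.+1 <= \sum_(i in J) (omg (P i) * 2 ^ a).
  by apply: leq_sum => i iJ; apply: (mc_sizeN mc); rewrite ?H2.
rewrite sum_nat_const -big_distrl /=.
have : 0 < 2 ^ a by rewrite expn_gt0.
move: (\sum_(i in J) _) (2 ^ a) cJ => s p; nia.
Qed.

(** With [k = omg (com A)] this reads [#|A| <= (2 * n / d) * (k / w) ^ d.-1]. The dependence on [k]
    is kept because [remainder] later sorts components by [w / k]. *)
Definition thin A := (0 < omg (com A)) && (#|A| * d * w ^ d.-1 <= 2 * n * omg (com A) ^ d.-1).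

Lemma thinS A B : A \subset B -> thin B -> thin A.
Proof.
move=> sAB /andP[H1 H2]; have H3 := omgS (comS sAB).
rewrite /thin (leq_trans H1 H3) /=.
apply: leq_trans (leq_trans H2 _); last by rewrite leq_mul2l leq_expl ?orbT.
by rewrite -!mulnA leq_mul2r subset_leq_card // orbT.
Qed.

Definition far A B := [/\ conn e A, conn e B, anti A B & [disjoint A & B]] /\
  (A != set0) && (B != set0).

Lemma far_sym A B : far A B -> far B A.
Proof.
case=> [[H1 H2 H3 H4] H5]; split; last by rewrite andbC.
by split=> //; [apply: anti_sym|rewrite disjoint_sym].
Qed.

Definition saturated A B := forall z, z \notin A -> z \notin B -> (z \in nb A) = (z \in nb B).

Lemma far_add A B z : far A B -> z \notin A -> z \notin B -> z \in nb A -> z \notin nb B ->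
  far (z |: A) B.
Proof.
move=> [[H1 H2 H3 H4] /andP[H5 H6]] zA zB /nbP[a aA za] zB'; split; last first.
  by rewrite H6 andbT; apply/set0Pn; exists z; rewrite !inE eqxx.
split=> //.
- by apply: (connU1 (@adj_sym G) H1 aA); rewrite adj_sym.
- move=> x y; rewrite !inE => /orP[/eqP->|]; last by move=> xA yB; apply: H3.
  by move=> yB; apply: contra zB' => zy; apply/nbP; exists y.
by rewrite disjoints_subset subUset sub1set inE zB -disjoints_subset.
Qed.

Lemma far_saturate A B : far A B ->
  exists A' B', [/\ A \subset A', B \subset B', far A' B' & saturated A' B'].
Proof.
have [k] := ubnP (n + n - (#|A| + #|B|)); elim: k A B => // k IH A B Hk AB.
have mA (C : {set G}) : #|C| <= n by exact: max_card.
case: (boolP [exists z, [&& z \notin A, z \notin B & (z \in nb A) != (z \in nb B)]]); last first.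
  rewrite negb_exists => /forallP H; exists A, B; split=> // z zA zB.
  by have := H z; rewrite zA zB /= negbK => /eqP.
case/existsP=> z /and3P[zA zB]; case: (boolP (z \in nb A)) => zA'; case: (boolP (z \in nb B)) => zB' // _.
  have F := far_add AB zA zB zA' zB'.
  have [|A' [B' [s1 s2 H1 H2]]] := IH _ _ _ F.
    rewrite cardsU1 zA; have := mA (z |: A); have := mA B; rewrite cardsU1 zA; lia.
  exists A', B'; split=> //; apply: subset_trans s1; exact: subsetUr.
have F := far_add (far_sym AB) zB zA zB' zA'.
have [|A' [B' [s1 s2 H1 H2]]] := IH _ _ _ (far_sym F).
  rewrite cardsU1 zB; have := mA (z |: B); have := mA A; rewrite cardsU1 zB; lia.
exists A', B'; split=> //; apply: subset_trans s2; exact: subsetUr.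
Qed.

Lemma com_neqT A : A != set0 -> com A != setT.
Proof.
case/set0Pn=> a aA; apply/negP=> /eqP E.
have : a \in com A by rewrite E.
by move/comP/(_ a aA); rewrite adj_irr.
Qed.

Lemma omg_com A : omg (com A) + omg A <= w.
Proof. exact: leq_trans (omgU (@com_full G A)) (omg_w _). Qed.

(** [com A] and [com B] together separate [A] from the rest, and as [k] is the larger of their
    clique numbers, each has at most [al * k ^ d] vertices. Cliques of [A] extend by a [k]-clique of
    [com A], so [mc_gain] applies with this [k]; [al * w ^ d < n] then eliminates [al]. *)
Lemma saturated_thin A B : far A B -> saturated A B -> omg (com B) <= omg (com A) -> thin A.
Proof.
move=> [[cA cB AB dAB] /andP[A0 B0]] sat Hk; set k := omg (com A) in Hk *.
pose Y := com A :|: com B.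
have dY : [disjoint A & Y].
  rewrite -setI_eq0; apply/eqP/setP=> x; rewrite [RHS]inE inE; apply/negP=> /andP[xA].
  rewrite in_setU => /orP[/comP/(_ x xA)|]; first by rewrite adj_irr.
  case/set0Pn: B0 => b bB /comP/(_ b bB); apply/negP; exact: AB.
have aA : anti A (~: (Y :|: A)).
  move=> a c aA; rewrite !in_setC !in_setU !negb_or => /andP[/andP[cA' cB'] nA].
  apply/negP=> ac.
  have cB1 : c \notin B by apply: contraL ac => cB1; apply: AB.
  have cn : c \in nb A by apply/nbP; exists a => //; rewrite adj_sym.
  have cn' : c \in nb B by rewrite -sat.
  exact: (mc_M mc cA cB AB (mixedI cn cA') (mixedI cn' cB')).
have Hg : #|A| * d * k <= #|Y| * w.
  by apply: (mc_gain mc) => //; rewrite addnC; apply: omg_com.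
(* Otherwise both common neighbourhoods are empty and no edge leaves [A], although [G] is
   connected. *)
have k0 : 0 < k.
  rewrite lt0n; apply/eqP=> k0.
  have cz (C : {set G}) : omg C = 0 -> C = set0.
    by have [//|C0 H] := eqVneq C set0; have := omg_gt0 C0; rewrite H.
  have E : Y = set0 by rewrite /Y (cz _ k0) (cz (com B)) ?setU0 //; lia.
  rewrite E set0U in aA.
  have [] := mc_conn mc (subsetT A) A0.
    apply/eqP=> E'; case/set0Pn: B0 => b bB.
    by move: dAB; rewrite E' -setI_eq0 setTI => /eqP E2; rewrite E2 inE in bB.
  by move=> b [c [bA _ cA']]; apply/negP/aA => //; rewrite inE.
rewrite /thin -/k k0 /=.
have HY : #|Y| <= 2 * (al * k ^ d).
  apply: leq_trans (leq_card_setU _ _) _; rewrite mul2n -addnn; apply: leq_add.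
    exact: (mc_alomg mc (com_neqT A0)).
  apply: leq_trans (mc_alomg mc (com_neqT B0)) _.
  by rewrite leq_mul2l leq_expl ?orbT.
have := mc_big mc; have d0 := d_gt0 mc.
rewrite -(ltn_predK d0) in Hg HY *; move: d.-1 Hg HY => d' /= Hg HY.
rewrite !expnS in HY *; move: Hg HY k0; move: (k ^ d') (w ^ d') #|A| #|Y| => p q a y Hg HY k0 Hn.
suff : k * (a * d'.+1 * q) <= k * (2 * n * p) by rewrite leq_pmul2l.
have H1 : a * d'.+1 * k * q <= y * w * q by rewrite leq_mul2r Hg orbT.
have H2 : y * (w * q) <= 2 * (al * (k * p)) * (w * q) by rewrite leq_mul2r HY orbT.
have H3 : al * (w * q) * (2 * (k * p)) <= n * (2 * (k * p)) by rewrite leq_mul2r (ltnW Hn) orbT.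
lia.
Qed.

(* Enlarging a far pair until every outside vertex sees both sets or neither makes, by P5-freeness,
   every outside neighbour complete to one of them: few neighbours, hence a gain by minimality. *)
Lemma tough A B : far A B -> thin A \/ thin B.
Proof.
move=> /far_saturate[A' [B' [s1 s2 H1 H2]]].
case: (leqP (omg (com B')) (omg (com A'))) => H3.
  by left; apply: (thinS s1); apply: (saturated_thin H1).
right; apply: (thinS s2); apply: (saturated_thin (far_sym H1)); last exact: ltnW.
by move=> z zB zA; rewrite H2.
Qed.

(** If [com A] has more than half of the clique number, [A] has less than half and [mc_size]
    applies. Otherwise thinness gives the factor [2 ^ d.-1], and the factor [d] absorbs the
    constant. *)
Lemma thin_small A : thin A -> #|A| * 2 ^ d < n.
Proof.
move=> /andP[k0 H]; rewrite ltnNge; apply/negP=> big.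
have dd := mc_d mc.
set k := omg (com A) in k0 H.
have Hk : w < 2 * k.
  rewrite ltnNge; apply/negP=> kw.
  have K1 : (2 * k) ^ d.-1 <= w ^ d.-1 by apply: leq_expl.
  rewrite expnMn in K1.
  have d0 := d_gt0 mc; rewrite -{1}(ltn_predK d0) expnS in big.
  have p0 : 0 < k ^ d.-1 by rewrite expn_gt0 k0.
  have A0 : 0 < #|A|.
    by rewrite lt0n; apply: contraTneq big => ->; rewrite -ltnNge (mc_n0 mc).
  move: H big K1 p0; move: (k ^ d.-1) (w ^ d.-1) (2 ^ d.-1) #|A| A0 => p q r a A0 H big K1 p0.
  have H1 : a * d * (r * p) <= a * d * q by rewrite leq_mul2l K1 orbT.
  have H2 : n * (2 * p) <= a * (2 * r) * (2 * p) by rewrite leq_mul2r big orbT.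
  have r0 : 0 < r by have := mc_n0 mc; lia.
  have H3 : a * d * (r * p) <= a * 4 * (r * p) by lia.
  move: H3; rewrite leq_pmul2r ?muln_gt0 ?r0 // leq_pmul2l //; lia.
have : omg A * 2 ^ 1 <= w by have := omg_com A; rewrite expn1 -/k; lia.
by move/(mc_size mc (isT : 0 < 1)); rewrite mul1n ltnNge big.
Qed.

Lemma far_small A B : far A B -> n <= #|A| * 2 ^ d -> n <= #|B| * 2 ^ d -> False.
Proof. by case/tough=> /thin_small; rewrite ltnNge => /negP H ? ?; apply: H. Qed.

End Tough.

(** * Removing the closed neighbourhood of a connected set *)

Lemma level_arith u y n d a b c : u * d <= y * b -> y * c <= 48 * n -> a * b <= c ->
  48 <= d -> 0 < b -> u * a <= n.
Proof.
move=> H1 H2 H3 H4 b0.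
have K1 : u * d * c <= y * b * c by rewrite leq_mul2r H1 orbT.
have K2 : y * c * b <= 48 * n * b by rewrite leq_mul2r H2 orbT.
have K3 : u * d * (a * b) <= u * d * c by rewrite leq_mul2l H3 orbT.
have : b * (u * d * a) <= b * (48 * n) by lia.
rewrite leq_pmul2l // => K4.
have K5 : 48 * (u * a) <= d * (u * a) by rewrite leq_mul2r H4 orbT.
lia.
Qed.

Section Remainder.
Variables (G : sgraph) (d : nat).
Hypothesis mc : mincex G d.
Implicit Types (A B C S U W Y K L : {set G}) (x y z v : G).
Local Notation e := (@adj G).
Local Notation n := #|G|.
Local Notation al := (alf [set: G]).
Local Notation w := (omg [set: G]).
Local Notation es := (@adj_sym G).

Lemma comp_anti U z z' : z \in U -> z' \in U -> z' \notin component e U z ->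
  anti (component e U z) (component e U z').
Proof.
move=> zU zU' nz a b aC bC; apply: contra nz => ab.
have aU := subsetP (comp_sub _ zU) a aC; have bU := subsetP (comp_sub _ zU') b bC.
have bz : b \in component e U z by apply: (comp_closed zU aC bU ab).
by rewrite -(comp_eq es bz) (comp_eq es bC) mem_comp.
Qed.

Lemma comp_disj U z z' : z' \notin component e U z -> [disjoint component e U z & component e U z'].
Proof.
move=> nz; rewrite -setI_eq0; apply/eqP/setP=> b; rewrite inE [RHS]inE.
apply: contraNF nz => /andP[bz bz'].
by rewrite -(comp_eq es bz) (comp_eq es bz') mem_comp.
Qed.

Lemma comp_far U z z' : z \in U -> z' \in U -> z' \notin component e U z ->
  far (component e U z) (component e U z').
Proof.
move=> zU zU' nz; split; last by apply/andP; split; apply/set0Pn; [exists z|exists z']; apply: mem_comp.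
split; [exact: (comp_conn es)|exact: (comp_conn es)|exact: comp_anti|exact: comp_disj].
Qed.

Lemma clique_comp U K z : z \in U -> K \subset U -> clique K -> z \in K -> K \subset component e U z.
Proof.
move=> zU KU /cliqueP cK zK; apply/subsetP=> y yK.
have [->|yz] := eqVneq y z; first exact: mem_comp.
apply: (@comp_closed _ e U z z) => //; [exact: mem_comp|exact: (subsetP KU)|].
by apply: cK => //; rewrite eq_sym.
Qed.

(* A clique meets only one component, so its size is bounded through that component alone. *)
Lemma omg_comps U W k : U \subset W -> U != set0 ->
  (forall z, z \in U -> omg (component e W z) + k <= w) -> omg U + k <= w.
Proof.
move=> UW U0 H; have [K [KU cK <-]] := omg_ex U.
case: (set_0Vmem K) => [->|[z zK]].
  by case/set0Pn: U0 => z /H; rewrite cards0; lia.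
have zU := subsetP KU z zK; apply: leq_trans (H z zU); rewrite leq_add2r.
apply: clique_le => //; apply: clique_comp => //; first exact: (subsetP UW).
exact: subset_trans KU UW.
Qed.

Section FixQ.
Variables (Q : {set G}).
Hypothesis cQ : conn e Q.
Hypothesis Q0 : Q != set0.
Let Z := ~: (Q :|: nb Q).
Local Notation C := (component e Z).
Let X z := com (C z).

Lemma ZQ q z : q \in Q -> z \in Z -> ~~ e q z.
Proof.
move=> qQ; rewrite !inE negb_or => /andP[_]; apply: contra => qz.
by apply/exists_inP; exists q => //; rewrite es.
Qed.

Lemma nb_ZQ x z : z \in Z -> x \notin Z -> e x z -> (x \notin Q) && (x \in nb Q).
Proof.
move=> zZ xZ xz.
have xQ : x \notin Q by apply: contraL xz => xQ; apply: ZQ.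
by move: xZ; rewrite in_setC negbK in_setU (negbTE xQ) /= => ->.
Qed.

Lemma XnotZ x z : z \in Z -> x \in X z -> x \notin Z.
Proof.
move=> zZ /comP H; apply/negP=> xZ.
have xz := H z (mem_comp _ _ _).
have xC : x \in C z.
  by apply: (comp_closed zZ (mem_comp _ _ _) xZ); rewrite es.
by have := H x xC; rewrite adj_irr.
Qed.

Lemma XnbQ x z : z \in Z -> x \in X z -> (x \notin Q) && (x \in nb Q).
Proof.
move=> zZ xX; apply: (nb_ZQ zZ (XnotZ zZ xX)).
by move/comP: xX; apply; apply: mem_comp.
Qed.

(** Suppose [x], [x'] are nonadjacent, and let [B] be the component of [c'] among the non-neighbours
    of [x] in the connected set [R]. An edge leaves [B] inside [R], necessarily to a neighbour [a]
    of [x] in [Q]; then [a] is mixed on the anticomplete sets [[set x; c]] and [B]. *)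
Lemma X_full z z' x x' : z \in Z -> z' \in Z -> z' \notin C z ->
  x \in X z -> x \notin X z' -> x' \in X z' -> x' \notin X z -> e x x'.
Proof.
move=> zZ zZ' nz xX xX' x'X' x'X; apply: contraT => nxx'.
move: (x'X); rewrite inE negb_forall_in => /exists_inP[c cC x'c].
move: (xX'); rewrite inE negb_forall_in => /exists_inP[c' cC' xc'].
have cZ := subsetP (comp_sub _ zZ) c cC; have cZ' := subsetP (comp_sub _ zZ') c' cC'.
have /andP[xQ xnb] := XnbQ zZ xX; have /andP[xQ' xnb'] := XnbQ zZ' x'X'.
have xc : e x c by move/comP: xX; apply.
have xc'' : e x' c' by move/comP: x'X'; apply.
have cc' : ~~ e c c' by apply: (comp_anti zZ zZ' nz).
pose R := c' |: (x' |: Q).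
have cR : conn e R.
  case/nbP: xnb' => q qQ x'q.
  have c1 : conn e (x' |: Q) by apply: (connU1 es cQ qQ); rewrite es.
  by apply: (connU1 es c1 _ xc''); rewrite !inE eqxx.
pose D := R :\: N x.
have c'D : c' \in D by rewrite !inE eqxx xc'.
pose B := component e D c'.
case/nbP: xnb => q qQ xq.
have qR : q \in R by rewrite !inE qQ !orbT.
have c'R : c' \in R by rewrite !inE eqxx.
have qB : q \notin B.
  by apply: contraL xq => /(subsetP (comp_sub _ c'D)); rewrite !inE => /andP[].
have [b [a [bR bB aR aB ba]]] := conn_exit (P := mem B) cR c'R (mem_comp _ _ _) qR qB.
have aD : a \notin D.
  by apply: contra aB => aD; apply: (comp_closed c'D bB aD ba).
have xa : e x a by move: aD; rewrite inE aR andbT negbK inE.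
have aQ : a \in Q.
  move: aR; rewrite !inE => /or3P[/eqP E|/eqP E|//].
    by move: xc'; rewrite -E xa.
  by move: nxx'; rewrite -E xa.
case: (@mc_M _ _ mc a [set x; c] B) => //.
- exact: (conn2 es).
- exact: (comp_conn es).
- move=> y b' yy /(subsetP (comp_sub _ c'D)); rewrite !inE => /andP[xb' b'R].
  move: yy; rewrite !inE => /orP[/eqP->//|/eqP->].
  case/or3P: b'R => [/eqP->|/eqP->|b'Q] //; first by rewrite es.
  by rewrite es; apply: ZQ.
- by exists x, c; rewrite !inE !eqxx orbT; split=> //; [rewrite es|apply: ZQ].
- by exists b, c'; split=> //; [exact: mem_comp|rewrite es|apply: ZQ].
Qed.

(** Being mixed on [C z] and not complete to [C z'], the vertex [x] is anticomplete to [C z'];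
    symmetrically for [x']. Then [x] is mixed on [C z] and also on the connected union of [x'], [Q]
    and [C z'], which is anticomplete to [C z]. *)
Lemma X_escape z z' x x' : z \in Z -> z' \in Z -> z' \notin C z ->
  x \notin Z -> x \in nb (C z) -> x \notin X z -> x \notin X z' ->
  x' \notin Z -> x' \in nb (C z') -> x' \notin X z -> x' \notin X z' -> False.
Proof.
move=> zZ zZ' nz xZ xn xX xX' xZ' xn' x'X x'X'.
have cC : conn e (C z) by exact: (comp_conn es).
have cC' : conn e (C z') by exact: (comp_conn es).
have aC := comp_anti zZ zZ' nz.
have mx := mixedI xn xX; have mx' := mixedI xn' x'X'.
have nx y : y \in C z' -> ~~ e x y.
  move=> yC; apply/negP=> xy; apply: (mc_M mc cC cC' aC mx).
  by apply: mixedI => //; apply/nbP; exists y.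
have nx' y : y \in C z -> ~~ e x' y.
  move=> yC; apply/negP=> xy; apply: (mc_M mc cC cC' aC _ mx').
  by apply: mixedI => //; apply/nbP; exists y.
case/nbP: (xn) => c cC1 xc; case/nbP: (xn') => c' cC1' xc'.
have cZ := subsetP (comp_sub _ zZ) c cC1; have cZ' := subsetP (comp_sub _ zZ') c' cC1'.
have /andP[_ /nbP[q qQ xq]] := nb_ZQ cZ xZ xc.
have /andP[_ /nbP[q' qQ' xq']] := nb_ZQ cZ' xZ' xc'.
have cA : conn e ((x' |: Q) :|: C z').
  have c1 : conn e (x' |: Q) by apply: (connU1 es cQ qQ'); rewrite es.
  by apply: (connU es c1 cC' _ cC1' (a := x')); rewrite ?inE ?eqxx // xc' orbT.
apply: (mc_M mc cC cA _ mx).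
  move=> a b aC1; rewrite !in_setU in_set1 => /orP[/orP[/eqP->|bQ]|bC].
  - by rewrite es; apply: nx'.
  - by rewrite es; apply: ZQ bQ (subsetP (comp_sub _ zZ) a aC1).
  - exact: aC.
exists q, c'; split=> //; last exact: nx.
  by rewrite !in_setU qQ orbT.
by rewrite !in_setU cC1' orbT.
Qed.

Let k z := omg (X z).

Lemma k_comp z y : y \in C z -> k y = k z.
Proof. by move=> yz; rewrite /k /X (comp_eq es yz). Qed.

Section Level.
Variables (U : {set G}) (m : nat).
Hypothesis UZ : U \subset Z.
Hypothesis Ucl : forall z y, z \in U -> y \in C z -> y \in U.
Hypothesis m3 : 2 < m.
Hypothesis kU : forall z, z \in U -> (2 ^ m * k z <= w) && (w < 2 ^ m.+1 * k z).
Hypothesis thinU : forall z, z \in U -> thin d (C z).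

(** Extended by [set0] because [cover_bound] takes a family over a whole finite type. *)
Let Xm z := if z \in U then X z else set0.
Let Y := \bigcup_z Xm z.

(** Private parts of the sets [X z] are pairwise complete by [X_full], so [full_family] supplies the
    hypothesis of [cover_bound]. The starting level [(m * d)./2] corresponds to
    [#|X z| <= n / 2 ^ (m * d)]. *)
Lemma Y_small : #|Y| * 2 ^ (m * d)./2 <= 48 * n.
Proof.
have dd := mc_d mc.
have md : 2 * 2 <= m * d by nia.
apply: (@cover_bound _ _ Xm) => [a J aa cJ|z]; last first.
  rewrite /Xm; case: ifP => [zU|_]; last by rewrite cards0.
  have /andP[K _] := kU zU.
  have m0 : 0 < m by lia.
  have H : omg (X z) * 2 ^ m <= w by rewrite mulnC.
  apply: leq_trans (ltnW (mc_size mc m0 H)); rewrite leq_mul2l.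
  by rewrite (_ : 4 = 2 ^ 2) // -expnM leq_exp2l // mul2n -[X in _ <= X]odd_double_half leq_addl orbT.
have [//|H] : (exists2 i, i \in J & #|Xm i :\: \bigcup_(j in J :\ i) Xm j| * 4 ^ a.+2 < n) \/
   forall i, i \in J -> n <= #|Xm i :\: \bigcup_(j in J :\ i) Xm j| * 4 ^ a.+2.
  case: (boolP [exists i in J, #|Xm i :\: \bigcup_(j in J :\ i) Xm j| * 4 ^ a.+2 < n]).
    by case/exists_inP=> i; left; exists i.
  rewrite negb_exists_in => /forall_inP H; right=> i iJ; by rewrite leqNgt; apply: H.
have a2 : 2 <= a by apply: leq_trans aa; rewrite (half_leq md).
have mem i x : i \in J -> x \in Xm i :\: \bigcup_(j in J :\ i) Xm j ->
   [/\ i \in U, x \in X i & forall j, j \in J -> j != i -> x \notin Xm j].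
  move=> iJ; rewrite inE => /andP[H1]; rewrite /Xm; case: ifP; last by rewrite inE.
  move=> iU xi; split=> // j jJ ji; apply: contra H1 => xj.
  by apply/bigcupP; exists j; rewrite // !inE ji.
case: (@full_family _ _ mc _ J (fun i => Xm i :\: \bigcup_(j in J :\ i) Xm j) a).
- lia.
- by rewrite cJ.
- move=> i j iJ jJ ij x y /(mem i x iJ)[iU xi Hi] /(mem j y jJ)[jU yj Hj].
  have nij : y \notin X i by have := Hj i iJ ij; rewrite /Xm iU.
  have nji : x \notin X j by have := Hi j jJ; rewrite eq_sym /Xm jU => /(_ ij).
  apply: (X_full (subsetP UZ i iU) (subsetP UZ j jU)) => //.
  by apply: contra nji => jC; rewrite /X (comp_eq es jC).
move=> i iJ; apply: leq_trans (H i iJ) _.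
rewrite leq_mul2l (_ : 4 = 2 ^ 2) // -expnM leq_exp2l //; apply/orP; right; nia.
Qed.

Let U' := [set z in U | nb (C z) \subset Y :|: Z].

(** [U'] is a union of components separated from the rest by [Y], each complete to a clique of more
    than [w / 2 ^ m.+1] vertices; [k'] is the least integer above this ratio, and [mc_gain] applies
    with it. *)
Lemma U'_small : #|U'| * d <= #|Y| * 2 ^ m.+1.
Proof.
have U'U : U' \subset U by apply/subsetP=> z; rewrite inE => /andP[].
have [->|U'0] := eqVneq U' set0; first by rewrite cards0.
set k' := (w %/ 2 ^ m.+1).+1.
have Hk : w < 2 ^ m.+1 * k'.
  by rewrite mulnC -ltn_divLR ?expn_gt0.
have H : #|U'| * d * k' <= #|Y| * w.
  apply: (mc_gain mc).
  - rewrite disjoint_sym disjoints_subset; apply/subsetP=> x /bigcupP[z _].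
    rewrite /Xm; case: ifP => [zU xX|_]; last by rewrite inE.
    rewrite inE; apply: contra (XnotZ (subsetP UZ z zU) xX) => xU.
    by apply: (subsetP UZ); apply: (subsetP U'U).
  - move=> u c uU'; have := uU'; rewrite inE => /andP[uU sub].
    rewrite !in_setC in_setU negb_or => /andP[cY cU].
    apply/negP=> uc; have uZ := subsetP UZ u uU.
    have cn : c \in nb (C u) by apply/nbP; exists u; [exact: mem_comp|rewrite es].
    have := subsetP sub c cn; rewrite in_setU (negbTE cY) /= => cZ.
    have cC : c \in C u by apply: (comp_closed uZ (mem_comp _ _ _) cZ).
    case/negP: cU; rewrite inE (Ucl uU cC) /=.
    by rewrite (comp_eq es cC).
  apply: (omg_comps (W := Z)) => //; first exact: subset_trans UZ.
  move=> z /(subsetP U'U) zU; apply: leq_trans (omg_com (C z)); rewrite addnC leq_add2r.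
  have /andP[_ K] := kU zU.
  by rewrite -/(X z) -/(k z) /k' ltn_divLR ?expn_gt0 // mulnC.
have w0 := mc_w0 mc.
suff : w * (#|U'| * d) <= w * (#|Y| * 2 ^ m.+1) by rewrite leq_pmul2l.
have H2 : #|U'| * d * w <= #|U'| * d * (2 ^ m.+1 * k') by rewrite leq_mul2l (ltnW Hk) orbT.
have H3 : #|U'| * d * k' * 2 ^ m.+1 <= #|Y| * w * 2 ^ m.+1 by rewrite leq_mul2r H orbT.
by move: (2 ^ m.+1) H2 H3 => p; lia.
Qed.

Lemma thin_level z : z \in U -> #|C z| * 2 ^ (m * d.-1) <= n.
Proof.
move=> zU; have /andP[_] := thinU zU; rewrite -/(X z) -/(k z).
have /andP[K1 K2] := kU zU; have dd := mc_d mc => H.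
have k0 : 0 < k z by rewrite lt0n; apply: contraTneq K2 => ->; rewrite muln0.
have := leq_expl d.-1 K1; rewrite expnMn -expnM.
have p0 : 0 < k z ^ d.-1 by rewrite expn_gt0 k0.
move: H p0; move: (k z ^ d.-1) (w ^ d.-1) (2 ^ _) #|C z| => p q r c H p0 K.
have H1 : c * d * (r * p) <= c * d * q by rewrite leq_mul2l K orbT.
have : p * (d * (c * r)) <= p * (2 * n) by lia.
rewrite leq_pmul2l // => H3.
have : 2 * (c * r) <= d * (c * r) by rewrite leq_mul2r; apply/orP; right; lia.
lia.
Qed.

(** By [X_escape] two components cannot both have a neighbour outside [Y] and [Z]. So [U :\: U']
    sits in one component, whose size [thin_level] bounds. *)
Lemma Uexc z z' : z \in U :\: U' -> z' \in U :\: U' -> z' \in C z.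
Proof.
case/setDP=> zU H /setDP[zU' H']; rewrite inE zU /= in H; rewrite inE zU' /= in H'.
apply: contraT => nz.
case/subsetPn: H => x xn; rewrite in_setU negb_or => /andP[xY xZ].
case/subsetPn: H' => x' xn'; rewrite in_setU negb_or => /andP[xY' xZ'].
have nX u y : u \in U -> y \notin Y -> y \notin X u.
  by move=> uU; apply: contra => yX; apply/bigcupP; exists u; rewrite // /Xm uU.
by case: (X_escape (subsetP UZ z zU) (subsetP UZ z' zU') nz (x := x) (x' := x')) => //; apply: nX.
Qed.

Lemma level_small q : 7 * q <= d -> #|U| * 2 ^ (q + m) <= n.
Proof.
move=> qd; have dd := mc_d mc.
have H1 : #|U'| * 2 ^ (q + m).+1 <= n.
  have Y1 := Y_small; have U1 := U'_small.
  have md : q + m + m + 2 <= (m * d)./2.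
    have : 2 * (q + m + m + 2) <= m * d by nia.
    by move/half_leq; rewrite mul2n doubleK.
  have P : 2 ^ (q + m).+1 * 2 ^ m.+1 <= 2 ^ (m * d)./2.
    by rewrite -expnD leq_exp2l //; lia.
  have p0 : 0 < 2 ^ (m * d)./2 by rewrite expn_gt0.
  by apply: (level_arith U1 Y1 P); rewrite ?expn_gt0 //; lia.
have H2 : #|U :\: U'| * 2 ^ (q + m).+1 <= n.
  case: (set_0Vmem (U :\: U')) => [->|[z zU]]; first by rewrite cards0.
  have zU1 : z \in U by move: zU; rewrite inE => /andP[].
  apply: leq_trans (thin_level zU1); apply: leq_mul.
    by apply/subset_leq_card/subsetP=> y; apply: Uexc.
  by rewrite leq_exp2l //; nia.
have H3 : #|U| <= #|U'| + #|U :\: U'|.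
  by rewrite -(cardsID U' U) leq_add2r subset_leq_card ?subsetIr.
move: H1 H2 H3; rewrite expnS; move: (2 ^ _) #|U| #|U'| #|U :\: U'| => p a b c; nia.
Qed.

End Level.

(** By [tough] at most one component is not thin; it becomes [B]. Vertices in the others are sorted
    by [w / k z]. A ratio below 8 costs an eighth of the clique number, so [mc_frac] applies with
    [s = 7]; each dyadic level [m >= 3] is bounded by [n / 2 ^ (q + m)], and these sum to at most
    [n / 2 ^ q]. *)
Lemma remainder q : 7 * q <= d ->
  exists B, [/\ B \subset Z, conn e B, anti B (Z :\: B) & #|Z :\: B| * 2 ^ q <= 2 * n].
Proof.
move=> qd.
have [B [sB cB aB tB]] : exists B, [/\ B \subset Z, conn e B, anti B (Z :\: B) &
    forall z, z \in Z :\: B -> thin d (C z)].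
  case: (boolP [exists z in Z, ~~ thin d (C z)]) => [/exists_inP[z zZ nt]|].
    exists (C z); split; [exact: comp_sub|exact: (comp_conn es)| |].
      move=> a b aC; rewrite inE => /andP[bC bZ]; apply: contra bC => ab.
      exact: (comp_closed zZ aC bZ ab).
    move=> y; rewrite inE => /andP[yC yZ].
    by have [|//] := tough mc (comp_far zZ yZ yC); rewrite (negbTE nt).
  rewrite negb_exists_in => /forall_inP H; exists set0; split.
  - exact: sub0set.
  - exact: conn0.
  - by move=> a b; rewrite inE.
  - by move=> z; rewrite setD0 => zZ; have := H z zZ; rewrite negbK.
exists B; split=> //.
pose lev z := trunc_log 2 (w %/ k z).
pose U0 := [set z in Z :\: B | w < 8 * k z].
pose Um m := [set z in Z :\: B | (2 < m) && (lev z == m)].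
have closed z y : z \in Z :\: B -> y \in C z -> y \in Z :\: B.
  move=> zZB yC; have := zZB; rewrite inE => /andP[zB zZ].
  have yZ := subsetP (comp_sub _ zZ) y yC; rewrite inE yZ andbT.
  apply/negP=> yB.
  have [b [c [bC /= bB cC /= cnB bc]]] :=
    conn_exit (P := mem B) (@comp_conn _ _ es Z z) yC yB (mem_comp _ _ _) zB.
  have cZ := subsetP (comp_sub _ zZ) c cC.
  by have := aB b c bB; rewrite inE cnB cZ bc => /(_ isT).
have H0 : #|U0| * 2 ^ q <= n.
  apply: (@mc_frac _ _ mc U0 7) => //.
  have [->|U00] := eqVneq U0 set0; first by rewrite omg0 muln0.
  have U0Z : U0 \subset Z by apply/subsetP=> z; rewrite !inE => /andP[/andP[]].
  have : omg U0 + (w %/ 8).+1 <= w.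
    apply: (omg_comps (W := Z)) => // z; rewrite inE => /andP[_ K].
    apply: leq_trans (omg_com (C z)); rewrite addnC leq_add2r.
    by rewrite -/(X z) -/(k z) ltn_divLR // mulnC.
  have := divn_eq w 8; have := ltn_pmod w (isT : 0 < 8); lia.
have kz z : z \in Z :\: B -> 0 < k z.
  by move/tB=> /andP[].
have levP z : z \in Z :\: B -> (2 ^ lev z * k z <= w) && (w < 2 ^ (lev z).+1 * k z).
  move=> /kz k0; have kw : k z <= w by exact: omg_w.
  have q0 : 0 < w %/ k z by rewrite divn_gt0.
  have /andP[] := trunc_log_bounds (isT : 1 < 2) q0; rewrite -/(lev z).
  by rewrite leq_divRL // ltn_divLR // => -> ->.
have Hm m : #|Um m.+3| * 2 ^ (q + m.+3) <= n.
  apply: (@level_small (Um m.+3) m.+3) => //.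
  - by apply/subsetP=> z; rewrite !inE => /andP[/andP[]].
  - move=> z y; rewrite [in X in X -> _]inE => /andP[zZ /= lz] yC.
    by rewrite inE (closed z y zZ yC) /= /lev (k_comp yC).
  - by move=> z; rewrite inE => /andP[zZ /= /eqP<-]; apply: levP.
  - by move=> z; rewrite inE => /andP[/tB].
have cov : Z :\: B \subset U0 :|: \bigcup_(m < w) Um m.+3.
  apply/subsetP=> z zZ; rewrite in_setU inE zZ /=.
  case: ltnP => //= k8; apply/bigcupP.
  have l3 : 2 < lev z.
    have /andP[_ K] := levP z zZ; rewrite ltnNge; apply/negP=> l3.
    have : 2 ^ (lev z).+1 <= 2 ^ 3 by rewrite leq_exp2l.
    by have := kz z zZ; move: (2 ^ _) K => p; nia.
  have lw : lev z - 3 < w.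
    have /andP[K _] := levP z zZ; have := kz z zZ.
    have : lev z < 2 ^ lev z by apply: ltn_expl.
    by move: (2 ^ _) K => p; nia.
  by exists (Ordinal lw) => //; rewrite inE zZ /=; apply/eqP; lia.
have H1 : \sum_(m < w) #|Um m.+3| * 2 ^ q <= n.
  apply: (@geometric_sum (fun m => #|Um m.+3| * 2 ^ q)) => m _.
  apply: leq_trans (Hm m); rewrite -mulnA -expnD leq_mul2l leq_exp2l //.
  by apply/orP; right; lia.
apply: (@leq_trans ((#|U0| + \sum_(m < w) #|Um m.+3|) * 2 ^ q)).
  rewrite leq_mul2r; apply/orP; right.
  apply: leq_trans (leq_trans (subset_leq_card cov) (leq_card_setU _ _)) _.
  by rewrite leq_add2l; apply: card_bigcup.
by rewrite -big_distrl /= in H1; rewrite mulnDl mul2n -addnn leq_add.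
Qed.

End FixQ.
End Remainder.

(** * Dense sets and sparse non-neighbourhoods *)

Section Robust.
Variables (G : sgraph).
Hypothesis M5 : forall (z : G) (A B : {set G}), conn (@adj G) A -> conn (@adj G) B ->
  anti A B -> mixed z A -> mixed z B -> False.
Implicit Types (A B C S U Y Z K L Q : {set G}) (x y z v u : G).
Local Notation e := (@adj G).
Local Notation es := (@adj_sym G).

Lemma conn_sub_closed A B Z x : conn e A -> A \subset Z -> anti B (Z :\: B) ->
  x \in A -> x \in B -> A \subset B.
Proof.
move=> cA AZ aB xA xB; apply/subsetP=> y yA; apply: contraT => yB.
have [b [c [bA /= bB cA' /= cB bc]]] := conn_exit (P := mem B) cA xA xB yA yB.
by have := aB b c bB; rewrite inE cB (subsetP AZ) // bc => /(_ isT).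
Qed.

(** Common interface for two uses: the whole vertex set, where it follows from minimality, and a set
    without large pure pairs ([robust_of_no_pair]). Sets with fewer than [m] vertices count as
    negligible. *)
Record robust (W : {set G}) (m : nat) : Prop := Robust {
  rob_far : forall Q, Q \subset W -> conn e Q -> Q != set0 ->
    exists B, [/\ B \subset W :\: (Q :|: nb Q), conn e B,
                  anti B (W :\: (Q :|: nb Q) :\: B) & #|W :\: (Q :|: nb Q) :\: B| < m];
  rob_full : forall A B, A \subset W -> B \subset W -> full A B -> m <= #|A| -> #|B| < m;
  rob_anti : forall A B, A \subset W -> B \subset W -> conn e A -> conn e B -> anti A B ->
    [disjoint A & B] -> m <= #|A| -> #|B| < m }.

Variables (W : {set G}) (m : nat).
Hypothesis rob : robust W m.

Lemma m_gt0 : 0 < m.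
Proof.
have H : full (set0 : {set G}) set0 by move=> a b; rewrite inE.
have := rob_full rob (sub0set _) (sub0set _) H; rewrite cards0.
by case: (posnP m) => // -> /(_ isT).
Qed.

Lemma giant v : v \in W -> exists B, [/\ B \subset W :&: nN v, conn e B,
  anti B (W :&: nN v :\: B) & #|W :&: nN v :\: B| < m].
Proof.
move=> vW; have [|||B] := rob_far rob (Q := [set v]).
- by rewrite sub1set.
- exact: conn1.
- by apply/set0Pn; exists v; rewrite inE.
have -> : W :\: ([set v] :|: nb [set v]) = W :&: nN v; last by exists B.
apply/setP=> x; rewrite in_setI in_setD in_setU in_nN in_set1 andbC negb_or (eq_sym x).
congr (_ && (_ && ~~ _)); apply/nbP/idP=> [[y /set1P->]|xv]; first by rewrite es.
by exists v; rewrite ?inE // es.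
Qed.

Section FixV.
Variables (v : G) (B : {set G}).
Hypothesis vW : v \in W.
Hypothesis BZ : B \subset W :&: nN v.
Hypothesis cB : conn e B.
Hypothesis clB : anti B (W :&: nN v :\: B).
Hypothesis remB : #|W :&: nN v :\: B| < m.

Lemma Bv b : b \in B -> [/\ b \in W, v != b & ~~ e v b].
Proof. by move/(subsetP BZ); rewrite in_setI in_nN => /and3P[]. Qed.

Lemma conn_star L : L \subset N v -> conn e (v |: L).
Proof.
move=> LN; apply: (connUnb es); first exact: conn1.
by move=> b /(subsetP LN); rewrite in_N => vb; exists v; rewrite ?inE.
Qed.

Lemma nb_star L b : b \in nb (v |: L) -> e v b \/ b \in nb L.
Proof.
case/nbP=> a; rewrite !inE => /orP[/eqP->|aL] ba; [left|right]; first by rewrite es.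
by apply/exists_inP; exists a.
Qed.

Lemma star_giant L : L \subset W :&: N v -> exists B',
  [/\ B' \subset W :\: ((v |: L) :|: nb (v |: L)), conn e B',
      anti B' (W :\: ((v |: L) :|: nb (v |: L)) :\: B'),
      #|W :\: ((v |: L) :|: nb (v |: L)) :\: B'| < m &
      forall b, b \in B -> b \notin nb L -> b \in W :\: ((v |: L) :|: nb (v |: L))].
Proof.
rewrite subsetI => /andP[LW LN].
have [|||B' [H1 H2 H3 H4]] := rob_far rob (Q := v |: L).
- by rewrite subUset sub1set vW.
- exact: conn_star.
- by apply/set0Pn; exists v; rewrite !inE eqxx.
exists B'; split=> // b bB bL; have [bW vb nvb] := Bv bB.
rewrite in_setD bW andbT !in_setU in_set1 !negb_or eq_sym vb /=.
apply/andP; split; first by apply: contra nvb => /(subsetP LN); rewrite in_N.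
by apply/negP=> /nb_star[vb'|bL']; [rewrite vb' in nvb|rewrite bL' in bL].
Qed.

(** [z] is already mixed on an edge from [v] to [L], which is anticomplete to [B'], so it cannot be
    mixed on [B']. *)
Lemma nb_full L B' z : L \subset N v -> B' \subset W :\: ((v |: L) :|: nb (v |: L)) -> conn e B' ->
  v != z -> ~~ e v z -> z \in nb L -> z \in nb B' -> z \in com B'.
Proof.
move=> LN B'Z cB' vz nvz /nbP[x xL zx] zB'; apply: contraT => zc.
case: (M5 (z := z) (A := [set v; x]) _ cB' _ _ (mixedI zB' zc)).
- by apply: (conn2 es); have := subsetP LN x xL; rewrite in_N.
- move=> a b aa /(subsetP B'Z); rewrite in_setD in_setU negb_or => /andP[/andP[_ nb_] _].
  apply: contra nb_ => ab; apply/nbP; exists a; rewrite 1?es //.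
  by move: aa; rewrite !inE => /orP[->//|/eqP->]; rewrite xL orbT.
- by exists x, v; rewrite !inE !eqxx orbT; split=> //; rewrite es.
Qed.

(** The giant component [B'] off the star on [v |: L] lies inside [B] and has at least [m] vertices.
    Vertices of [B :&: nb L] with a neighbour in [B'] are complete to [B'] and form [E]; the others,
    with the star, form the connected set [A] anticomplete to [B']. Robustness makes both smaller
    than [m]. *)
Lemma star_dichotomy L : L \subset W :&: N v -> 3 * m <= #|B :\: nb L| ->
  #|L| < m /\ #|B :&: nb L| < 2 * m.
Proof.
move=> LWN big; have [B' [B'Z cB' clB' remB' inZ]] := star_giant LWN.
move: (LWN); rewrite subsetI => /andP[LW LN].
set Z := W :\: _ in B'Z clB' remB' inZ.
have m0 := m_gt0.
have H1 : B :\: nb L \subset (Z :\: B') :|: (B :&: B').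
  apply/subsetP=> b; rewrite inE => /andP[bL bB]; have bZ := inZ b bB bL.
  by rewrite in_setU in_setD in_setI bZ bB; case: (b \in B').
have H2 := leq_trans (subset_leq_card H1) (leq_card_setU _ _).
have H3 : 0 < #|B :&: B'| by lia.
have ZZ : Z \subset W :&: nN v.
  apply/subsetP=> z; rewrite in_setD !in_setU !negb_or in_set1 => /andP[/andP[/andP[zv _] zn] zW].
  rewrite in_setI zW in_nN eq_sym zv; apply: contra zn => vz.
  by apply/nbP; exists v; rewrite ?inE ?eqxx // es.
have B'B : B' \subset B.
  case/card_gt0P: H3 => x; rewrite inE => /andP[xB xB'].
  exact: (conn_sub_closed cB' (subset_trans B'Z ZZ) clB xB' xB).
have B'm : m <= #|B'| by have := subset_leq_card (subsetIr B B'); lia.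
have B'W : B' \subset W by apply: subset_trans B'Z (subsetDl _ _).
have aB' a b : a \in v |: L -> b \in B' -> ~~ e a b.
  move=> aL /(subsetP B'Z); rewrite in_setD in_setU negb_or => /andP[/andP[_ nb_] _].
  by apply: contra nb_ => ab; apply/nbP; exists a; rewrite 1?es.
pose R := [set z in B | [&& z \in nb L, z \notin B' & z \notin nb B']].
pose A := (v |: L) :|: R.
pose E := [set z in B | [&& z \in nb L, z \notin B' & z \in nb B']].
have RB : R \subset B by apply/subsetP=> z; rewrite inE => /andP[].
have EB : E \subset B by apply/subsetP=> z; rewrite inE => /andP[].
have BW : B \subset W by apply: subset_trans BZ (subsetIl _ _).
have HA : #|A| < m.
  apply: (rob_anti rob B'W _ cB') => //.
  - by rewrite !subUset sub1set vW LW (subset_trans RB BW).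
  - apply: (connUnb es); first exact: conn_star.
    move=> z; rewrite inE => /andP[_ /and3P[/nbP[x xL zx] _ _]]; exists x; last by rewrite es.
    by rewrite in_setU xL orbT.
  - apply: anti_sym => a b; rewrite in_setU => /orP[|aR]; first exact: aB'.
    move=> bB'; move: aR; rewrite inE => /andP[_ /and3P[_ _]]; apply: contra => ab.
    by apply/nbP; exists b.
  - rewrite disjoint_sym -setI_eq0; apply/eqP/setP=> x; rewrite in_setI [RHS]inE.
    apply/negP=> /andP[]; rewrite in_setU => /orP[xL|].
      by move/(subsetP B'Z); rewrite in_setD in_setU xL.
    by rewrite inE => /andP[_ /and3P[_ /negP]].
have HE : #|E| < m.
  apply: (rob_full rob B'W (subset_trans EB BW)) => //; apply: full_sym => z b zE.
  apply/comP; have zB := subsetP EB z zE; have [_ vz nvz] := Bv zB.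
  move: zE; rewrite inE => /andP[_ /and3P[zL _ zn]].
  exact: (nb_full LN B'Z cB' vz nvz zL zn).
split; first by apply: leq_ltn_trans HA; apply/subset_leq_card/subsetP=> x xL; rewrite !in_setU xL orbT.
have : B :&: nb L \subset A :|: E.
  apply/subsetP=> z; rewrite in_setI => /andP[zB zL].
  have zB' : z \notin B'.
    case/nbP: zL => x xL zx; apply: contraL zx => zB'; rewrite es; apply: aB' => //.
    by rewrite in_setU xL orbT.
  case zn: (z \in nb B'); apply/setUP; [right|left; apply/setUP; right].
    by rewrite inE zB zL zB' zn.
  by rewrite inE zB zL zB' zn.
move/subset_leq_card; have := leq_card_setU A E; move=> [K _]; lia.
Qed.

Definition Lset := [set x in W :&: N v | #|B :&: N x| < 2 * m].

(** Grow subsets of [Lset] one vertex at a time. A new vertex raises the number of hit vertices of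
    [B] from below [2 * m] to below [4 * m]; more than [3 * m] remain unhit, so [star_dichotomy]
    restores the bound [2 * m]. *)
Lemma Lset_small : 8 * m <= #|B| -> #|Lset| < m /\ #|B :&: nb Lset| < 2 * m.
Proof.
move=> B8; have m0 := m_gt0.
have LW : Lset \subset W :&: N v by apply/subsetP=> x; rewrite inE => /andP[].
have H k (L : {set G}) : #|L| = k -> L \subset Lset -> #|B :&: nb L| < 2 * m.
  elim: k L => [|k IH] L cL LL.
    rewrite (_ : B :&: nb L = set0) ?cards0; first lia.
    apply/setP=> x; rewrite in_setI [RHS]inE; apply/negP=> /andP[_ /nbP[y]].
    by move/eqP: cL; rewrite cards_eq0 => /eqP->; rewrite inE.
  have /card_gt0P[x xL] : 0 < #|L| by rewrite cL.
  have H1 : #|B :&: nb (L :\ x)| < 2 * m.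
    apply: IH; last by apply: subset_trans LL; exact: subD1set.
    by have := cardsD1 x L; rewrite xL cL; lia.
  have H2 : #|B :&: N x| < 2 * m by have := subsetP LL x xL; rewrite inE => /andP[].
  have H3 : #|B :&: nb L| <= #|B :&: nb (L :\ x)| + #|B :&: N x|.
    apply: leq_trans (leq_card_setU _ _); apply/subset_leq_card/subsetP=> z.
    rewrite in_setU !in_setI in_N => /andP[-> /nbP[y yL zy]] /=.
    have [E|yx] := eqVneq y x; first by rewrite -E es zy orbT.
    by apply/orP; left; apply/nbP; exists y; rewrite // !inE yx.
  have [|//] := star_dichotomy (subset_trans LL LW).
  by have := cardsID (nb L) B; lia.
have H1 := H _ Lset erefl (subxx _); split=> //.
have [|//] := star_dichotomy LW.
by have := cardsID (nb Lset) B; lia.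
Qed.

Lemma notL_big x : x \in W -> e v x -> x \notin Lset -> #|B :\: N x| < 3 * m.
Proof.
move=> xW vx xL; rewrite ltnNge; apply/negP=> H.
have E : nb [set x] = N x.
  apply/setP=> z; rewrite in_N; apply/nbP/idP=> [[y /set1P->]|xz]; first by rewrite es.
  by exists x; rewrite ?inE // es.
have [] := @star_dichotomy [set x]; rewrite ?E //.
  by rewrite sub1set in_setI xW in_N.
by move=> _ K; case/negP: xL; rewrite inE in_setI xW in_N vx.
Qed.

(** If [B] is large, a neighbour of [v] is in the small set [Lset] or misses fewer than [4 * m]
    non-neighbours of [v]. If [B] is small, [v] has fewer than [9 * m] non-neighbours in [W]. *)
Lemma few_missing_at : \sum_(x in W :&: N v) #|W :&: nN v :\: N x| <= 10 * m * #|W|.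
Proof.
have m0 := m_gt0.
have WN : #|W :&: N v| <= #|W| by rewrite subset_leq_card ?subsetIl.
have ZB : #|W :&: nN v| <= #|W :&: nN v :\: B| + #|B|.
  by rewrite -(cardsID B (W :&: nN v)) addnC leq_add2l subset_leq_card ?subsetIr.
case: (leqP (8 * m) #|B|) => B8; last first.
  apply: (@leq_trans (\sum_(x in W :&: N v) (9 * m))).
    apply: leq_sum => x _; apply: leq_trans (subset_leq_card (subsetDl _ _)) _; lia.
  rewrite sum_nat_const; nia.
have [L1 L2] := Lset_small B8.
rewrite (bigID (mem Lset)) /=.
have S1 : \sum_(x in W :&: N v | x \in Lset) #|W :&: nN v :\: N x| <= m * #|W|.
  apply: (@leq_trans (\sum_(x in Lset) #|W|)); last first.
    by rewrite sum_nat_const leq_mul2r ltnW ?orbT.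
  rewrite (eq_bigl (mem Lset)) => [|x]; last first.
    by apply: andb_idl; rewrite inE => /andP[].
  apply: leq_sum => x _; apply/subset_leq_card; apply: subset_trans (subsetDl _ _) _; exact: subsetIl.
have S2 : \sum_(x in W :&: N v | x \notin Lset) #|W :&: nN v :\: N x| <= 4 * m * #|W|.
  apply: (@leq_trans (\sum_(x in W :&: N v) (4 * m))); last by rewrite sum_nat_const mulnC leq_mul2l WN orbT.
  rewrite big_mkcondr; apply: leq_sum => x xx; case: ifP => // xL.
  move: xx; rewrite in_setI in_N => /andP[xW vx]; have K := notL_big xW vx xL.
  have : W :&: nN v :\: N x \subset (W :&: nN v :\: B) :|: (B :\: N x).
    by apply/subsetP=> z; rewrite in_setU !in_setD; case: (z \in B); case: (z \in N x); rewrite //= ?orbT ?orbF.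
  move/subset_leq_card; have [K2 _] := leq_card_setU (W :&: nN v :\: B) (B :\: N x); lia.
lia.
Qed.

End FixV.

Lemma few_missing v : v \in W -> \sum_(x in W :&: N v) #|W :&: nN v :\: N x| <= 10 * m * #|W|.
Proof.
by move=> vW; have [B [H1 H2 H3 H4]] := giant vW; apply: (@few_missing_at v B).
Qed.

(** Counts ordered pairs, so every edge inside [A] twice. *)
Definition edges_in (A : {set G}) := \sum_(u in A) #|A :&: N u|.

(** Both sides of the argument count triples [v], [u], [x] with [u], [x] adjacent and [v]
    nonadjacent to both; grouped by [u] they are the missing pairs of [few_missing]. *)
Lemma sum_edges : \sum_(v in W) edges_in (W :&: nN v) <= 10 * m * #|W| * #|W|.
Proof.
have H : \sum_(u in W) \sum_(x in W :&: N u) #|W :&: nN u :\: N x| <= 10 * m * #|W| * #|W|.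
  by rewrite mulnC -sum_nat_const; apply: leq_sum => u uW; apply: few_missing.
apply: leq_trans H.
have -> : \sum_(v in W) edges_in (W :&: nN v) =
   \sum_(u in W) \sum_(v in W :&: nN u) #|W :&: nN v :&: N u|.
  rewrite /edges_in (exchange_big_dep (mem W)) /=; last by move=> i j _; rewrite inE => /andP[].
  apply: eq_bigr => u uW; apply: eq_bigl => v; by rewrite !in_setI uW nNC.
apply: leq_sum => u uW.
have -> : \sum_(v in W :&: nN u) #|W :&: nN v :&: N u| =
  \sum_(v in W :&: nN u) #|[set x in W :&: N u | nadj v x]|.
  apply: eq_bigr => v _; congr #|pred_of_set _|; apply/setP=> x.
  by rewrite !inE; case: (x \in W); case: (e u x); rewrite /= ?andbT ?andbF.
rewrite dblcount; apply: leq_sum => x xx; apply/subset_leq_card/subsetP=> v.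
by rewrite !inE => /andP[-> /andP[_]]; rewrite andbT es.
Qed.

Lemma dense_or_cluster t : W != set0 ->
  #|[set v in W | #|W| <= #|W :&: nN v| * 2 ^ t]| * 2 ^ t < #|W| \/
  exists v, [/\ v \in W, #|W| <= #|W :&: nN v| * 2 ^ t &
    edges_in (W :&: nN v) <= 10 * m * #|W| * 2 ^ t].
Proof.
move=> W0; set X := [set v in W | _]; have W1 : 0 < #|W| by rewrite card_gt0.
case: ltnP => H; [by left|right].
have X0 : 0 < #|mem X| by move: H; rewrite -/(#|X|); case: #|X| => //; lia.
have [|v vX Hv] := @avg_le _ (fun v => edges_in (W :&: nN v)) (mem X) (10 * m * #|W| * #|W|) X0.
  apply: leq_trans sum_edges; rewrite [X in _ <= X](bigID (mem X)) /=.
  apply: leq_trans (leq_addr _ _); rewrite (eq_bigl (fun v => (v \in W) && (v \in X))) //.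
  by move=> v; rewrite !inE; case: (v \in W).
move: (vX); rewrite [mem X v]/= inE => /andP[vW big]; exists v; split=> //.
suff : #|W| * edges_in (W :&: nN v) <= #|W| * (10 * m * #|W| * 2 ^ t) by rewrite leq_pmul2l.
have K : #|W| * edges_in (W :&: nN v) <= #|X| * 2 ^ t * edges_in (W :&: nN v).
  by rewrite leq_mul2r H orbT.
have K2 : #|X| * edges_in (W :&: nN v) * 2 ^ t <= 10 * m * #|W| * #|W| * 2 ^ t by rewrite leq_mul2r Hv orbT.
by move: (2 ^ t) K K2 => p; lia.
Qed.

End Robust.

(** * Density of a minimal counterexample *)

Lemma exp_split a b : a <= b -> 2 ^ b = 2 ^ a * 2 ^ (b - a).
Proof. by move=> ab; rewrite -expnD subnKC. Qed.

(** Only exponents are compared, so large powers need not be evaluated. *)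
Lemma pow_split a b c e k : a + b + c + e = k -> 2 ^ a * 2 ^ b * 2 ^ c * 2 ^ e = 2 ^ k.
Proof. by move=> <-; rewrite !expnD. Qed.

Lemma robust_arith z m p q r : z * (p * q) <= 2 * r -> r < m.+1 * p -> 0 < m -> 0 < p -> 4 < q -> z < m.
Proof.
move=> H1 H2 m0 p0 q0; rewrite ltnNge; apply/negP=> mz.
have K1 : m * (p * q) <= z * (p * q) by rewrite leq_mul2r mz orbT.
have K2 : m * p * 5 <= m * p * q by rewrite leq_mul2l q0 orbT.
have K3 : p <= m * p by rewrite leq_pmull.
lia.
Qed.

Lemma card_big_arith a m p q r : r < m.+1 * p -> 0 < m -> m <= a -> 0 < q -> r <= a * (2 * p * q).
Proof.
move=> ltm m0 H q0.
have K1 : m.+1 * p <= 2 * a * p by rewrite leq_mul2r; apply/orP; right; lia.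
have K2 : 2 * a * p <= 2 * a * p * q by rewrite leq_pmulr.
lia.
Qed.

Lemma cluster_arith m n f p E r : m * (p * p * p * r) <= n -> n <= f * p -> 0 < p ->
  100 * 100 <= r -> E <= 10 * m * n * p -> 1000 * E <= f * f.
Proof.
move=> H1 H2 p0 r0 H3.
have K1 : n * (m * (p * p * p * r)) <= f * p * (f * p) by apply: leq_mul => //; apply: leq_trans H2.
have K2 : p * p * (n * m * p * r) <= p * p * (f * f) by lia.
rewrite leq_pmul2l ?muln_gt0 ?p0 // in K2.
have K3 : n * m * p * (100 * 100) <= n * m * p * r by rewrite leq_mul2l r0 orbT.
lia.
Qed.

Lemma half_arith m n f p r : m * (p * r) <= n -> n <= f * p -> 0 < p -> 1000 <= r -> 1000 * m <= f.
Proof.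
move=> H1 H2 p0 r0; have K : p * (m * r) <= p * f by lia.
rewrite leq_pmul2l // in K; have : 1000 * m <= r * m by rewrite leq_mul2r r0 orbT.
lia.
Qed.

Lemma dense_half x s n p : x * p < n -> 1 < p -> x + s = n -> n <= 2 * s.
Proof. by move=> H1 H2 H3; nia. Qed.

Lemma dense_deg a b s n p : b * (2 * p) < n -> n <= 2 * s -> a <= b -> a * p <= s.
Proof.
by move=> H1 H2 H3; have : a * p <= b * p; [rewrite leq_mul2r H3 orbT|lia].
Qed.

Section Dense.
Variables (G : sgraph) (d : nat).
Hypothesis mc : mincex G d.
Implicit Types (A B C S U W Y Z K L Q : {set G}) (x y z v u t : G).
Local Notation e := (@adj G).
Local Notation n := #|G|.
Local Notation al := (alf [set: G]).
Local Notation w := (omg [set: G]).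
Local Notation es := (@adj_sym G).

Lemma full_pair_small A B : full A B -> n <= #|A| * 2 ^ d -> n <= #|B| * 2 ^ d -> False.
Proof.
move=> AB nA nB.
apply: (@full_family _ _ mc _ [set: bool] (fun b => if b then A else B) 1) => //.
- by rewrite cardsT card_bool.
- by case=> [] [] _ _ // _; apply: full_sym.
- by case=> _; rewrite mul1n.
Qed.

(** The threshold is [n / 2 ^ 800] with [800 = 3 * 257 + 29]: [cluster_arith] consumes three factors
    [2 ^ 257] and a constant, for which [2 ^ 29] is ample. [remainder] is used with exponent 1400,
    well beyond 800 and still with [7 * 1400 <= d]. *)
Lemma V_robust : exists m,
  [/\ 0 < m, m * (2 ^ 257 * 2 ^ 257 * 2 ^ 257 * 2 ^ 29) <= n & robust [set: G] m].
Proof.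
have dd := mc_d mc; have nb_ := mc_nbig mc.
exists (n %/ 2 ^ 800).
have p0 : 0 < 2 ^ 800 by rewrite expn_gt0.
have m0 : 0 < n %/ 2 ^ 800.
  by rewrite divn_gt0 //; apply: leq_trans (ltnW nb_); rewrite leq_exp2l //; lia.
have ltm := ltn_ceil n p0.
have big A : n %/ 2 ^ 800 <= #|A| -> n <= #|A| * 2 ^ d.
  move=> H; have s : 801 <= d by lia.
  rewrite (exp_split s) (expnS 2 800); have : 0 < 2 ^ (d - 801) by rewrite expn_gt0.
  exact: card_big_arith ltm m0 H.
split; [exact: m0|by rewrite (@pow_split _ _ _ _ 800) ?leq_trunc_div|].
split.
- move=> Q _ cQ Q0; rewrite setTD.
  have q7 : 7 * 1400 <= d by lia.
  have [B [H1 H2 H3 H4]] := remainder mc cQ Q0 q7.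
  exists B; split=> //.
  have s : 800 <= 1400 by [].
  rewrite (exp_split s) in H4; apply: (robust_arith H4 ltm m0 p0).
  by apply: (@leq_trans (2 ^ 3)); rewrite ?leq_exp2l.
- move=> A B _ _ AB H; rewrite ltnNge; apply/negP=> H'.
  exact: (full_pair_small AB (big _ H) (big _ H')).
- move=> A B _ _ cA cB AB dAB H; rewrite ltnNge; apply/negP=> H'.
  apply: (far_small mc (A := A) (B := B)); [|exact: big|exact: big].
  by split=> //; rewrite -!card_gt0; apply/andP; split; apply: leq_trans m0 _.
Qed.

(** * Excluding a large sparse non-neighbourhood in the whole graph *)

Section Cluster.
Variables (v : G) (m : nat).
Local Notation F := (nN v).
Local Notation f := #|F|.
Hypothesis rob : robust [set: G] m.
Hypothesis fm : 1000 * m <= f.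
Hypothesis ed : 1000 * edges_in F <= f * f.

Let Y := [set z | f <= 2 * #|F :&: N z|].
Local Notation C := (component e (~: Y)).

Lemma f_big : 1000 <= f.
Proof. by have := m_gt0 rob; lia. Qed.

Lemma low_degree A : A \subset F -> f <= 10 * #|A| -> exists2 u, u \in A & 100 * #|F :&: N u| <= f.
Proof.
move=> AF A10; have f0 := f_big.
have A0 : 0 < #|mem A| by rewrite -/(#|A|); lia.
have [|u uA Hu] := @avg_le _ (fun u => #|F :&: N u|) (mem A) (edges_in F) A0.
  rewrite /edges_in [X in _ <= X](bigID (mem A)) /=; apply: leq_trans (leq_addr _ _).
  rewrite [X in _ <= X](eq_bigl (mem A)) // => x /=.
  by apply: andb_idl => /(subsetP AF).
exists u => //; suff : f * (100 * #|F :&: N u|) <= f * f by rewrite leq_pmul2l //; lia.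
have K : f * #|F :&: N u| <= 10 * #|A| * #|F :&: N u| by rewrite leq_mul2r A10 orbT.
move: ed K Hu; rewrite -/(#|A|); move: #|A| #|F :&: N u| f (edges_in F) => a b c g; lia.
Qed.

(** Otherwise [C t] contains a vertex [u] with few neighbours in [F], and the giant component [B']
    off the star of [u] and [L] contains half of [F]. [C t] meets [B'] and leaves it through some
    [z]. Neighbours of [u] outside [Y] all lie in [L], so [z] is nonadjacent to [u], and [nb_full]
    makes [z] complete to [B'], which puts it in [Y]. *)
Lemma cluster_comp t : t \notin Y -> 10 * #|C t :&: F| < f.
Proof.
move=> tY; rewrite ltnNge; apply/negP=> H; have f0 := f_big; have m0 := m_gt0 rob.
have tZ : t \in ~: Y by rewrite inE.
have [u uCF ulow] := low_degree (subsetIr (C t) F) H.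
move: (uCF); rewrite in_setI => /andP[uC uF].
have uT : u \in [set: G] by rewrite inE.
have [B [BZ cB clB remB]] := giant rob uT.
have H1 : f <= #|F :&: N u| + 1 + #|[set: G] :&: nN u :\: B| + #|F :&: B|.
  have s : F \subset (F :&: N u) :|: [set u] :|: ([set: G] :&: nN u :\: B) :|: (F :&: B).
    apply/subsetP=> x xF; rewrite !in_setU !in_setI in_setD in_setI in_setT in_N in_set1 xF in_nN /=.
    by rewrite (eq_sym x); case: (u == x) => //=; case: (e u x) => //=; case: (x \in B).
  apply: leq_trans (subset_leq_card s) _.
  apply: leq_trans (leq_card_setU _ _) _; rewrite leq_add2r.
  apply: leq_trans (leq_card_setU _ _) _; rewrite leq_add2r.
  by apply: leq_trans (leq_card_setU _ _) _; rewrite cards1.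
have FB : #|F :&: B| <= #|B| by rewrite subset_leq_card ?subsetIr.
have B8 : 8 * m <= #|B| by lia.
have [L1 L2] := Lset_small (mc_M mc) rob uT BZ clB remB B8.
set L := Lset _ m u B in L1 L2.
have LN : L \subset [set: G] :&: N u by apply/subsetP=> x; rewrite inE => /andP[].
have LN' : L \subset N u by apply: subset_trans LN (subsetIr _ _).
have NL x : e u x -> x \notin Y -> x \in L.
  move=> ux; apply: contraR => xL; rewrite inE.
  have xT : x \in [set: G] by rewrite inE.
  have K := notL_big (mc_M mc) rob uT BZ clB remB xT ux xL.
  have : #|F :&: B| <= #|B :\: N x| + #|F :&: N x|.
    apply: leq_trans (leq_card_setU _ _); apply/subset_leq_card/subsetP=> y.
    by rewrite !in_setU in_setD !in_setI => /andP[-> ->]; case: (y \in N x).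
  by move=> K2; clear - f0 fm ulow H1 remB K K2; lia.
have [B' [B'Z cB' clB' remB' inZ]] := star_giant rob uT BZ LN.
set Z := _ :\: _ in B'Z clB' remB' inZ.
have H2 : #|F :&: B| <= #|B :&: nb L| + #|Z :\: B'| + #|F :&: B'|.
  have s : F :&: B \subset (B :&: nb L) :|: (Z :\: B') :|: (F :&: B').
    apply/subsetP=> x; rewrite in_setI => /andP[xF xB].
    rewrite !in_setU !in_setI xF xB in_setD.
    by case: (boolP (x \in nb L)) => //= xL; rewrite (inZ x xB xL); case: (x \in B').
  apply: leq_trans (subset_leq_card s) _.
  apply: leq_trans (leq_card_setU _ _) _; rewrite leq_add2r.
  exact: leq_card_setU.
have fb : f <= 2 * #|F :&: B'| by clear - f0 fm ulow H1 H2 L2 remB remB'; lia.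
have [b0 b0C b0B'] : exists2 b, b \in C t & b \in B'.
  have : 0 < #|(C t :&: F) :&: (F :&: B')|.
    have := cardsUI (C t :&: F) (F :&: B').
    have : #|(C t :&: F) :|: (F :&: B')| <= f.
      by apply: subset_leq_card; rewrite subUset subsetIr subsetIl.
    by move=> K1 K2; clear - K1 K2 H H1 H2 f0 fm ulow L2 remB remB'; lia.
  case/card_gt0P=> b; rewrite !in_setI => /andP[/andP[bC _] /andP[_ bB']].
  by exists b.
have Q' a b : a \in u |: L -> b \in B' -> ~~ e a b.
  move=> aL /(subsetP B'Z); rewrite in_setD in_setU negb_or => /andP[/andP[_ nb_] _].
  by apply: contra nb_ => ab; apply/nbP; exists a; rewrite 1?es.
have uB' : u \notin B'.
  by apply/negP=> /(subsetP B'Z); rewrite in_setD !in_setU in_set1 eqxx.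
have [b [z [bC /= bB' zC /= zB' bz]]] :=
  conn_exit (P := mem B') (@comp_conn _ _ es (~: Y) t) b0C b0B' uC uB'.
have zY : z \notin Y by have := subsetP (comp_sub _ tZ) z zC; rewrite inE.
have zZ : z \notin Z.
  by apply/negP=> zZ; have := clB' b z bB'; rewrite in_setD zB' zZ bz => /(_ isT).
have zQ : z \notin u |: L by apply: contraL bz => zQ; rewrite es; apply: Q'.
move: zZ; rewrite in_setD in_setT andbT negbK in_setU (negbTE zQ) /= => zn.
have nuz : ~~ e u z.
  by apply: contra zQ => uz; rewrite in_setU (NL z uz zY) orbT.
have zL : z \in nb L by case: (nb_star zn) => // uz; rewrite uz in nuz.
have uz : u != z by apply: contraNneq zQ => <-; rewrite !inE eqxx.
have zb : z \in nb B' by apply/nbP; exists b; rewrite // es.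
have zc := nb_full (mc_M mc) LN' B'Z cB' uz nuz zL zb.
have : #|F :&: B'| <= #|F :&: N z|.
  apply/subset_leq_card/subsetP=> y; rewrite !in_setI in_N => /andP[-> yB'] /=.
  by move/comP: zc; apply.
move=> K; case/negP: zY; rewrite inE; apply: leq_trans fb _.
by rewrite leq_mul2l K.
Qed.

Lemma YF_small : 500 * #|F :&: Y| <= f.
Proof.
have f0 := f_big.
have H : \sum_(u in F :&: Y) #|F :&: N u| <= edges_in F.
  rewrite /edges_in [X in _ <= X](bigID (mem Y)) /=; apply: leq_trans (leq_addr _ _).
  by rewrite [X in _ <= X](eq_bigl (mem (F :&: Y))) // => x /=; rewrite in_setI.
have H2 : #|F :&: Y| * f <= 2 * edges_in F.
  rewrite -sum_nat_const; apply: (@leq_trans (\sum_(u in F :&: Y) 2 * #|F :&: N u|)).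
    by apply: leq_sum => u; rewrite in_setI [u \in Y]inE => /andP[].
  by rewrite -big_distrr /= leq_mul2l H orbT.
suff : f * (500 * #|F :&: Y|) <= f * f by rewrite leq_pmul2l //; lia.
move: ed H2; move: #|F :&: Y| f (edges_in F) => a b c; lia.
Qed.

Let cz z := [set t in F :\: Y | z \in com (C t)].

(** [z] sees half of [F]. At most a 500th of [F] lies in [Y], and the vertices [t] for which [z] is
    mixed on [C t] all lie in one component, hence form at most a tenth. *)
Lemma cz_big z : z \in Y -> 3 * f <= 10 * #|cz z|.
Proof.
move=> zY; have f0 := f_big; have yf := YF_small.
have zY' : f <= 2 * #|F :&: N z| by rewrite inE in zY.
pose R := [set t in F :\: Y | e z t && (z \notin com (C t))].
have s : F :&: N z \subset (F :&: Y) :|: cz z :|: R.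
  apply/subsetP=> t /setIP[tF]; rewrite in_N => zt.
  case: (boolP (t \in Y)) => tY; first by rewrite !in_setU in_setI tF tY.
  have tFY : t \in F :\: Y by rewrite in_setD tY tF.
  by rewrite !in_setU [t \in cz z]in_set [t \in R]in_set tFY zt; case: (z \in com (C t)); rewrite ?orbT.
have H1 : #|F :&: N z| <= #|F :&: Y| + #|cz z| + #|R|.
  apply: leq_trans (subset_leq_card s) _.
  apply: leq_trans (leq_card_setU _ _) _; rewrite leq_add2r.
  exact: leq_card_setU.
have H2 : 10 * #|R| <= f.
  case: (set_0Vmem R) => [->|[t tR]]; first by rewrite cards0.
  have mixR t' : t' \in R -> (t' \in ~: Y) /\ mixed z (C t').
    rewrite in_set in_setD => /andP[/andP[tY _] /andP[zt zc]]; split; first by rewrite inE.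
    by apply: mixedI => //; apply/nbP; exists t' => //; apply: mem_comp.
  have [tY tm] := mixR t tR; have tY' : t \notin Y by rewrite inE in tY.
  apply: leq_trans (ltnW (cluster_comp tY')); rewrite leq_mul2l /=.
  apply/subset_leq_card/subsetP=> t' tR'; have [tY1 tm1] := mixR t' tR'.
  rewrite in_setI; apply/andP; split; last by move: tR'; rewrite in_set in_setD => /andP[/andP[]].
  apply: contraT => nt.
  by case: (mc_M mc (@comp_conn _ _ es _ _) (@comp_conn _ _ es _ _) (comp_anti tY tY1 nt) tm tm1).
lia.
Qed.

(** Counting pairs between a maximum clique [K] of [Y] and [F :\: Y] gives a set [U] of at least
    [f / 5] vertices, a union of components off [Y], each complete to a tenth of [K]. Cliques of [U]
    thus fall short of [w] by a tenth of [kap], and only [Y] separates [U], so [mc_gain] applies. *)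
Lemma cluster_false p257 : p257 = 2 ^ 257 -> n <= f * p257 -> False.
Proof.
move=> -> nf; have f0 := f_big; have dd := mc_d mc.
have vY : v \notin Y.
  rewrite inE (_ : F :&: N v = set0) ?cards0; first by lia.
  by apply/setP=> x; rewrite in_setI in_N in_nN in_set0; case: (e v x); rewrite ?andbF.
have YT : Y != setT by apply: contraNneq vY => ->; rewrite inE.
have [K [KY cK]] := omg_ex Y; move kapE : (omg Y) => kap cardK.
have k0 : 0 < kap.
  rewrite lt0n; apply/eqP=> k0.
  have Y0 : Y = set0 by have [//|Y1] := eqVneq Y set0; have := omg_gt0 Y1; rewrite kapE k0.
  have := cluster_comp vY; rewrite Y0 setC0.
  have -> : component e setT v = setT.
    apply/eqP; rewrite eqEsubset subsetT /=; apply: conn_sub_comp => //.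
    exact: (mc_conn mc).
  by rewrite setTI; lia.
pose kt t := #|[set z in K | z \in com (C t)]|.
pose U := [set t in ~: Y | kap <= 10 * kt t].
have dbl : \sum_(z in K) #|cz z| = \sum_(t in F :\: Y) kt t.
  exact: (dblcount K (F :\: Y) (fun z t => z \in com (C t))).
have H1 : 3 * f * kap <= 10 * \sum_(t in F :\: Y) kt t.
  rewrite -dbl big_distrr /= -cardK mulnC -sum_nat_const.
  by apply: leq_sum => z /(subsetP KY); apply: cz_big.
have H2 : 10 * \sum_(t in F :\: Y) kt t <= 10 * #|U| * kap + f * kap.
  rewrite big_distrr /= (bigID (mem U)) /=; apply: leq_add.
    apply: (@leq_trans (\sum_(t in U) 10 * kap)); last by rewrite sum_nat_const; lia.
    rewrite big_mkcond [X in _ <= X]big_mkcond /=; apply: leq_sum => t _.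
    case: (t \in U); rewrite ?andbF // andbT; case: ifP => // _.
    by rewrite leq_mul2l /= -cardK; apply/subset_leq_card/subsetP=> z; rewrite in_set => /andP[].
  apply: (@leq_trans (\sum_(t in F) kap)); last by rewrite sum_nat_const.
  rewrite big_mkcond [X in _ <= X]big_mkcond /=; apply: leq_sum => t _.
  rewrite [t \in U]in_set in_setD in_setC; case: (t \in F); rewrite ?andbF //.
  by case: (t \in Y) => //=; case: (leqP kap (10 * kt t)) => K0 //=; lia.
have U5 : f <= 5 * #|U|.
  suff : kap * (2 * f) <= kap * (10 * #|U|) by rewrite leq_pmul2l //; lia.
  lia.
pose k := (kap + 9) %/ 10.
have k10 : kap <= 10 * k.
  rewrite /k; have := divn_eq (kap + 9) 10; have := ltn_pmod (kap + 9) (isT : 0 < 10); lia.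
have U0 : U != set0 by rewrite -card_gt0; lia.
have Hk : omg U + k <= w.
  apply: (omg_comps (W := ~: Y)) => //; first by apply/subsetP=> t; rewrite in_set => /andP[].
  move=> t; rewrite in_set => /andP[tY Ht].
  have : k <= kt t.
    rewrite /k; have := divn_eq (kap + 9) 10; move: (_ %/ 10) => q; lia.
  have : full [set z in K | z \in com (C t)] (C t).
    by move=> a b; rewrite in_set => /andP[_ /comP]; apply.
  move/omgU => H3 H4; have H5 := leq_trans H3 (omg_w _).
  have : kt t <= omg [set z in K | z \in com (C t)].
    apply: clique_le => //; apply/cliqueP=> a b; rewrite !in_set => /andP[aK _] /andP[bK _].
    by move/cliqueP: cK; apply.
  lia.
have Hg : #|U| * d * k <= #|Y| * w.
  apply: (mc_gain mc) => //.
    by rewrite disjoints_subset; apply/subsetP=> t; rewrite in_set => /andP[].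
  move=> a b; rewrite [a \in U]in_set => /andP[aY Ha]; rewrite in_setC in_setU negb_or => /andP[bY bU].
  apply: contra bU => ab; have bY' : b \in ~: Y by rewrite inE.
  have bC : b \in C a by apply: (comp_closed aY (mem_comp _ _ _) bY' ab).
  by rewrite in_set bY' /kt (comp_eq es bC).
(* If [kap] exceeds [w / 2], then [U] lacks a twentieth of the clique number, whence [s = 19].
   Otherwise minimality makes [Y] too small for the bound from [mc_gain]. *)
have [kw|kw] := leqP (2 * kap) w; last first.
  have q19 : 19 * 520 <= d by lia.
  have := mc_frac mc (U := U) (s := 19) isT _ q19 => /(_ _) K1.
  have {}K1 : #|U| * 2 ^ 520 <= n by apply: K1; lia.
  have s : 257 <= 520 by [].
  rewrite (exp_split s) in K1.
  have q0 : 2 ^ 3 <= 2 ^ (520 - 257) by rewrite leq_exp2l.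
  have p0 : 0 < 2 ^ 257 by rewrite expn_gt0.
  move: U0 nf K1 U5 q0 p0; rewrite -card_gt0.
  move: #|U| (2 ^ 257) (2 ^ (520 - 257)) => a p q a0 nf K1 U5 q0 p0.
  have L1 : f * p <= 5 * a * p by rewrite leq_mul2r U5 orbT.
  have L2 : a * p * 8 <= a * p * q by rewrite leq_mul2l q0 orbT.
  have L3 : 0 < a * p by rewrite muln_gt0 a0.
  lia.
have HY := mc_alomg mc YT; rewrite kapE in HY.
have d0 := d_gt0 mc; have Hn := mc_big mc.
have K1 := leq_expl d.-1 kw; rewrite expnMn in K1.
have q0 : 2 ^ 257 <= 2 ^ d.-1 by rewrite leq_exp2l //; lia.
have p0 : 0 < kap ^ d.-1 by rewrite expn_gt0 k0.
have p1 : 0 < 2 ^ 257 by rewrite expn_gt0.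
have dE : d = d.-1.+1 by rewrite (ltn_predK d0).
rewrite dE !expnS in HY Hn.
move: HY Hn K1 p0 p1 nf q0 U0; rewrite -card_gt0.
move: #|Y| (kap ^ _) (2 ^ 257) (2 ^ d.-1) (w ^ _) #|U| U5 Hg.
move=> y p r q g a U5 Hg HY Hn K1 p0 r0 nf q0 a0.
have L1 : a * d * kap * g <= a * d * (10 * k) * g by rewrite leq_mul2r leq_mul2l k10 !orbT.
have L2 : a * d * k * g <= y * w * g by rewrite leq_mul2r Hg orbT.
have L3 : y * (w * g) <= al * (kap * p) * (w * g) by rewrite leq_mul2r HY orbT.
have L4 : al * (w * g) * (kap * p) <= n * (kap * p) by rewrite leq_mul2r (ltnW Hn) orbT.
have L5 : kap * (a * d * g) <= kap * (10 * n * p) by lia.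
rewrite leq_pmul2l // in L5.
have L6 : a * d * (q * p) <= a * d * g by rewrite leq_mul2l K1 orbT.
have L7 : p * (a * d * q) <= p * (10 * n) by lia.
rewrite leq_pmul2l // in L7.
have L8 : f * r <= 5 * a * r by rewrite leq_mul2r U5 orbT.
have L9 : a * d * r <= a * d * q by rewrite leq_mul2l q0 orbT.
have L10 : a * r * d <= a * r * 50 by lia.
move: L10; rewrite leq_pmul2l ?muln_gt0 ?a0 //; lia.
Qed.

End Cluster.

Lemma V_cluster v m p c : robust [set: G] m -> p = 2 ^ 257 -> 100 * 100 <= c ->
  m * (p * p * p * c) <= n -> n <= #|nN v| * p -> edges_in (nN v) <= 10 * m * n * p -> False.
Proof.
move=> rob E c0 mn big ed; have p0 : 0 < p by rewrite E expn_gt0.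
apply: (cluster_false rob _ _ E big); last exact: (cluster_arith mn big p0 c0 ed).
apply: (@half_arith m n _ p (p * p * c)) => //; first by rewrite !mulnA in mn *.
by apply: leq_trans (leq_pmull _ _); rewrite ?muln_gt0 ?p0 //; lia.
Qed.

Lemma V_dense : exists S : {set G}, n <= 2 * #|S| /\
  forall v, v \in S -> #|S :&: nN v| * 2 ^ 256 <= #|S|.
Proof.
have [m [m0 mn rob]] := V_robust.
have T0 : [set: G] != set0 by rewrite -card_gt0 cardsT (mc_n0 mc).
have [D|[v [_ big ed]]] := dense_or_cluster (mc_M mc) rob 257 T0.
  set X := [set v in _ | _] in D; exists (~: X); rewrite cardsT in D.
  have c : n <= 2 * #|~: X|.
    apply: (dense_half D _ (cardsC X)).
    by rewrite -{1}(expn1 2) leq_exp2l.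
  split=> // v; rewrite in_setC in_set in_setT /= -ltnNge setTI cardsT (expnS 2 256) => H.
  by apply: (dense_deg H c); rewrite subset_leq_card ?subsetIr.
rewrite setTI cardsT in big ed.
have e2 : 100 * 100 <= 2 ^ 29.
  apply: (@leq_trans (2 ^ 7 * 2 ^ 7)); first by apply: leq_mul.
  by rewrite -expnD leq_exp2l.
by case: (V_cluster rob erefl e2 mn big ed).
Qed.

End Dense.

(** * Sets without large pure pairs *)

Section Greedy.
Variable G : sgraph.
Implicit Types (A B S K : {set G}) (x y z v u : G).
Local Notation e := (@adj G).
Local Notation es := (@adj_sym G).

Lemma greedy_arith s M j k t : t * M <= j * s -> j < k -> 2 * k <= M -> 2 * k <= s -> t + j < s.
Proof.
move=> H1 H2 H3 H4; rewrite ltnNge; apply/negP=> H5.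
have K1 : (2 * j + 2) * s <= M * s by rewrite leq_mul2r; apply/orP; right; lia.
have K2 : (2 * j + 2) * M <= s * M by rewrite leq_mul2r; apply/orP; right; lia.
have K3 : s * M <= (t + j) * M by rewrite leq_mul2r H5 orbT.
lia.
Qed.

Lemma greedy_clique S M k : (forall v, v \in S -> #|S :&: nN v| * M <= #|S|) ->
  2 * k <= M -> 2 * k <= #|S| -> k <= omg S.
Proof.
move=> H kM kS.
suff [K [KS cK <-]] : exists K : {set G}, [/\ K \subset S, clique K & #|K| = k] by apply: clique_le.
suff: forall j, j <= k -> exists K : {set G}, [/\ K \subset S, clique K & #|K| = j] by apply.
elim=> [|j IH] jk; first by exists set0; rewrite sub0set clique0 cards0.
have [K [KS cK cardK]] := IH (ltnW jk).
pose R := (\bigcup_(x in K) (S :&: nN x)) :|: K.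
have [x xS xR] : exists2 x, x \in S & x \notin R.
  apply/subsetPn; apply/negP=> /subset_leq_card; apply/negP; rewrite -ltnNge.
  apply: leq_ltn_trans (leq_card_setU _ _) _; rewrite cardK.
  apply: (@greedy_arith _ M _ k) => //.
  apply: (@leq_trans ((\sum_(x in K) #|S :&: nN x|) * M)).
    by rewrite leq_mul2r card_bigcup orbT.
  rewrite big_distrl /= -cardK -sum_nat_const; apply: leq_sum => x xK.
  by apply: H; apply: (subsetP KS).
move: xR; rewrite in_setU negb_or => /andP[xR xK].
have adjx y : y \in K -> e y x.
  move=> yK; apply: contraT => nyx; case/negP: xR; apply/bigcupP; exists y => //.
  by rewrite in_setI xS in_nN nyx andbT; apply: contraNneq xK => <-.
exists (x |: K); split.
- by rewrite subUset sub1set xS.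
- apply/cliqueP=> a b; rewrite !inE => /orP[/eqP->|aK] /orP[/eqP->|bK]; rewrite ?eqxx //.
  + by move=> _; rewrite es; apply: adjx.
  + by move=> _; apply: adjx.
  + by move/cliqueP: cK; apply.
- by rewrite cardsU1 xK cardK.
Qed.

End Greedy.

Section NoPair.
Variable G : sgraph.
Hypothesis M5 : forall (z : G) (A B : {set G}), conn (@adj G) A -> conn (@adj G) B ->
  anti A B -> mixed z A -> mixed z B -> False.
Implicit Types (A B C S U X Y Z K L Q : {set G}) (x y z v u : G).
Local Notation e := (@adj G).
Local Notation es := (@adj_sym G).
Variables (W : {set G}) (m : nat).
Hypothesis no_anti : forall A B, A \subset W -> B \subset W -> anti A B -> [disjoint A & B] ->
  m <= #|A| -> #|B| < m.
Hypothesis no_full : forall A B, A \subset W -> B \subset W -> full A B -> m <= #|A| -> #|B| < m.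

(** If all components are smaller than [m], take a smallest union [X] of components with at least
    [m] vertices. Dropping one component shows that [X] has fewer than [2 * m], and [no_anti] leaves
    fewer than [m] outside it. *)
Lemma giant_sub Z : Z \subset W ->
  exists B, [/\ B \subset Z, conn e B, anti B (Z :\: B) & #|Z :\: B| < 3 * m].
Proof.
move=> ZW.
have m0 : 0 < m.
  have H : anti (set0 : {set G}) set0 by move=> a b; rewrite inE.
  have := no_anti (sub0set _) (sub0set _) H; rewrite cards0 disjoints_subset sub0set.
  by case: (posnP m) => // -> /(_ isT isT).
pose cl X := (X \subset Z) && [forall a in X, forall b in Z :\: X, ~~ e a b].
have clP X : cl X -> anti X (Z :\: X).
  by case/andP=> _ /forall_inP H a b aX bX; have /forall_inP := H a aX; apply.
have cl_no X : cl X -> m <= #|X| -> #|Z :\: X| < m.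
  move=> cX; move: (cX) => /andP[XZ _]; apply: no_anti.
  - exact: subset_trans ZW.
  - by apply: subset_trans ZW; apply: subsetDl.
  - exact: clP.
  - by rewrite disjoints_subset; apply/subsetP=> x xX; rewrite !inE xX.
have cl_comp z : z \in Z -> cl (component e Z z).
  move=> zZ; rewrite /cl comp_sub //=; apply/forall_inP=> a aC; apply/forall_inP=> b.
  rewrite in_setD => /andP[bC bZ]; apply: contra bC => ab.
  exact: (comp_closed zZ aC bZ ab).
case: (ltnP #|Z| (3 * m)) => Z3.
  by exists set0; rewrite sub0set setD0; split=> //; [exact: conn0|move=> a b; rewrite inE].
case: (boolP [exists z in Z, m <= #|component e Z z|]) => [/exists_inP[z zZ big]|].
  exists (component e Z z); split; [exact: comp_sub|exact: (comp_conn es)| |].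
    exact/clP/cl_comp.
  by have := cl_no _ (cl_comp z zZ) big; lia.
rewrite negb_exists_in => /forall_inP small.
have clZ : cl Z && (m <= #|Z|).
  rewrite /cl subxx /=; apply/andP; split; last lia.
  by apply/forall_inP=> a _; apply/forall_inP=> b; rewrite setDv inE.
case: (@arg_minnP _ Z (fun X => cl X && (m <= #|X|)) (fun X => #|X|) clZ) => X /andP[cX Xm] minX.
have /card_gt0P[x xX] : 0 < #|X| by lia.
move: (cX) => /andP[XZ _]; have xZ := subsetP XZ x xX.
have aX := clP X cX.
have CX : component e Z x \subset X.
  apply: (conn_sub_closed (@comp_conn _ _ es Z x) (comp_sub _ xZ) aX (mem_comp _ _ _) xX).
have Cm : #|component e Z x| < m by have := small x xZ; rewrite -ltnNge.
have clXC : cl (X :\: component e Z x).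
  rewrite /cl (subset_trans (subsetDl _ _) XZ) /=; apply/forall_inP=> a.
  rewrite in_setD => /andP[aC aX']; apply/forall_inP=> b; rewrite !in_setD negb_and negbK.
  case/andP=> /orP[bC|bX] bZ; last by apply: aX; rewrite // in_setD bX.
  apply: contra aC => ab; apply: (comp_closed xZ bC); last by rewrite es.
  exact: (subsetP XZ).
have card_XC := cardsD X (component e Z x); rewrite (setIidPr CX) in card_XC.
have XCm : #|X :\: component e Z x| < m.
  rewrite ltnNge; apply/negP=> H; have := minX (X :\: component e Z x); rewrite clXC H => /(_ isT).
  have : 0 < #|component e Z x| by apply/card_gt0P; exists x; apply: mem_comp.
  have := subset_leq_card CX; lia.
have := cl_no X cX Xm; rewrite cardsD (setIidPr XZ).
have := subset_leq_card CX; lia.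
Qed.

Lemma robust_of_no_pair : robust W (3 * m).
Proof.
split.
- by move=> Q QW cQ Q0; apply: giant_sub; apply: subsetDl.
- by move=> A B AW BW AB H; have := no_full AW BW AB; lia.
- by move=> A B AW BW _ _ AB dAB H; have := no_anti AW BW AB dAB; lia.
Qed.

(** Three nested giant components: [B1] in [A], [B2] off the neighbours of some [v] in [B1], and
    [B3] off those of [x] too, where [x] in [B1] is reached by leaving [B2]. Leaving [B3] inside
    [B2] reaches some [y] adjacent to [x] and not to [v]. So [y] is mixed on the edge [v - x], hence
    complete to [B3], and has too many neighbours. *)
Lemma sparse_false A : A \subset W -> 100 * m <= #|A| -> 100 <= #|A| ->
  (forall u, u \in A -> 20 * #|A :&: N u| <= #|A|) -> False.
Proof.
move=> AW Am A100 low.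
have split_nN u X : X \subset A -> u \in A -> #|X| <= #|X :&: nN u| + #|A :&: N u| + 1.
  move=> XA uA; have s : X \subset (X :&: nN u) :|: (A :&: N u) :|: [set u].
    apply/subsetP=> x xX; rewrite !in_setU !in_setI in_nN in_N in_set1 xX (subsetP XA x xX) (eq_sym x).
    by case: (u == x); rewrite ?orbT //=; case: (e u x).
  apply: leq_trans (subset_leq_card s) _; apply: leq_trans (leq_card_setU _ _) _.
  by rewrite cards1 leq_add2r; apply: leq_card_setU.
have meet X X' : X \subset A -> X' \subset A -> #|A| < #|X| + #|X'| -> exists2 x, x \in X & x \in X'.
  move=> XA XA' H; have : 0 < #|X :&: X'|.
    have := cardsUI X X'; have : #|X :|: X'| <= #|A| by rewrite subset_leq_card // subUset XA.
    lia.
  by case/card_gt0P=> x /setIP[]; exists x.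
have [B1 [B1A cB1 clB1 remB1]] := giant_sub AW.
have cA := cardsD A B1; rewrite (setIidPr B1A) in cA.
have B1c := subset_leq_card B1A.
have /card_gt0P[v vB1] : 0 < #|B1| by clear - cA remB1 Am A100 B1c; lia.
have vA := subsetP B1A v vB1.
have Z1A : A :&: nN v \subset A by apply: subsetIl.
have [B2 [B2Z cB2 clB2 remB2]] := giant_sub (subset_trans Z1A AW).
have cZ1 := split_nN v A (subxx _) vA; have lv := low v vA.
have cB2' := cardsD (A :&: nN v) B2; rewrite (setIidPr B2Z) in cB2'.
have B2c := subset_leq_card B2Z.
have B2A : B2 \subset A by apply: subset_trans Z1A.
have [b0 b0B1 b0B2] : exists2 x, x \in B1 & x \in B2.
  by apply: meet => //; clear - cA remB1 Am A100 B1c cZ1 lv cB2' B2c remB2; lia.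
have B21 : B2 \subset B1 by apply: (conn_sub_closed cB2 B2A clB1 b0B2 b0B1).
have vB2 : v \notin B2.
  by apply/negP=> /(subsetP B2Z); rewrite in_setI in_nN eqxx andbF.
have [b [x [bB1 /= bB2 xB1 /= xB2 bx]]] := conn_exit (P := mem B2) cB1 b0B1 b0B2 vB1 vB2.
have xA := subsetP B1A x xB1.
have bv : ~~ e v b by have := subsetP B2Z b bB2; rewrite in_setI in_nN => /and3P[].
have xZ1 : x \notin A :&: nN v.
  by apply/negP=> xZ; have := clB2 b x bB2; rewrite in_setD xB2 xZ bx => /(_ isT).
have vx : e v x.
  move: xZ1; rewrite in_setI xA in_nN /= negb_and !negbK => /orP[/eqP E|//].
  by move: bv; rewrite E es bx.
have Z2A : A :&: nN v :&: nN x \subset A :&: nN v by apply: subsetIl.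
have [B3 [B3Z cB3 clB3 remB3]] := giant_sub (subset_trans Z2A (subset_trans Z1A AW)).
have cZ2 := split_nN x _ Z1A xA; have lx := low x xA.
have cB3' := cardsD (A :&: nN v :&: nN x) B3; rewrite (setIidPr B3Z) in cB3'.
have B3c := subset_leq_card B3Z.
have B3Z1 : B3 \subset A :&: nN v by apply: subset_trans Z2A.
have B3A : B3 \subset A by apply: subset_trans Z1A.
have [c0 c0B2 c0B3] : exists2 x, x \in B2 & x \in B3.
  by apply: meet => //; clear - Am A100 cZ1 lv cB2' B2c remB2 cZ2 lx cB3' B3c remB3; lia.
have B32 : B3 \subset B2 by apply: (conn_sub_closed cB3 B3Z1 clB2 c0B3 c0B2).
have inB3 z : z \in B3 -> ~~ e v z /\ ~~ e x z.
  by move/(subsetP B3Z); rewrite !in_setI !in_nN => /and3P[/andP[_ /andP[_ ->]] _ ->].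
have bB3 : b \notin B3 by apply/negP=> /inB3[_]; rewrite es bx.
have [c [y [cinB2 /= cB3'' yB2 /= yB3 cy]]] := conn_exit (P := mem B3) cB2 c0B2 c0B3 bB2 bB3.
have yZ1 := subsetP B2Z y yB2; have yA := subsetP B2A y yB2.
have yv : ~~ e v y by move: yZ1; rewrite in_setI in_nN => /and3P[].
have yZ2 : y \notin A :&: nN v :&: nN x.
  by apply/negP=> yZ; have := clB3 c y cB3''; rewrite in_setD yB3 yZ cy => /(_ isT).
have xy : e x y.
  move: yZ2; rewrite in_setI yZ1 in_nN /= negb_and !negbK => /orP[/eqP E|//].
  by rewrite E yB2 in xB2.
apply: (M5 (z := y) (A := [set v; x]) (conn2 es vx) cB3).
- by move=> a z; rewrite !inE => /orP[/eqP->|/eqP->] /inB3[].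
- by exists x, v; rewrite !inE !eqxx orbT; split=> //; rewrite es.
apply: mixedI; first by apply/nbP; exists c; rewrite // es.
apply/negP=> /comP yc; have ly := low y yA.
have : #|B3| <= #|A :&: N y|.
  by apply/subset_leq_card/subsetP=> z zB; rewrite in_setI (subsetP B3A) //= in_N yc.
by clear - ly Am A100 cZ1 lv cZ2 lx cB3' B3c remB3; lia.
Qed.

End NoPair.

(** * Shrinking along pure pairs *)

(* [sc_fine] says that [p] is the finest scale: no comparably large set is twice as dense on the
   logarithmic scale. *)
Record scale (G : sgraph) (d p : nat) (S : {set G}) : Prop := Scale {
  sc_mc : mincex G d;
  sc_p : 16 <= p;
  sc_w : 2 ^ (2 * p) <= omg [set: G];
  sc_dense : forall v, v \in S -> #|S :&: nN v| * 2 ^ (16 * p) <= #|S|;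
  sc_big : #|G| <= #|S| * 2 ^ (600 * p);
  sc_fine : forall S' : {set G}, #|G| <= #|S'| * 2 ^ (1200 * p) ->
    exists2 v, v \in S' & #|S'| < #|S' :&: nN v| * 2 ^ (32 * p) }.

Lemma pow_cancel a b x y : x * 2 ^ a <= y * 2 ^ b -> b <= a -> x * 2 ^ (a - b) <= y.
Proof.
move=> H ba; rewrite (exp_split ba) mulnCA mulnC leq_pmul2r ?expn_gt0 // in H.
Qed.

Lemma pow_trans a b c x y z : x * 2 ^ a <= y -> y <= z * 2 ^ b -> b + c <= a -> x * 2 ^ c <= z.
Proof.
move=> H1 H2 H; have K := leq_trans H1 H2.
have ba : b <= a by lia.
apply: leq_trans (pow_cancel K ba); rewrite leq_mul2l leq_exp2l //; apply/orP; right; lia.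
Qed.

Lemma rich_arith zz nc s u P Q Sg : 0 < zz -> u <= 16 * zz -> 68 * P <= Q -> 4 * P <= s ->
  zz * nc <= Sg -> Q * Q * Sg <= zz * s + Q * Q * zz + Q * u * s -> nc * (2 * P) <= s.
Proof.
move=> z0 uz PQ Ps H1 H2.
have [Q0|Q0] := posnP Q.
  have P0 : P = 0 by lia.
  by rewrite P0 !muln0.
have K1 : Q * Q * (zz * nc) <= Q * Q * Sg by rewrite leq_mul2l H1 orbT.
have K2 : Q * u * s <= Q * (16 * zz) * s by rewrite leq_mul2r leq_mul2l uz !orbT.
have K3 : zz * (Q * Q * nc) <= zz * (s + Q * Q + 16 * Q * s) by lia.
rewrite leq_pmul2l // in K3.
have K4 : s <= Q * s by rewrite leq_pmull.
have K5 : Q * (Q * nc) <= Q * (17 * s + Q) by lia.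
rewrite leq_pmul2l // in K5.
have K6 : Q * nc * (4 * P) <= (17 * s + Q) * (4 * P) by rewrite leq_mul2r K5 orbT.
have K7 : 68 * P * s <= Q * s by rewrite leq_mul2r PQ orbT.
have K8 : Q * (4 * P) <= Q * s by rewrite leq_mul2l Ps orbT.
have K9 : Q * (nc * (2 * P)) <= Q * s by lia.
by rewrite leq_pmul2l in K9.
Qed.

Lemma rate_arith k Z w z Q u P : k * Z <= w * z -> z * Q <= u -> u <= 8 * Z -> w < k.+1 * P ->
  0 < k -> 16 * P < Q -> 0 < u -> False.
Proof.
move=> H1 H2 H3 H4 k0 PQ u0.
have K1 : k * Q * u <= k * Q * (8 * Z) by rewrite leq_mul2l H3 orbT.
have K2 : k * Z * (8 * Q) <= w * z * (8 * Q) by rewrite leq_mul2r H1 orbT.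
have K3 : z * Q * (8 * w) <= u * (8 * w) by rewrite leq_mul2r H2 orbT.
have K4 : u * (k * Q) <= u * (8 * w) by lia.
rewrite leq_pmul2l // in K4.
have K5 : k.+1 * P <= 2 * k * P by rewrite leq_mul2r; apply/orP; right; lia.
have K6 : k * (16 * P).+1 <= k * Q by rewrite leq_mul2l PQ orbT.
lia.
Qed.

Lemma mincex_pow (G : sgraph) (d p : nat) : mincex G d -> 2 ^ (2 * p) <= omg [set: G] ->
  2 ^ (2 * p * d) < #|G|.
Proof.
move=> mc wp; apply: leq_ltn_trans (mc_big mc); rewrite expnM.
apply: (@leq_trans (omg [set: G] ^ d)); first exact: leq_expl.
rewrite leq_pmull // lt0n; apply/eqP=> a0; have /card_gt0P[x _] := mc_n0 mc.
have : #|[set x]| <= alf [set: G].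
  apply: stable_le => //; apply/stableP=> y z; rewrite !inE => /eqP-> /eqP->; by rewrite adj_irr.
by rewrite cards1 a0.
Qed.

Section Step.
Variables (G : sgraph) (d p : nat) (S : {set G}).
Hypothesis sc : scale d p S.
Let mc := sc_mc sc.
Implicit Types (A B C D U Y Z K L Q : {set G}) (x y z u t : G).
Local Notation e := (@adj G).
Local Notation n := #|G|.
Local Notation al := (alf [set: G]).
Local Notation w := (omg [set: G]).
Local Notation es := (@adj_sym G).

Lemma n_pow : 2 ^ (2 * p * d) < n.
Proof. exact: mincex_pow mc (sc_w sc). Qed.

Lemma pd_big : 10 * 1000 * p <= p * d.
Proof. by have := mc_d mc; rewrite mulnC leq_mul2l => H; apply/orP; right; lia. Qed.

Lemma card_pow U a : n <= #|U| * 2 ^ a -> forall c, a + c <= 2 * p * d -> 2 ^ c <= #|U|.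
Proof.
move=> H c ac; rewrite -[2 ^ c]mul1n.
apply: (@pow_trans (2 * p * d) a c 1 n #|U|) => //; rewrite mul1n; exact: ltnW n_pow.
Qed.

Lemma S_pow : 2 ^ (16 * p) <= #|S|.
Proof. by apply: (card_pow (sc_big sc)); have := pd_big; lia. Qed.

Definition NC A := S :\: com A.
Definition rich A := (w < omg A * 2 ^ p) && (#|NC A| * 2 ^ p.+1 <= #|S|).

Definition bad U q := [set x in S | #|U| <= #|U :&: nN x| * 2 ^ q].

Lemma bad_small U q : U \subset S -> U != set0 -> q <= 16 * p -> #|bad U q| * 2 ^ (16 * p - q) <= #|S|.
Proof.
move=> US U0 qp; rewrite -card_gt0 in U0.
have D : \sum_(x in S) #|U :&: nN x| = \sum_(u in U) #|S :&: nN u|.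
  have E (x : G) (V : {set G}) : #|V :&: nN x| = #|[set y in V | nadj x y]|.
    by congr #|pred_of_set _|; apply/setP=> y; rewrite !inE.
  under eq_bigr => x _ do rewrite E; rewrite dblcount.
  apply: eq_bigr => u _; rewrite E; congr #|pred_of_set _|; apply/setP=> y; rewrite !inE.
  by rewrite nadj_sym.
have D2 : (\sum_(x in S) #|U :&: nN x|) * 2 ^ (16 * p) <= #|U| * #|S|.
  rewrite D big_distrl /= -sum_nat_const; apply: leq_sum => u uU.
  by apply: (sc_dense sc); apply: (subsetP US).
have D3 : #|bad U q| * #|U| <= (\sum_(x in S) #|U :&: nN x|) * 2 ^ q.
  by rewrite big_distrl /=; apply: markov.
rewrite (exp_split qp) in D2.
have K : #|bad U q| * #|U| * 2 ^ (16 * p - q) <= (\sum_(x in S) #|U :&: nN x|) * 2 ^ q * 2 ^ (16 * p - q).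
  by rewrite leq_mul2r D3 orbT.
have : #|U| * (#|bad U q| * 2 ^ (16 * p - q)) <= #|U| * #|S|.
  by apply: leq_trans D2; rewrite mulnA (mulnC #|U|) -[X in _ <= X]mulnA in K *.
by rewrite leq_pmul2l.
Qed.

Lemma omg_le_comps U U0 q : U0 \subset U ->
  (forall z, z \in U0 -> omg (component e U z) * q <= w) -> omg U0 * q <= w.
Proof.
move=> UU H; have [K [KU cK <-]] := omg_ex U0.
case: (set_0Vmem K) => [->|[z zK]]; first by rewrite cards0.
have zU := subsetP KU z zK; apply: leq_trans (H z zU); rewrite leq_mul2r; apply/orP; right.
apply: clique_le => //; apply: clique_comp => //; first exact: (subsetP UU).
exact: subset_trans UU.
Qed.

(** A vertex outside [com (C z)] is nonadjacent to [z], equal to [z], or mixed on [C z]. Nonadjacent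
    pairs are rare by [sc_dense], and a vertex is mixed on at most one component, which is small;
    averaging over [Z] finds [z]. *)
Lemma rich_component U Z : U \subset S -> Z \subset U -> Z != set0 -> #|U| <= 16 * #|Z| ->
  (forall z, z \in Z -> #|component e U z| * 2 ^ (8 * p) <= #|U|) ->
  exists2 z, z \in Z & #|NC (component e U z)| * 2 ^ p.+1 <= #|S|.
Proof.
move=> US ZU Z0 Z16 small; rewrite -card_gt0 in Z0; have p16 := sc_p sc.
pose C := component e U.
have [z zZ Hz] := @avg_le _ (fun z => #|NC (C z)|) (mem Z) _ Z0 (leqnn _).
exists z => //; rewrite expnS; set Sg := (X in _ <= X) in Hz.
pose mx x := [set z in Z | e x z && (x \notin com (C z))].
have mxs x : #|mx x| * 2 ^ (8 * p) <= #|U|.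
  case: (set_0Vmem (mx x)) => [->|[t tm]]; first by rewrite cards0.
  have mixm t' : t' \in mx x -> (t' \in Z) /\ mixed x (C t').
    rewrite inE => /and3P[tZ xt xc]; split=> //; apply: mixedI => //.
    by apply/nbP; exists t' => //; apply: mem_comp.
  have [tZ tmx] := mixm t tm.
  apply: leq_trans (small t tZ); rewrite leq_mul2r; apply/orP; right.
  apply/subset_leq_card/subsetP=> t' tm'; have [tZ' tmx'] := mixm t' tm'.
  apply: contraT => nt.
  by case: (mc_M mc (@comp_conn _ _ es _ _) (@comp_conn _ _ es _ _)
    (comp_anti (subsetP ZU t tZ) (subsetP ZU t' tZ') nt) tmx tmx').
have HS : Sg <= \sum_(y in Z) #|S :&: nN y| + #|Z| + \sum_(x in S) #|mx x|.
  have -> : Sg = \sum_(y in Z) #|[set x in S | x \notin com (C y)]|.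
    by apply: eq_bigr => y _; congr #|pred_of_set _|; apply/setP=> x; rewrite !inE andbC.
  rewrite dblcount.
  have -> : \sum_(y in Z) #|S :&: nN y| = \sum_(x in S) #|[set y in Z | nadj y x]|.
    rewrite -dblcount; apply: eq_bigr => y _; congr #|pred_of_set _|; apply/setP=> x; by rewrite !inE.
  have -> : #|Z| = \sum_(x in S) #|[set y in Z | y == x]|.
    rewrite -dblcount -[LHS]sum1_card; apply: eq_bigr => y yZ; apply/esym/eqP.
    rewrite (_ : [set x in S | y == x] = [set y]) ?cards1 //; apply/setP=> x; rewrite !inE eq_sym.
    by apply: andb_idl => /eqP->; apply: (subsetP US); apply: (subsetP ZU).
  rewrite -!big_split /=; apply: leq_sum => x xS.
  apply: leq_trans (leq_add (leq_card_setU _ _) (leqnn _)).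
  apply: leq_trans (leq_card_setU _ _); apply/subset_leq_card/subsetP=> y.
  rewrite !in_setU !in_set => /andP[-> ->]; rewrite /nadj /= es.
  by case: (y == x); case: (e x y).
have D1 : (\sum_(y in Z) #|S :&: nN y|) * 2 ^ (16 * p) <= #|Z| * #|S|.
  rewrite big_distrl /= -sum_nat_const; apply: leq_sum => y yZ.
  by apply: (sc_dense sc); apply: (subsetP US); apply: (subsetP ZU).
have D2 : (\sum_(x in S) #|mx x|) * 2 ^ (8 * p) <= #|S| * #|U|.
  by rewrite big_distrl /= -sum_nat_const; apply: leq_sum.
have E16 : 2 ^ (16 * p) = 2 ^ (8 * p) * 2 ^ (8 * p) by rewrite -expnD -mulnDl.
have P1 : 68 * 2 ^ p <= 2 ^ (8 * p).
  apply: (@leq_trans (2 ^ 7 * 2 ^ p)); first by rewrite leq_mul2r orbC.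
  by rewrite -expnD leq_exp2l //; lia.
have P2 : 4 * 2 ^ p <= #|S|.
  apply: leq_trans S_pow; apply: (@leq_trans (2 ^ 2 * 2 ^ p)); first by [].
  by rewrite -expnD leq_exp2l //; lia.
apply: (rich_arith Z0 Z16 P1 P2 Hz); rewrite E16 in D1.
move: HS D1 D2; move: (2 ^ (8 * p)) (\sum_(y in Z) #|S :&: nN y|) (\sum_(x in S) #|mx x|) => Q a b HS D1 D2.
have L1 : Q * Q * Sg <= Q * Q * (a + #|Z| + b) by rewrite leq_mul2l HS orbT.
have L2 : Q * (b * Q) <= Q * (#|S| * #|U|) by rewrite leq_mul2l D2 orbT.
rewrite -/(#|Z|); lia.
Qed.

Variable v : G.
Hypothesis vS : v \in S.

Definition hit A := [set x in S | e v x && (x \notin com A)].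

Lemma hitS A B : A \subset B -> hit A \subset hit B.
Proof.
move=> AB; apply/subsetP=> x; rewrite [x \in hit A]in_set [x \in hit B]in_set => /and3P[-> -> xA] /=.
by apply: contra xA; apply: (subsetP (comS AB)).
Qed.

(* 1145 exceeds 600 (for [S]) + 32 (for the non-neighbours of [v]) + 2 * 256 (for the shrinking). *)
Variable W : {set G}.
Hypothesis WT : W \subset S :&: nN v.
Hypothesis Wbig : n <= #|W| * 2 ^ (1145 * p).

Let WS : W \subset S.
Proof. exact: subset_trans WT (subsetIl _ _). Qed.

Lemma W_nv y : y \in W -> (v != y) /\ ~~ e v y.
Proof. by move/(subsetP WT); rewrite in_setI in_nN => /and3P[]. Qed.

Lemma in_hit_nonadj x A : x \in hit A -> A \subset W -> [/\ e v x, x \in S & exists2 a, a \in A & ~~ e x a].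
Proof.
rewrite in_set => /and3P[xS vx]; rewrite in_set negb_forall_in => /exists_inP[a aA xa] _.
by split=> //; exists a.
Qed.

Lemma nonadj_nN x D : e v x -> D \subset W -> (forall y, y \in D -> ~~ e x y) -> D \subset nN x.
Proof.
move=> vx DW H; apply/subsetP=> y yD; rewrite in_nN H // andbT.
by apply: contraTneq vx => ->; have [_] := W_nv (subsetP DW y yD).
Qed.

(** Trim both sets to equal size. If an eighth of the union lies in small components, discard those
    of small clique number and use [rich_component]. Otherwise drop the small components: a vertex
    hitting both halves misses a vertex in each of two large components, is mixed on at most one, so
    is anticomplete to the other and thus [bad]. The hit sets are then almost disjoint and the
    smaller one is kept. *)
Lemma step_anti A B : A \subset W -> B \subset W -> anti A B -> [disjoint A & B] ->
  #|W| <= #|A| * 2 ^ 220 -> #|W| <= #|B| * 2 ^ 220 ->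
  (exists2 A' : {set G}, A' \subset W & rich A') \/
  exists W' : {set G}, [/\ W' \subset W, #|W| <= #|W'| * 2 ^ 221 &
    #|hit W'| * 2 ^ 1 * 2 ^ (8 * p) <= #|hit W| * 2 ^ (8 * p) + #|S| * 2 ^ 1].
Proof.
move=> AW BW AB dAB cA cB; have p16 := sc_p sc; have pd := pd_big.
have [A1 [B1 [h [sA1 sB1 cA1 cB1 Wh]]]] : exists (A1 B1 : {set G}) h,
    [/\ A1 \subset A, B1 \subset B, #|A1| = h, #|B1| = h & #|W| <= h * 2 ^ 220].
  case: (leqP #|A| #|B|) => H.
    by have [B1 sB1 cB1] := cards_subset_ex H; exists A, B1, #|A|; split.
  by have [A1 sA1 cA1] := cards_subset_ex (ltnW H); exists A1, B, #|B|; split.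
have AW1 := subset_trans sA1 AW; have BW1 := subset_trans sB1 BW.
have AB1 : anti A1 B1 by apply: antiS AB _ _.
pose U := A1 :|: B1; pose C := component e U.
have UW : U \subset W by rewrite subUset AW1.
have US : U \subset S by apply: subset_trans UW WS.
have dAB1 : A1 :&: B1 = set0.
  by apply/eqP; rewrite setI_eq0; apply: disjointWl sA1 _; apply: disjointWr sB1 _.
have cU : #|U| = 2 * h by rewrite cardsU dAB1 cards0 cA1 cB1 subn0 mul2n addnn.
have h0 : 0 < h.
  rewrite lt0n; apply/eqP=> h0; rewrite h0 mul0n leqn0 in Wh.
  by have := mc_n0 mc; move: Wbig; rewrite (eqP Wh) mul0n; case: n.
have U0 : U != set0 by rewrite -card_gt0 cU muln_gt0 h0.
pose Zs := [set z in U | #|C z| * 2 ^ (8 * p) < #|U|].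
have ZsU : Zs \subset U by apply/subsetP=> z; rewrite in_set => /andP[].
have nh : n <= h * 2 ^ (1145 * p + 220).
  rewrite expnD mulnCA mulnC; apply: leq_trans Wbig _; by rewrite leq_mul2r Wh orbT.
case: (leqP #|U| (8 * #|Zs|)) => Z8; [left|right].
  pose Poor := [set z in Zs | omg (C z) * 2 ^ p <= w].
  have PZ : Poor \subset Zs by apply/subsetP=> z; rewrite in_set => /andP[].
  have HP : #|Poor| * 2 ^ (p * d) < n.
    apply: (mc_size mc); first by clear - p16; lia.
    apply: (@omg_le_comps U); first exact: subset_trans ZsU.
    by move=> z; rewrite in_set => /andP[].
  have HP2 : #|Poor| * 2 ^ 3 <= h.
    by apply: (pow_trans (ltnW HP) nh); clear - pd p16; lia.
  have cZ' := cardsD Zs Poor; rewrite (setIidPr PZ) in cZ'.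
  have cP := subset_leq_card PZ.
  have [|||z zZ Hz] := @rich_component U (Zs :\: Poor) US (subset_trans (subsetDl _ _) ZsU).
  - by rewrite -card_gt0; clear - cZ' cP HP2 Z8 cU h0; lia.
  - by clear - cZ' cP HP2 Z8 cU h0; lia.
  - by move=> z; rewrite in_setD => /andP[_]; rewrite in_set => /andP[_ /ltnW].
  move: zZ; rewrite in_setD => /andP[zP zZ].
  have zU := subsetP ZsU z zZ.
  exists (C z); first by apply: subset_trans UW; apply: comp_sub.
  rewrite /rich Hz andbT; move: zP; rewrite in_set zZ /=; by rewrite -ltnNge.
pose A' := A1 :\: Zs; pose B' := B1 :\: Zs.
have A'W : A' \subset W by apply: subset_trans AW1; apply: subsetDl.
have B'W : B' \subset W by apply: subset_trans BW1; apply: subsetDl.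
have big D : #|D| = h -> h <= 2 * #|D :\: Zs|.
  move=> cD; have K1 := cardsID Zs D; have K2 := subset_leq_card (subsetIr D Zs).
  by clear - K1 K2 Z8 cU cD; lia.
have size D : #|D| = h -> #|W| <= #|D :\: Zs| * 2 ^ 221.
  move=> /big bD; rewrite (expnS 2 220) mulnA (mulnC _ 2).
  by apply: leq_trans Wh _; rewrite leq_mul2r bD orbT.
have inter : hit A' :&: hit B' \subset bad U (8 * p).
  apply/subsetP=> x /setIP[xA xB].
  have [vx xS [a aA xa]] := in_hit_nonadj xA A'W.
  have [_ _ [b bB xb]] := in_hit_nonadj xB B'W.
  move: aA bB; rewrite !in_setD => /andP[aZ aA] /andP[bZ bB].
  have aU : a \in U by rewrite in_setU aA.
  have bU : b \in U by rewrite in_setU bB orbT.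
  have nab : b \notin C a.
    have clA : anti A1 (U :\: A1).
      by move=> s t sA; rewrite in_setD in_setU => /andP[/negbTE->]; apply: AB1.
    have CA : C a \subset A1.
      by apply: (conn_sub_closed (@comp_conn _ _ es U a) (comp_sub _ aU) clA (mem_comp _ _ _) aA).
    apply/negP=> /(subsetP CA) bA; move/setP/(_ b): dAB1; by rewrite in_setI bA bB inE.
  have bigC z : z \in U -> z \notin Zs -> #|U| <= #|C z| * 2 ^ (8 * p).
    by move=> zU; rewrite in_set zU /= -leqNgt.
  have fin z : z \in U -> z \notin Zs -> (forall y, y \in C z -> ~~ e x y) -> x \in bad U (8 * p).
    move=> zU zZ H; rewrite in_set xS /=; apply: leq_trans (bigC z zU zZ) _.
    rewrite leq_mul2r; apply/orP; right; apply/subset_leq_card; rewrite subsetI comp_sub //=.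
    by apply: nonadj_nN => //; apply: subset_trans UW; apply: comp_sub.
  have mixedC z : z \in U -> ~~ e x z -> ~~ [forall y in C z, ~~ e x y] -> mixed x (C z).
    move=> zU xz; rewrite negb_forall_in => /exists_inP[y yC]; rewrite negbK => xy.
    by exists y, z; split=> //; apply: mem_comp.
  case: (boolP [forall y in C a, ~~ e x y]) => [/forall_inP|na]; first exact: fin.
  case: (boolP [forall y in C b, ~~ e x y]) => [/forall_inP|nb_]; first exact: fin.
  by case: (mc_M mc (@comp_conn _ _ es _ _) (@comp_conn _ _ es _ _) (comp_anti aU bU nab)
    (mixedC a aU xa na) (mixedC b bU xb nb_)).
have sum : #|hit A'| + #|hit B'| <= #|hit W| + #|bad U (8 * p)|.
  rewrite -cardsUI; apply: leq_add; last exact: subset_leq_card.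
  by apply: subset_leq_card; rewrite subUset !hitS.
have bs : #|bad U (8 * p)| * 2 ^ (8 * p) <= #|S|.
  have q : 8 * p <= 16 * p by rewrite leq_mul2r orbT.
  by have := bad_small US U0 q; rewrite -mulnBl.
have fin (x : nat) : 2 * x <= #|hit A'| + #|hit B'| ->
   x * 2 ^ 1 * 2 ^ (8 * p) <= #|hit W| * 2 ^ (8 * p) + #|S| * 2 ^ 1.
  rewrite expn1 => H; have K : 2 * x <= #|hit W| + #|bad U (8 * p)| by apply: leq_trans sum.
  have := leq_mul K (leqnn (2 ^ (8 * p))); move: bs; move: (2 ^ (8 * p)) => q; clear; lia.
case: (leqP #|hit A'| #|hit B'|) => Hm.
  exists A'; split; [exact: A'W|exact: (size A1 cA1)|apply: fin; clear - Hm; lia].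
exists B'; split; [exact: B'W|exact: (size B1 cB1)|apply: fin; clear - Hm; lia].
Qed.

(** Components of the complement are pairwise complete, so their clique numbers add. For a single
    one, [k * #|D| <= omg D * z] holds by the size bound if [omg D >= k], and by minimality
    otherwise. *)
Lemma rate (k z : nat) U Y : al * k ^ d <= z -> Y \subset U ->
  (forall y, y \in Y -> component (@nadj G) U y \subset Y) ->
  (forall y, y \in Y -> #|component (@nadj G) U y| <= z) ->
  (forall y, y \in Y -> component (@nadj G) U y != setT) -> k * #|Y| <= omg Y * z.
Proof.
move=> kz; have [m] := ubnP #|Y|; elim: m Y => // m IH Y Ym YU cl small nT.
case: (set_0Vmem Y) => [->|[y yY]]; first by rewrite cards0 muln0.
set D := component (@nadj G) U y.
have yU := subsetP YU y yY; have DY : D \subset Y := cl y yY.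
have cD : 0 < #|D| by apply/card_gt0P; exists y; apply: mem_comp.
have cYD := cardsD Y D; rewrite (setIidPr DY) in cYD.
have sY : Y :\: D \subset Y by apply: subsetDl.
have IHY : k * #|Y :\: D| <= omg (Y :\: D) * z.
  apply: IH.
  - by have := subset_leq_card DY; lia.
  - exact: subset_trans YU.
  - move=> x; rewrite in_setD => /andP[xD xY]; rewrite subsetD (cl x xY) /=.
    rewrite -setI_eq0; apply/eqP/setP=> t; rewrite in_setI [RHS]inE; apply/negP=> /andP[tx tD].
    case/negP: xD; rewrite /D -(comp_eq (@nadj_sym G) tD) (comp_eq (@nadj_sym G) tx).
    exact: mem_comp.
  - by move=> x /(subsetP sY); apply: small.
  - by move=> x /(subsetP sY); apply: nT.
have fD : full D (Y :\: D).
  move=> a b aD; rewrite in_setD => /andP[bD bY]; apply: contraT => nab.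
  have ab : a != b by apply: contraNneq bD => <-.
  case/negP: bD; apply: (comp_closed yU aD (subsetP YU b bY)).
  by rewrite /nadj /= nab ab.
have oD : k * #|D| <= omg D * z.
  have H := mc_alomg mc (nT y yY); rewrite -/D in H.
  case: (leqP k (omg D)) => kD.
    by apply: leq_mul => //; apply: small.
  have H2 : omg D ^ d <= omg D * k ^ d.-1.
    have d0 := d_gt0 mc; rewrite -{1}(ltn_predK d0) expnS leq_mul2l leq_expl ?orbT //.
    exact: ltnW.
  have H3 : k * k ^ d.-1 = k ^ d by rewrite -expnS (ltn_predK (d_gt0 mc)).
  move: H H2 H3 kz; move: (omg D ^ d) (k ^ d.-1) (k ^ d) => a b c H H2 H3 kz.
  have L1 : k * #|D| <= k * (al * (omg D * b)).
    by rewrite leq_mul2l; apply/orP; right; apply: leq_trans H _; rewrite leq_mul2l H2 orbT.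
  have L2 : omg D * (al * c) <= omg D * z by rewrite leq_mul2l kz orbT.
  by rewrite -H3 in L2; lia.
have E : D :|: (Y :\: D) = Y.
  apply/setP=> t; rewrite in_setU in_setD.
  by case: (boolP (t \in D)) => [/(subsetP DY)->|].
have := omgU fD; rewrite E => H.
have : (omg D + omg (Y :\: D)) * z <= omg Y * z by rewrite leq_mul2r H orbT.
have : k * #|Y| = k * #|D| + k * #|Y :\: D|.
  by rewrite -mulnDr cYD subnKC // subset_leq_card.
lia.
Qed.

(** Otherwise [rate], with [k] about [w / 2 ^ (2 * p)] and [z] about [#|U| / 2 ^ (8 * p)], yields a
    clique larger than [w]; [sc_w] makes this [k] positive. *)
Lemma anti_small U a : n <= #|U| * 2 ^ a -> a <= 1300 * p ->
  8 * #|[set z in U | #|component (@nadj G) U z| * 2 ^ (8 * p) < #|U|]| < #|U|.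
Proof.
move=> nU ap; rewrite ltnNge; apply/negP; set Y := [set z in U | _] => U8.
have p16 := sc_p sc; have pd := pd_big.
have U0 : 0 < #|U|.
  rewrite lt0n; apply/eqP=> E; rewrite E mul0n leqn0 in nU.
  by have := mc_n0 mc; rewrite (eqP nU).
have q0 : 0 < 2 ^ (8 * p) by rewrite expn_gt0.
have P0 : 0 < 2 ^ (2 * p) by rewrite expn_gt0.
have k0 : 0 < w %/ 2 ^ (2 * p) by rewrite divn_gt0 // (sc_w sc).
have kw : w < (w %/ 2 ^ (2 * p)).+1 * 2 ^ (2 * p) by apply: ltn_ceil.
have kle : w %/ 2 ^ (2 * p) * 2 ^ (2 * p) <= w by apply: leq_trunc_div.
have uq : #|U| %/ 2 ^ (8 * p) * 2 ^ (8 * p) <= #|U| by apply: leq_trunc_div.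
move: (w %/ 2 ^ (2 * p)) k0 kw kle => k k0 kw kle.
have kz : al * k ^ d <= #|U| %/ 2 ^ (8 * p).
  rewrite leq_divRL //.
  have H : al * k ^ d * 2 ^ (2 * p * d) <= n.
    apply: leq_trans (ltnW (mc_big mc)); rewrite -mulnA expnM -expnMn leq_mul2l.
    by apply/orP; right; apply: leq_expl.
  by apply: (pow_trans H nU); clear - ap pd; lia.
have YU : Y \subset U by apply/subsetP=> y; rewrite in_set => /andP[].
have smallY y : y \in Y -> #|component (@nadj G) U y| * 2 ^ (8 * p) < #|U|.
  by rewrite in_set => /andP[].
have R : k * #|Y| <= omg Y * (#|U| %/ 2 ^ (8 * p)).
  apply: (rate kz YU) => y yY; have yU := subsetP YU y yY; have sy := smallY y yY.
  - apply/subsetP=> t ty; rewrite in_set (comp_eq (@nadj_sym G) ty) sy andbT.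
    exact: (subsetP (comp_sub _ yU) t ty).
  - by rewrite leq_divRL // ltnW.
  - apply: contraTneq sy => ->; rewrite cardsT -leqNgt.
    by apply: leq_trans (max_card _) _; rewrite leq_pmulr.
apply: (rate_arith _ uq U8 kw k0 _ U0).
  by apply: leq_trans R _; rewrite leq_mul2r omg_w orbT.
by rewrite (_ : 16 = 2 ^ 4) // -expnD ltn_exp2l //; clear - p16; lia.
Qed.

(** The component of [a] in the complement stays inside [P i]. If [x] had a neighbour in it, [x]
    would separate some nonadjacent pair [s], [t] of it, and [b], complete to both, closes a
    five-vertex path. *)
Lemma full_hit (I : finType) (J : {set I}) (P : I -> {set G}) U i j x a b :
  U \subset W -> U = \bigcup_(k in J) P k ->
  (forall i j, i \in J -> j \in J -> i != j -> full (P i) (P j)) ->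
  i \in J -> j \in J -> i != j -> e v x -> a \in P i -> ~~ e x a -> b \in P j -> ~~ e x b ->
  component (@nadj G) U a \subset nN x.
Proof.
move=> UW UE fP iJ jJ ij vx aP xa bP xb.
have PU k : k \in J -> P k \subset U by move=> kJ; rewrite UE; apply: (bigcup_sup k).
have aU := subsetP (PU i iJ) a aP.
have DU := @comp_sub _ (@nadj G) U a aU.
have DP : component (@nadj G) U a \subset P i.
  apply/subsetP=> y yD; apply: contraT => yP.
  have [s [t [sD /= sP tD /= tP st]]] := conn_exit (P := mem (P i)) (@comp_conn _ _ (@nadj_sym G) U a)
    (mem_comp _ _ _) aP yD yP.
  have := subsetP DU t tD; rewrite UE => /bigcupP[k kJ tk].
  have ik : i != k by apply: contraNneq tP => ->.
  by move: st; rewrite /nadj /= (fP i k iJ kJ ik s t sP tk) andbF.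
have DW := subset_trans DU UW.
apply: nonadj_nN => // y yD; apply/negP=> xy.
have [s [t [sD /= xs tD /= xt /andP[/= st nst]]]] :=
  conn_exit (P := e x) (@comp_conn _ _ (@nadj_sym G) U a) yD xy (mem_comp _ _ _) xa.
have sP := subsetP DP s sD; have tP := subsetP DP t tD.
have fsb := fP i j iJ jJ ij s b sP bP; have ftb := fP i j iJ jJ ij t b tP bP.
have bW : b \in W by apply: (subsetP UW); apply: (subsetP (PU j jJ)).
have [_ vs] := W_nv (subsetP DW s sD); have [_ vt] := W_nv (subsetP DW t tD).
have [_ vb] := W_nv bW.
(* v-x-s-b-t would be an induced path *)
apply: (mc_M mc (z := s) (A := [set v; x]) (B := [set b; t])).
- exact: (conn2 es).
- by apply: (conn2 es); rewrite es.
- by move=> c1 c2; rewrite !inE => /orP[/eqP->|/eqP->] /orP[/eqP->|/eqP->].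
- by exists x, v; rewrite !inE !eqxx orbT; split=> //; rewrite es.
- by exists b, t; rewrite !inE !eqxx orbT; split.
Qed.

(** Remove vertices in small components of the complement. By [full_hit] a vertex hitting two of the
    remaining parts is [bad], so otherwise the hit sets are disjoint and an average one is small.
    Strictly less than a quarter of [J] is lost; the slack 4 in the last hypothesis uses this
    strictness to allow two sets with [g = 1]. *)
Lemma step_full (I : finType) (J : {set I}) (P : I -> {set G}) c g :
  (forall i, i \in J -> P i \subset W) ->
  (forall i j, i \in J -> j \in J -> i != j -> full (P i) (P j)) ->
  (forall i, i \in J -> #|W| <= #|P i| * 2 ^ c) ->
  c <= 100 * p -> J != set0 -> 4 * 2 ^ g <= 3 * #|J| + 4 ->
  exists W' : {set G}, [/\ W' \subset W, #|W| <= #|W'| * 2 ^ c.+1 &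
    #|hit W'| * 2 ^ g * 2 ^ (8 * p) <= #|hit W| * 2 ^ (8 * p) + #|S| * 2 ^ g].
Proof.
move=> PW fP cP cp /set0Pn[i0 i0J] gJ; have p16 := sc_p sc.
case: (@arg_minnP _ i0 (mem J) (fun i => #|P i|) i0J) => i1 i1J minP.
pose h := #|P i1|.
have [P' HP'] : exists P' : I -> {set G}, forall i, i \in J -> (P' i \subset P i) && (#|P' i| == h).
  apply: (@fin_all_exists _ (fun=> {set G}) (fun i Q => i \in J -> (Q \subset P i) && (#|Q| == h))) => i.
  case: (boolP (i \in J)) => iJ; last by exists set0.
  by have [Q sQ cQ] := cards_subset_ex (minP i iJ); exists Q; rewrite sQ cQ eqxx.
have sP i : i \in J -> P' i \subset P i by move/HP'/andP=> [].
have hP i : i \in J -> #|P' i| = h by move/HP'/andP=> [_ /eqP].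
have fP' i j : i \in J -> j \in J -> i != j -> full (P' i) (P' j).
  by move=> iJ jJ ij; apply: fullS (fP i j iJ jJ ij) (sP i iJ) (sP j jJ).
have Wh : #|W| <= h * 2 ^ c := cP i1 i1J.
pose U := \bigcup_(i in J) P' i.
have PU i : i \in J -> P' i \subset U by move=> iJ; apply: (bigcup_sup i).
have UW : U \subset W.
  by apply/bigcupsP=> i iJ; apply: subset_trans (sP i iJ) (PW i iJ).
have US : U \subset S by apply: subset_trans UW WS.
have hU : h <= #|U| by rewrite -(hP i1 i1J); apply/subset_leq_card/PU.
have UJ : #|U| <= #|J| * h.
  apply: leq_trans (card_bigcup _ _) _; rewrite -sum_nat_const.
  by apply: leq_sum => i iJ; rewrite hP.
have nU : n <= #|U| * 2 ^ (c + 1145 * p).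
  apply: leq_trans Wbig _; rewrite expnD mulnA leq_mul2r; apply/orP; right.
  by apply: leq_trans Wh _; rewrite leq_mul2r hU orbT.
have U0 : U != set0.
  rewrite -card_gt0 lt0n; apply/eqP=> E; rewrite E mul0n leqn0 in nU.
  by have := mc_n0 mc; rewrite (eqP nU).
have := anti_small nU; set Zs := [set z in U | _] => Z8.
have {}Z8 : 8 * #|Zs| < #|U| by apply: Z8; clear - cp p16; lia.
pose J' := [set i in J | 2 * #|P' i :&: Zs| <= h].
have disj i j : i \in J -> j \in J -> i != j -> [disjoint P' i & P' j].
  by move=> iJ jJ ij; apply/full_disjoint/fP'.
have cJ : 4 * #|J :\: J'| < #|J|.
  have H1 : #|J :\: J'| * h <= 2 * #|Zs|.
    rewrite -sum_nat_const; apply: (@leq_trans (\sum_(i in J :\: J') 2 * #|P' i :&: Zs|)).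
      apply: leq_sum => i; rewrite in_setD => /andP[iJ' iJ].
      by move: iJ'; rewrite in_set iJ /= -ltnNge => /ltnW.
    rewrite -big_distrr /= leq_mul2l /=; apply: sum_disjoint => [i _|i j]; first exact: subsetIr.
    rewrite !in_setD => /andP[_ iJ] /andP[_ jJ] ij.
    by apply: disjointWl (subsetIl _ _) _; apply: disjointWr (subsetIl _ _) _; apply: disj.
  have h0 : 0 < h by rewrite lt0n; apply/eqP=> h0; move: UJ Z8; rewrite h0 muln0 leqn0 => /eqP->.
  have : 4 * #|J :\: J'| * h < #|J| * h by clear - H1 UJ Z8; lia.
  by rewrite ltn_pmul2r.
have cJ' : 2 ^ g <= #|J'|.
  have sJ : J' \subset J by apply/subsetP=> i; rewrite in_set => /andP[].
  have := cardsD J J'; rewrite (setIidPr sJ); have := subset_leq_card sJ.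
  by move: (2 ^ g) gJ cJ => q; clear; lia.
pose bd := bad U (8 * p).
have J'0 : 0 < #|mem J'| by apply: leq_trans cJ'; rewrite expn_gt0.
have PWD i : i \in J -> P' i :\: Zs \subset W.
  by move=> iJ; apply: subset_trans (subsetDl _ _) (subset_trans (PU i iJ) UW).
have [i iJ' Hi] : exists2 i, i \in J' & #|J'| * #|hit (P' i :\: Zs) :\: bd| <= #|hit W|.
  apply: (@avg_le _ (fun i => #|hit (P' i :\: Zs) :\: bd|) (mem J') _ J'0).
  apply: sum_disjoint => [i|i j]; rewrite in_set => /andP[iJ _].
    by apply: subset_trans (subsetDl _ _) _; apply: hitS; apply: PWD.
  rewrite in_set => /andP[jJ _] ij; rewrite -setI_eq0; apply/eqP/setP=> x.
  rewrite in_setI !in_setD [RHS]inE; apply/negP=> /andP[/andP[xb xi] /andP[_ xj]].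
  have [vx xS [a]] := in_hit_nonadj xi (PWD i iJ).
  have [_ _ [b]] := in_hit_nonadj xj (PWD j jJ).
  rewrite !in_setD => /andP[_ bP] xb' /andP[aZ aP] xa.
  have aU := subsetP (PU i iJ) a aP.
  case/negP: xb; rewrite in_set xS /=.
  apply: (@leq_trans (#|component (@nadj G) U a| * 2 ^ (8 * p))).
    by move: aZ; rewrite in_set aU /= -leqNgt.
  rewrite leq_mul2r; apply/orP; right; apply: subset_leq_card; rewrite subsetI comp_sub //=.
  exact: (full_hit UW erefl fP' iJ jJ ij vx aP xa bP xb').
have iJ : i \in J by move: iJ'; rewrite in_set => /andP[].
exists (P' i :\: Zs); split; first exact: PWD.
  have H : h <= 2 * #|P' i :\: Zs|.
    have := cardsID Zs (P' i); rewrite (hP i iJ); move: iJ'; rewrite in_set => /andP[_].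
    by clear; lia.
  rewrite expnS mulnA (mulnC _ 2); apply: leq_trans Wh _; by rewrite leq_mul2r H orbT.
have bs : #|bd| * 2 ^ (8 * p) <= #|S|.
  have q : 8 * p <= 16 * p by rewrite leq_mul2r orbT.
  by have := bad_small US U0 q; rewrite -mulnBl.
have H1 : #|hit (P' i :\: Zs)| <= #|hit (P' i :\: Zs) :\: bd| + #|bd|.
  by rewrite -(cardsID bd (hit _)) addnC leq_add2l subset_leq_card ?subsetIr.
have H2 : 2 ^ g * #|hit (P' i :\: Zs) :\: bd| <= #|hit W|.
  by apply: leq_trans Hi; rewrite leq_mul2r cJ' orbT.
move: bs H1 H2; move: (2 ^ g) (2 ^ (8 * p)) #|hit _| #|_ :\: _| #|hit W| #|bd| #|S|.
move=> q r x y f b s bs H1 H2; clear - bs H1 H2.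
have K1 : x * q * r <= (y + b) * q * r by rewrite !leq_mul2r H1 !orbT.
have K2 : q * y * r <= f * r by rewrite leq_mul2r H2 orbT.
have K3 : b * r * q <= s * q by rewrite leq_mul2r bs orbT.
lia.
Qed.

End Step.

(** * Shrinking inside dense sets *)

Lemma maximal_stable (G : sgraph) (A : {set G}) : exists K : {set G},
  [/\ K \subset A, stable K & forall a, a \in A -> a \in K \/ exists2 k, k \in K & adj a k].
Proof.
have [K [KA sK cK]] := alf_ex A; exists K; split=> // a aA.
case: (boolP (a \in K)) => aK; [by left|right].
case: (boolP [exists k in K, adj a k]) => [/exists_inP[k kK ak]|]; first by exists k.
rewrite negb_exists_in => /forall_inP H.
have : #|a |: K| <= alf A.
  apply: stable_le; first by rewrite subUset sub1set aA.
  apply/stableP=> x y; rewrite !inE => /orP[/eqP->|xK] /orP[/eqP->|yK]; rewrite ?adj_irr ?H //.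
    by rewrite adj_sym H.
  by move/stableP: sK; apply.
by rewrite cardsU1 aK cK ltnn.
Qed.

Lemma sum_if_mem (T : finType) (A B : {set T}) c :
  \sum_(x in A) (if x \in B then c else 0) <= #|B| * c.
Proof.
rewrite -sum_nat_const big_mkcond [X in _ <= X]big_mkcond /=; apply: leq_sum => x _.
by case: (x \in A); case: (x \in B).
Qed.

Lemma avg_arith c h Sg q bd hw x r s : 0 < c -> c * h <= Sg ->
  Sg * (4 * q) <= bd * c * (4 * q) + hw * (2 * x) -> x <= 2 * c -> bd * r <= s ->
  h * q * r <= hw * r + s * q.
Proof.
move=> c0 H1 H2 H3 H4.
have K1 : c * h * (4 * q) <= Sg * (4 * q) by rewrite leq_mul2r H1 orbT.
have K2 : hw * (2 * x) <= hw * (2 * (2 * c)) by rewrite !leq_mul2l H3 !orbT.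
have K3 : 4 * c * (h * q) <= 4 * c * (bd * q + hw) by lia.
rewrite leq_pmul2l ?muln_gt0 ?c0 // in K3.
have K4 : h * q * r <= (bd * q + hw) * r by rewrite leq_mul2r K3 orbT.
have K5 : bd * r * q <= s * q by rewrite leq_mul2r H4 orbT.
lia.
Qed.

Lemma pow_split5 a b c e f k : a + b + c + (e + f) = k ->
  2 ^ a * 2 ^ b * 2 ^ c * (2 ^ e * 2 ^ f) = 2 ^ k.
Proof. by move=> <-; rewrite !expnD. Qed.

Lemma sparse_arith m x q c r : m.-1 * (q * (r * c)) <= x -> q * (r * c) <= x -> 6 <= c ->
  3 * m * (q * r) <= x.
Proof.
move=> H1 H2 c6; have K : m * (q * (r * c)) <= 2 * x.
  by case: m H1 => [|m] /= H1; lia.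
have : m * (q * r) * 6 <= m * (q * r) * c by rewrite leq_mul2l c6 orbT.
lia.
Qed.

Section Final.
Variables (G : sgraph) (d p : nat) (S : {set G}).
Hypothesis sc : scale d p S.
Let mc := sc_mc sc.
Implicit Types (A B C D U X Y Z K L Q : {set G}) (x y z u t : G).
Local Notation e := (@adj G).
Local Notation n := #|G|.
Local Notation w := (omg [set: G]).
Local Notation es := (@adj_sym G).
Variable v : G.
Hypothesis vS : v \in S.
Variable W : {set G}.
Hypothesis WT : W \subset S :&: nN v.
Hypothesis Wbig : n <= #|W| * 2 ^ (1145 * p).

Let WS : W \subset S.
Proof. exact: subset_trans WT (subsetIl _ _). Qed.

Let W0 : 0 < #|W|.
Proof.
rewrite lt0n; apply/eqP=> E; have := mc_n0 mc; move: Wbig.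
by rewrite E mul0n leqn0 => /eqP->.
Qed.

Local Notation hit := (hit S v).

Section NoFamily.
Hypothesis no_fam : forall a (J : {set G}) (P : G -> {set G}), 2 <= a -> #|J| = 2 ^ a ->
  (forall i, i \in J -> P i \subset W) ->
  (forall i j, i \in J -> j \in J -> i != j -> full (P i) (P j)) ->
  exists2 i, i \in J & #|P i| * 2 ^ (4 * a + 8) < #|W|.

Section FixX.
Variables (X : {set G}) (b : nat).
Hypothesis XW : X \subset W.
Hypothesis b8 : 8 <= b.
Hypothesis Xbig : #|W| <= #|X| * 2 ^ b.
Hypothesis Xdense : forall u, u \in X -> #|X :&: nN u| * 2 ^ (8 * b) <= #|X|.

Let X0 : 0 < #|X|.
Proof. by rewrite lt0n; apply/eqP=> E; move: Xbig W0; rewrite E mul0n leqn0 => /eqP->. Qed.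

Let priv K k := if k \in K then X :&: nN k else set0.

(** Private parts of the non-neighbourhoods of [K] are pairwise complete, since a nonadjacent pair
    and three vertices of [K] would form an induced path. [no_fam] then gives the hypothesis of
    [cover_bound], started at level [4 * b] because [4 ^ (4 * b) = 2 ^ (8 * b)]. *)
Lemma priv_cover K : K \subset X -> stable K -> #|\bigcup_k priv K k| * 2 ^ (4 * b) <= 48 * #|X|.
Proof.
move=> KX /stableP sK; apply: cover_bound => [a J ab cJ|k]; last first.
  rewrite /priv; case: ifP => [kK|_]; last by rewrite cards0.
  by rewrite (_ : 4 = 2 ^ 2) // -expnM mulnA; apply: Xdense; apply: (subsetP KX).
pose P i := priv K i :\: \bigcup_(j in J :\ i) priv K j.
case: (boolP [exists i in J, #|P i| * 4 ^ a.+2 < #|X|]) => [/exists_inP[i iJ Hi]|].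
  by exists i.
rewrite negb_exists_in => /forall_inP H.
have big i : i \in J -> #|X| <= #|P i| * 4 ^ a.+2 by move=> iJ; rewrite leqNgt H.
have Pne i : i \in J -> i \in K.
  move=> iJ; have := big i iJ; rewrite /P /priv; case: ifP => // _.
  by rewrite set0D cards0 mul0n leqn0 => /eqP E; move: X0; rewrite E.
have memP i x : i \in J -> x \in P i ->
   [/\ x \in X, nadj i x & forall j, j \in J -> j != i -> ~~ nadj j x].
  move=> iJ; rewrite /P in_setD {2}/priv (Pne i iJ) in_setI [x \in nN i]in_set => /and3P[xU xX ix].
  split=> // j jJ ji; apply: contra xU => jx; apply/bigcupP; exists j; first by rewrite !inE ji.
  by rewrite /priv (Pne j jJ) in_setI xX in_set.
have third i j : exists k, [/\ k \in J, k != i & k != j].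
  have : 0 < #|J :\: [set i; j]|.
    have := cardsD J [set i; j]; have := subset_leq_card (subsetIr J [set i; j]).
    have : #|[set i; j]| <= 2 by rewrite cards2; case: (_ == _).
    have : 2 ^ 2 <= 2 ^ a by rewrite leq_exp2l //; clear - ab b8; lia.
    by rewrite cJ; move: (2 ^ a) => q; clear; lia.
  by case/card_gt0P=> k; rewrite !inE negb_or => /andP[/andP[ki kj] kJ]; exists k.
have adjP i j x : i \in J -> j \in J -> i != j -> x \in P i -> e j x.
  move=> iJ jJ ij xP; have [xX ix Hx] := memP i x iJ xP.
  have ji : j != i by rewrite eq_sym.
  have := Hx j jJ ji; rewrite /nadj /= negb_and !negbK => /orP[/eqP E|//].
  have [k [kJ ki kj]] := third i j; have := Hx k kJ ki.
  by rewrite -E /nadj /= kj (sK k j (Pne k kJ) (Pne j jJ)).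
have fullP i j : i \in J -> j \in J -> i != j -> full (P i) (P j).
  move=> iJ jJ ij x x' xP xP'; apply: contraT => nxx'.
  have [k [kJ ki kj]] := third i j.
  have ji : j != i by rewrite eq_sym.
  have ik : i != k by rewrite eq_sym.
  have jk : j != k by rewrite eq_sym.
  have [_ /andP[/= _ nix] _] := memP i x iJ xP; have [_ /andP[/= _ njx'] _] := memP j x' jJ xP'.
  have sKK s t : s \in J -> t \in J -> ~~ e s t by move=> sJ tJ; apply: sK; apply: Pne.
  (* i-x'-k-x-j would be an induced path *)
  case: (mc_M mc (z := k) (A := [set i; x']) (B := [set x; j])).
  - by apply: (conn2 es); apply: (adjP j).
  - by apply: (conn2 es); rewrite es; apply: (adjP i).
  - move=> s t; rewrite !inE => /orP[/eqP->|/eqP->] /orP[/eqP->|/eqP->] //.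
    + exact: sKK.
    + by rewrite es.
    + by rewrite es.
  - exists x', i; rewrite !inE !eqxx orbT; split=> //; last exact: sKK.
    exact: (adjP j).
  - exists x, j; rewrite !inE !eqxx orbT; split=> //; last exact: sKK.
    exact: (adjP i).
have a2 : 2 <= a by clear - ab b8; lia.
have PW i : i \in J -> P i \subset W.
  by move=> iJ; apply/subsetP=> x /(memP i x iJ)[xX _ _]; apply: (subsetP XW).
have [i iJ Hi] := no_fam a2 cJ PW fullP.
have : #|W| <= #|P i| * 2 ^ (4 * a + 8).
  apply: leq_trans Xbig _; apply: leq_trans (leq_mul (big i iJ) (leqnn _)) _.
  rewrite (_ : 4 ^ a.+2 = 2 ^ (2 * a.+2)); last by rewrite expnM.
  rewrite -mulnA -expnD leq_mul2l leq_exp2l //; apply/orP; right; clear - ab; lia.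
by rewrite leqNgt Hi.
Qed.

(** [V] is the union of the non-neighbourhoods of a maximal stable set [K] among the non-neighbours
    of [x] in [X]. If [u] is adjacent to [x] and outside [V], it is complete to [K], and by
    maximality a common non-neighbour [a] of [x] and [u] has a neighbour in [K], which completes an
    induced path from [v]. *)
Lemma hitters x : x \in hit X ->
  exists2 V : {set G}, #|V| * 2 ^ (4 * b) <= 48 * #|X| &
    forall u, u \in X -> x \in hit (X :&: nN u) -> u \in (X :&: nN x) :|: V.
Proof.
move=> xh; have [K [KA sK maxK]] := maximal_stable (X :&: nN x).
have KX : K \subset X by apply: subset_trans KA (subsetIl _ _).
exists (\bigcup_k priv K k); first exact: priv_cover.
move=> u uX xu.
have [vx xS [a aXu xa]] := in_hit_nonadj xu (subset_trans (subsetIl _ _) XW).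
move: aXu; rewrite in_setI => /andP[aX au].
have Wn y : y \in X -> ~~ e v y by move=> yX; have [_] := W_nv WT (subsetP XW y yX).
have ne y : y \in X -> x != y by move=> yX; apply: contraTneq vx => ->; apply: Wn.
have aA : a \in X :&: nN x by rewrite in_setI aX in_nN ne.
rewrite in_setU; case: (boolP (e x u)) => xu'; last by rewrite in_setI uX in_nN ne // xu'.
apply/orP; right.
case: (boolP [exists k in K, nadj k u]) => [/exists_inP[k kK ku]|].
  by apply/bigcupP; exists k => //; rewrite /priv kK in_setI uX in_set.
rewrite negb_exists_in => /forall_inP nK.
have KN k : k \in K -> ~~ e x k.
  by move/(subsetP KA); rewrite in_setI in_nN => /and3P[].
have Ku k : k \in K -> e u k.
  move=> kK; have := nK k kK; rewrite /nadj /= negb_and !negbK => /orP[/eqP E|]; last by rewrite es.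
  by have := KN k kK; rewrite E xu'.
move: au; rewrite in_nN => /andP[_ nua].
case: (maxK a aA) => [aK|[k kK ak]]; first by rewrite (Ku a aK) in nua.
(* v-x-u-k-a would be an induced path *)
case: (mc_M mc (z := u) (A := [set v; x]) (B := [set k; a])).
- exact: (conn2 es).
- by apply: (conn2 es); rewrite es.
- have kX := subsetP KX k kK.
  by move=> s t; rewrite !inE => /orP[/eqP->|/eqP->] /orP[/eqP->|/eqP->] //; rewrite ?Wn ?KN.
- by exists x, v; rewrite !inE !eqxx orbT; split=> //; rewrite es // Wn.
- by exists k, a; rewrite !inE !eqxx orbT; split=> //; apply: Ku.
Qed.

(** Average over [u] in [H]. By [hitters] a vertex that is not [bad] is counted for at most
    [2 * #|X| / 2 ^ b <= 4 * #|H| / 2 ^ b] choices of [u]; this 4 turns [b] into [b - 2]. *)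
Lemma avg_step (H : {set G}) : H \subset X -> #|X| <= 2 * #|H| -> b <= 8 * p ->
  exists2 u, u \in H &
    #|hit (X :&: nN u)| * 2 ^ (b - 2) * 2 ^ (8 * p) <= #|hit W| * 2 ^ (8 * p) + #|S| * 2 ^ (b - 2).
Proof.
move=> HX X2 bp.
have H0 : 0 < #|mem H| by rewrite -/(#|H|); clear - X0 X2; lia.
have XS : X \subset S by apply: subset_trans XW WS.
have Xne : X != set0 by rewrite -card_gt0.
pose bd := bad S X b.
have bp16 : b <= 16 * p by clear - bp; lia.
have bs : #|bd| * 2 ^ (8 * p) <= #|S|.
  have := bad_small sc XS Xne bp16; apply: leq_trans; rewrite leq_mul2l leq_exp2l //.
  by apply/orP; right; clear - bp; lia.
pose f x := #|[set u in H | x \in hit (X :&: nN u)]|.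
have f1 x : f x <= #|H| by apply/subset_leq_card/subsetP=> u; rewrite in_set => /andP[].
have f0 x : x \notin hit X -> f x = 0.
  move=> xh; apply/eqP; rewrite cards_eq0; apply/eqP/setP=> u; rewrite in_set [RHS]inE.
  by apply: contraNF xh => /andP[_]; apply: (subsetP (hitS _ _ (subsetIl _ _))).
have f2 x : x \in S -> x \in hit X -> x \notin bd -> f x * 2 ^ b <= 2 * #|X|.
  move=> xS xh; rewrite in_set xS /= -ltnNge => xb; have [V cV HV] := hitters xh.
  have L1 : f x <= #|X :&: nN x| + #|V|.
    apply: leq_trans (leq_card_setU _ _); apply/subset_leq_card/subsetP=> u.
    by rewrite in_set => /andP[/(subsetP HX) uX]; apply: HV.
  have L2 : #|V| * 2 ^ b <= #|X|.
    have E : 2 ^ (4 * b) = 2 ^ b * 2 ^ (3 * b) by rewrite -expnD -mulSn.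
    have q : 48 <= 2 ^ (3 * b).
      by apply: (@leq_trans (2 ^ 6)) => //; rewrite leq_exp2l //; clear - b8; lia.
    move: cV; rewrite E mulnA; move: (#|V| * 2 ^ b) (2 ^ (3 * b)) q => c q q48 cV.
    have K : c * 48 <= c * q by rewrite leq_mul2l q48 orbT.
    by clear - K cV; lia.
  have K : f x * 2 ^ b <= (#|X :&: nN x| + #|V|) * 2 ^ b by rewrite leq_mul2r L1 orbT.
  by apply: leq_trans K _; rewrite mulnDl mul2n -addnn leq_add // ltnW.
have [u uH Hu] := @avg_le _ (fun u => #|hit (X :&: nN u)|) (mem H) _ H0 (leqnn _).
exists u => //.
have E1 : \sum_(u in H) #|hit (X :&: nN u)| = \sum_(x in S) f x.
  rewrite /f -dblcount; apply: eq_bigr => t _; congr #|pred_of_set _|; apply/setP=> x.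
  by rewrite [RHS]in_set [x \in hit _]in_set; case: (x \in S).
have E2 : (\sum_(x in S) f x) * 2 ^ b <= #|bd| * #|H| * 2 ^ b + #|hit W| * (2 * #|X|).
  rewrite big_distrl /=; apply: (@leq_trans (\sum_(x in S) ((if x \in bd then #|H| * 2 ^ b else 0) +
      (if x \in hit X then 2 * #|X| else 0)))).
    apply: leq_sum => x xS; case: (boolP (x \in hit X)) => xh; last by rewrite f0.
    case: (boolP (x \in bd)) => xb; last exact: f2.
    by apply: leq_trans (leq_addr _ _); rewrite leq_mul2r f1 orbT.
  rewrite big_split /=; apply: leq_add.
    by rewrite -mulnA; apply: sum_if_mem.
  apply: leq_trans (sum_if_mem _ _ _) _; rewrite leq_mul2r; apply/orP; right.
  by apply/subset_leq_card/hitS.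
have E4 : 2 ^ b = 4 * 2 ^ (b - 2) by rewrite (_ : 4 = 2 ^ 2) // -expnD subnKC //; clear - b8; lia.
rewrite E4 in E2; rewrite E1 in Hu.
exact: (avg_arith H0 Hu E2 X2 bs).
Qed.

End FixX.

(** Keep deleting the vertices of large non-degree, doubling the density exponent each time, until
    they make up half of the set; [sc_fine] forces a stop before exponent [32 * p]. At the stop half
    of the vertices have non-degree within about a squaring of the guaranteed bound, which keeps the
    size loss proportional to the gain. *)
Lemma refine Y : Y \subset W -> #|W| <= 2 * #|Y| ->
  (forall u, u \in Y -> #|Y :&: nN u| * 2 ^ 64 <= #|Y|) ->
  exists (X : {set G}) j, [/\ X \subset W, #|W| <= #|X| * 2 ^ j.+1, 64 * 2 ^ j < 32 * p,
    forall u, u \in X -> #|X :&: nN u| * 2 ^ (64 * 2 ^ j) <= #|X| &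
    #|X| <= 2 * #|[set u in X | #|X| < #|X :&: nN u| * 2 ^ (64 * 2 ^ j.+1).+1]|].
Proof.
move=> YW Y2 Yd; have p16 := sc_p sc.
pose lev (X : {set G}) j := [/\ X \subset W, #|W| <= #|X| * 2 ^ j.+1 &
  forall u, u \in X -> #|X :&: nN u| * 2 ^ (64 * 2 ^ j) <= #|X|].
have levlt X j : j <= p -> lev X j -> 64 * 2 ^ j < 32 * p.
  move=> jp [XW Xb Xd]; rewrite ltnNge; apply/negP=> H.
  have [|u uX Hu] := sc_fine sc (S' := X).
    apply: leq_trans Wbig _; apply: leq_trans (leq_mul Xb (leqnn _)) _.
    by rewrite -mulnA -expnD leq_mul2l leq_exp2l //; apply/orP; right; clear - jp p16; lia.
  have := Xd u uX; rewrite leqNgt => /negP; apply; apply: leq_trans Hu _.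
  by rewrite leq_mul2l leq_exp2l // H orbT.
have lev_next X j : lev X j ->
    #|X| <= 2 * #|[set u in X | #|X| < #|X :&: nN u| * 2 ^ (64 * 2 ^ j.+1).+1]| \/
    exists X', lev X' j.+1.
  case=> XW Xb Xd; set H := [set u in X | _]; case: (leqP #|X| (2 * #|H|)) => cH; [by left|right].
  exists (X :\: H).
  have HX : H \subset X by apply/subsetP=> u; rewrite in_set => /andP[].
  have cXH := cardsD X H; rewrite (setIidPr HX) in cXH; have cHX := subset_leq_card HX.
  have X2 : #|X| <= 2 * #|X :\: H| by clear - cXH cHX cH; lia.
  split.
  - exact: subset_trans (subsetDl _ _) XW.
  - apply: leq_trans Xb _; rewrite [2 ^ j.+2]expnS mulnA (mulnC _ 2).
    by rewrite leq_mul2r X2 orbT.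
  move=> u; rewrite in_setD => /andP[uH uX].
  move: uH; rewrite in_set uX /= -leqNgt expnS => Hu.
  have K : #|(X :\: H) :&: nN u| <= #|X :&: nN u| by apply: subset_leq_card; apply: setSI; apply: subsetDl.
  move: (2 ^ (64 * 2 ^ j.+1)) Hu => q Hu.
  have K2 : #|(X :\: H) :&: nN u| * (2 * q) <= #|X :&: nN u| * (2 * q) by rewrite leq_mul2r K orbT.
  by clear - K2 Hu X2; lia.
have main k : k <= p -> (exists X j, [/\ lev X j, j <= p &
    #|X| <= 2 * #|[set u in X | #|X| < #|X :&: nN u| * 2 ^ (64 * 2 ^ j.+1).+1]|]) \/
    exists X, lev X k.
  elim: k => [|k IH] kp.
    by right; exists Y; split; [exact: YW|rewrite expn1 mulnC|rewrite expn0 muln1].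
  case: (IH (ltnW kp)) => [|[X Xk]]; first by left.
  by case: (lev_next X k Xk) => H; [left; exists X, k; split=> //; exact: ltnW|right].
case: (main p (leqnn p)) => [[X [j [[XW Xb Xd] jp cX]]]|[X Xp]].
  by exists X, j; split=> //; apply: (levlt X).
have := levlt X p (leqnn p) Xp; have : p < 2 ^ p by apply: ltn_expl.
by move: (2 ^ p) => q; clear; lia.
Qed.

Lemma step_dense Y : Y \subset W -> #|W| <= 2 * #|Y| ->
  (forall u, u \in Y -> #|Y :&: nN u| * 2 ^ 64 <= #|Y|) ->
  exists (W' : {set G}) s g, [/\ W' \subset W, 0 < g <= 16 * p, s <= 256 * g, #|W| <= #|W'| * 2 ^ s &
    #|hit W'| * 2 ^ g * 2 ^ (8 * p) <= #|hit W| * 2 ^ (8 * p) + #|S| * 2 ^ g].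
Proof.
move=> YW Y2 Yd; have [X [j [XW Xb jp Xd XH]]] := refine YW Y2 Yd.
set H := [set u in X | _] in XH; pose b := 8 * 2 ^ j.
have j2 : j < 2 ^ j by apply: ltn_expl.
have b8 : 8 <= b by rewrite /b leq_pmulr // expn_gt0.
have Eb : 64 * 2 ^ j = 8 * b by rewrite /b mulnA.
have Eb2 : 64 * 2 ^ j.+1 = 16 * b by rewrite /b expnS !mulnA.
have Xb' : #|W| <= #|X| * 2 ^ b.
  apply: leq_trans Xb _; rewrite leq_mul2l leq_exp2l //; apply/orP; right; rewrite /b.
  by clear - j2; lia.
have Xd' u : u \in X -> #|X :&: nN u| * 2 ^ (8 * b) <= #|X| by rewrite -Eb; apply: Xd.
have HX : H \subset X by apply/subsetP=> u; rewrite in_set => /andP[].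
rewrite Eb in jp.
have bp : b <= 8 * p by clear - jp; lia.
have [u uH Hu] := avg_step XW b8 Xb' Xd' HX XH bp.
(* [b] pays for passing from [W] to [X], and [16 * b + 1] for the non-neighbourhood of [u]; the rate
   256 holds because [b >= 8]. *)
exists (X :&: nN u), (b + (16 * b).+1), (b - 2); split.
- exact: subset_trans (subsetIl _ _) XW.
- by clear - bp b8; lia.
- by clear - b8; lia.
- move: uH; rewrite in_set Eb2 => /andP[_ K]; apply: leq_trans Xb' _.
  by rewrite addnC expnD mulnA leq_mul2r ltnW ?orbT.
- exact: Hu.
Qed.

End NoFamily.

Lemma sparse_cluster (F : {set G}) m : 0 < m -> F \subset W ->
  (forall A B, A \subset W -> B \subset W -> anti A B -> [disjoint A & B] -> m <= #|A| -> #|B| < m) ->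
  1000 * (3 * m) <= #|F| -> 1000 * edges_in F <= #|F| * #|F| -> False.
Proof.
move=> m0 FW no_anti Fm Fe.
pose R := [set u in F | #|F|.+1 <= 100 * #|F :&: N u|].
have RF : R \subset F by apply/subsetP=> u; rewrite in_set => /andP[].
have mk : #|R| * #|F|.+1 <= 100 * edges_in F by rewrite /edges_in big_distrr; apply: markov.
have cR : 10 * #|R| <= #|F|.
  suff : #|F|.+1 * (10 * #|R|) <= #|F|.+1 * #|F| by rewrite leq_pmul2l.
  by move: mk Fe; move: #|R| #|F| (edges_in F) => a b c; clear; lia.
have cA := cardsD F R; rewrite (setIidPr RF) in cA.
have AF : F :\: R \subset F by apply: subsetDl.
apply: (@sparse_false _ (mc_M mc) W m no_anti (F :\: R)).
- exact: subset_trans FW.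
- by clear - cA cR Fm; lia.
- by clear - cA cR Fm m0; lia.
move=> u; rewrite in_setD => /andP[uR uF].
move: uR; rewrite in_set uF /= -leqNgt => Hu.
have : #|(F :\: R) :&: N u| <= #|F :&: N u| by apply: subset_leq_card; apply: setSI.
by clear - Hu cA cR; lia.
Qed.

Lemma W_cluster u m c r : 0 < m ->
  (forall A B, A \subset W -> B \subset W -> anti A B -> [disjoint A & B] -> m <= #|A| -> #|B| < m) ->
  0 < c -> 100 * 100 <= r -> 3 * m * (c * c * c * r) <= #|W| -> #|W| <= #|W :&: nN u| * c ->
  edges_in (W :&: nN u) <= 10 * (3 * m) * #|W| * c -> False.
Proof.
move=> m0 no_anti c0 r0 mW big ed.
apply: (sparse_cluster m0 (subsetIl _ _) no_anti); last exact: (cluster_arith mW big c0 r0 ed).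
have r1 : 1000 <= c * c * r.
  by apply: leq_trans (leq_pmull _ _); rewrite ?muln_gt0 ?c0 //; clear - r0; lia.
apply: (half_arith _ big c0 r1); move: mW; clear; lia.
Qed.

(** A large anticomplete pair, a large complete pair or a large complete family each gives a step
    directly. Without them [W] is robust; its sparse clusters are refuted by [sparse_false], so
    [dense_or_cluster] leaves a dense half of [W] for [step_dense]. *)
Lemma step : (exists2 A : {set G}, A \subset W & rich p S A) \/
  exists (W' : {set G}) s g, [/\ W' \subset W, 0 < g <= 16 * p, s <= 256 * g, #|W| <= #|W'| * 2 ^ s &
    #|hit W'| * 2 ^ g * 2 ^ (8 * p) <= #|hit W| * 2 ^ (8 * p) + #|S| * 2 ^ g].
Proof.
have p16 := sc_p sc; have pd := pd_big sc.
have gp : 0 < 1 <= 16 * p by clear - p16; lia.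
case: (classic (exists A B : {set G}, [/\ A \subset W, B \subset W, anti A B, [disjoint A & B] &
    #|W| <= #|A| * 2 ^ 220 /\ #|W| <= #|B| * 2 ^ 220])) => [[A [B [AW BW AB dAB [cA cB]]]]|nA].
  have [|[W' [H1 H2 H3]]] := step_anti sc WT Wbig AW BW AB dAB cA cB; first by left.
  by right; exists W', 221, 1; split; [exact: H1|exact: gp|by []|exact: H2|exact: H3].
case: (classic (exists A B : {set G}, [/\ A \subset W, B \subset W, full A B &
    #|W| <= #|A| * 2 ^ 220 /\ #|W| <= #|B| * 2 ^ 220])) => [[A [B [AW BW AB [cA cB]]]]|nF].
  right; have [||||||W' [H1 H2 H3]] := @step_full _ _ _ _ sc v vS W WT Wbig bool [set: bool]
    (fun b => if b then A else B) 220 1.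
  - by case=> _.
  - by case=> [] [] _ _ // _; apply: full_sym.
  - by case=> _; [exact: cA|exact: cB].
  - by clear - p16; lia.
  - by apply/set0Pn; exists true; rewrite inE.
  - by rewrite cardsT card_bool.
  by exists W', 221, 1; split; [exact: H1|exact: gp|by []|exact: H2|exact: H3].
case: (classic (exists a (J : {set G}) (P : G -> {set G}), [/\ 2 <= a, #|J| = 2 ^ a,
   forall i, i \in J -> P i \subset W,
   forall i j, i \in J -> j \in J -> i != j -> full (P i) (P j) &
   forall i, i \in J -> #|W| <= #|P i| * 2 ^ (4 * a + 8)])).
  case=> a [J [P [a2 cJ PW fP cP]]]; right.
  (* For [a >= p] the members are large enough in [G] to contradict [full_family]. *)
  have ap : a < p.
    rewrite ltnNge; apply/negP=> pa.
    apply: (@full_family _ _ mc _ J P a) => //; [by clear - a2; lia|by rewrite cJ|].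
    move=> i iJ; apply: leq_trans Wbig _; apply: leq_trans (leq_mul (cP i iJ) (leqnn _)) _.
    rewrite -mulnA -expnD leq_mul2l leq_exp2l //; apply/orP; right.
    have K : a * (10 * 1000) <= a * d by rewrite leq_mul2l (mc_d mc) orbT.
    by clear - K pa p16; lia.
  have J0 : J != set0 by rewrite -card_gt0 cJ expn_gt0.
  have c1 : 4 * a + 8 <= 100 * p by clear - ap p16; lia.
  have c2 : 4 * 2 ^ a.-1 <= 3 * #|J| + 4.
    rewrite cJ -{2}(ltn_predK a2) expnS; move: (2 ^ a.-1) => q; clear; lia.
  have [W' [H1 H2 H3]] := step_full sc vS WT Wbig PW fP cP c1 J0 c2.
  exists W', (4 * a + 8).+1, a.-1; split; [exact: H1| | |exact: H2|exact: H3].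
    by clear - a2 ap; lia.
  by clear - a2; lia.
move=> nJ; right.
have no_fam a (J : {set G}) (P : G -> {set G}) : 2 <= a -> #|J| = 2 ^ a ->
  (forall i, i \in J -> P i \subset W) ->
  (forall i j, i \in J -> j \in J -> i != j -> full (P i) (P j)) ->
  exists2 i, i \in J & #|P i| * 2 ^ (4 * a + 8) < #|W|.
  move=> a2 cJ PW fP.
  case: (boolP [exists i in J, #|P i| * 2 ^ (4 * a + 8) < #|W|]) => [/exists_inP[i iJ Hi]|].
    by exists i.
  rewrite negb_exists_in => /forall_inP H; case: nJ; exists a, J, P; split=> // i iJ.
  by rewrite leqNgt H.
(* The quotient [#|W| / 2 ^ 220] rounded up, so that at least [m] vertices means large in the sense
   of the excluded pairs. *)
pose m := (#|W|.-1 %/ 2 ^ 220).+1.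
have q0 : 0 < 2 ^ 220 by rewrite expn_gt0.
have mP k : m <= k -> #|W| <= k * 2 ^ 220.
  by rewrite /m ltn_divLR //; move: (k * 2 ^ 220) => c; clear - W0; lia.
have no_anti A B : A \subset W -> B \subset W -> anti A B -> [disjoint A & B] -> m <= #|A| -> #|B| < m.
  move=> AW BW AB dAB /mP cA; rewrite ltnNge; apply/negP=> /mP cB.
  by apply: nA; exists A, B; split.
have no_full A B : A \subset W -> B \subset W -> full A B -> m <= #|A| -> #|B| < m.
  move=> AW BW AB /mP cA; rewrite ltnNge; apply/negP=> /mP cB.
  by apply: nF; exists A, B; split.
have rob := robust_of_no_pair no_anti no_full.
have Wne : W != set0 by rewrite -card_gt0.
have [Dn|[u [uW big ed]]] := dense_or_cluster (mc_M mc) rob 65 Wne.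
  set X := [set u in W | _] in Dn.
  have XW : X \subset W by apply/subsetP=> u; rewrite in_set => /andP[].
  have cX : #|X| + #|W :\: X| = #|W| by rewrite -(cardsID X W) (setIidPr XW).
  have Y2 : #|W| <= 2 * #|W :\: X|.
    by apply: (dense_half Dn _ cX); rewrite -{1}(expn1 2) leq_exp2l.
  apply: (step_dense no_fam (subsetDl W X) Y2) => u; rewrite in_setD => /andP[uX uW].
  move: uX; rewrite in_set uW /= -ltnNge (expnS 2 64) => Hu.
  by apply: (dense_deg Hu Y2); apply: subset_leq_card; apply: setSI; apply: subsetDl.
(* Origin of 220: three factors [2 ^ 65] and [2 ^ 14 >= 100 * 100] for [cluster_arith]; [2 ^ 11]
   more than covers the factor 3 and the rounding of [m]. *)
have E : 2 ^ 65 * 2 ^ 65 * 2 ^ 65 * (2 ^ 14 * 2 ^ 11) = 2 ^ 220 by apply: pow_split5.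
have W220 : 2 ^ 220 <= #|W| by apply: (card_pow sc Wbig); clear - pd p16; lia.
have m1 : m.-1 * 2 ^ 220 <= #|W| by apply: leq_trans (leq_trunc_div _ _) (leq_pred _).
rewrite -E in W220 m1.
have mW : 3 * m * (2 ^ 65 * 2 ^ 65 * 2 ^ 65 * 2 ^ 14) <= #|W|.
  by apply: (sparse_arith m1 W220); rewrite (@leq_trans (2 ^ 3)) // leq_exp2l.
have r0 : 100 * 100 <= 2 ^ 14.
  apply: (@leq_trans (2 ^ 7 * 2 ^ 7)); first by apply: leq_mul.
  by rewrite -expnD leq_exp2l.
have c0 : 0 < 2 ^ 65 by rewrite expn_gt0.
by case: (W_cluster (ltn0Sn _) no_anti c0 r0 mW big ed).
Qed.

End Final.

(** * Descent through the scales *)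

Lemma rich_final_arith h dg nc s P Q E : nc <= h + dg + 1 -> h * Q * E <= s * Q + 2 * s * E ->
  P * P <= E -> P * P <= Q -> dg * (P * P) <= s -> P * P <= s -> 10 <= P -> nc * (2 * P) <= s.
Proof.
move=> H1 H2 PE PQ Hd Hs P10.
have P0 : 0 < P * P by rewrite muln_gt0; lia.
have K1 : s * Q * (P * P) <= s * Q * E by rewrite leq_mul2l PE orbT.
have K2 : s * E * (P * P) <= s * E * Q by rewrite leq_mul2l PQ orbT.
have K3 : h * Q * E * (P * P) <= (s * Q + 2 * s * E) * (P * P) by rewrite leq_mul2r H2 orbT.
have K4 : Q * E * (h * (P * P)) <= Q * E * (3 * s) by lia.
have QE : 0 < Q * E by rewrite muln_gt0; lia.
rewrite leq_pmul2l // in K4.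
have K5 : nc * (P * P) <= (h + dg + 1) * (P * P) by rewrite leq_mul2r H1 orbT.
have K6 : nc * P * 10 <= nc * P * P by rewrite leq_mul2l P10 orbT.
lia.
Qed.

Lemma hit_arith h h' s Q E q : h * Q * E <= s * Q + 2 * s * E -> h' * q * Q <= h * Q + s * q ->
  2 <= q -> h' * Q * (E * q) <= s * Q + 2 * s * (E * q).
Proof.
move=> H1 H2 q2.
have K1 : h' * q * Q * E <= (h * Q + s * q) * E by rewrite leq_mul2r H2 orbT.
have K2 : s * E * 2 <= s * E * q by rewrite leq_mul2l q2 orbT.
lia.
Qed.

Section Iterate.
Variables (G : sgraph) (d p : nat) (S : {set G}).
Hypothesis sc : scale d p S.
Let mc := sc_mc sc.
Implicit Types (A B U W : {set G}) (x y z u v : G).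
Local Notation e := (@adj G).
Local Notation n := #|G|.
Local Notation w := (omg [set: G]).

Lemma rich_subset U : U \subset S -> #|S| <= 2 * #|U| ->
  exists2 A : {set G}, A \subset U & rich p S A.
Proof.
move=> US U2; have p16 := sc_p sc; have pd := pd_big sc.
have nU : n <= #|U| * 2 ^ (600 * p).+1.
  apply: leq_trans (sc_big sc) _; rewrite expnS mulnA (mulnC _ 2).
  by rewrite leq_mul2r U2 orbT.
have [|v vU Hv] := sc_fine sc (S' := U).
  by apply: leq_trans nU _; rewrite leq_mul2l leq_exp2l //; apply/orP; right; clear - p16; lia.
have vS := subsetP US v vU.
set T := U :&: nN v in Hv.
have TU : T \subset U by apply: subsetIl.
have TS : T \subset S :&: nN v by apply: setSI.
have nT : n <= #|T| * 2 ^ (32 * p + (600 * p).+1).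
  rewrite expnD mulnA; apply: leq_trans nU _; by rewrite leq_mul2r ltnW ?orbT.
(* Each step at least halves the accumulated error and adds [#|S| / 2 ^ (8 * p)], so twice that
   amount bounds it throughout. *)
pose inv W g := [/\ W \subset T, #|T| <= #|W| * 2 ^ (256 * g) &
  #|hit S v W| * 2 ^ (8 * p) * 2 ^ g <= #|S| * 2 ^ (8 * p) + 2 * #|S| * 2 ^ g].
have nW W g : inv W g -> n <= #|W| * 2 ^ (256 * g + (32 * p + (600 * p).+1)).
  by case=> _ H _; rewrite expnD mulnA; apply: leq_trans nT _; rewrite leq_mul2r H orbT.
(* A step is taken only while [g < 2 * p] and gains at most [16 * p], hence [g <= 18 * p]. If no
   rich set appears on the way, the final [W] is itself rich. *)
have main k : k <= 2 * p -> (exists2 A : {set G}, A \subset U & rich p S A) \/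
    exists W g, inv W g /\ k <= g <= 18 * p.
  elim: k => [|k IH] kp.
    right; exists T, 0; split=> //; split; rewrite ?muln0 ?expn0 ?muln1 //.
    apply: leq_trans (leq_addr _ _); rewrite leq_mul2r; apply/orP; right.
    by apply/subset_leq_card/subsetP=> x; rewrite in_set => /andP[].
  case: (IH (ltnW kp)) => [|[W [g [Wg gk]]]]; first by left.
  case: (ltnP k g) => kg.
    by right; exists W, g; split=> //; clear - kg gk; lia.
  have Wb : n <= #|W| * 2 ^ (1145 * p).
    apply: leq_trans (nW W g Wg) _; rewrite leq_mul2l leq_exp2l //; apply/orP; right.
    by clear - kg kp p16; lia.
  case: (Wg) => WT cW hW.
  have [[A AW rA]|[W' [s [g' [WW gp sg cW' hW']]]]] := step sc vS (subset_trans WT TS) Wb.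
    by left; exists A => //; apply: subset_trans AW (subset_trans WT TU).
  right; exists W', (g + g'); split; last by clear - kg gk gp kp; lia.
  split; first exact: subset_trans WW WT.
    apply: leq_trans cW _; apply: leq_trans (leq_mul cW' (leqnn _)) _.
    by rewrite -mulnA -expnD leq_mul2l leq_exp2l //; apply/orP; right; clear - sg; lia.
  rewrite expnD; apply: (hit_arith hW hW').
  by rewrite -{1}(expn1 2) leq_exp2l //; case/andP: gp.
case: (main (2 * p) (leqnn _)) => [//|[W [g [Wg gk]]]].
have nWg := nW W g Wg; case: Wg => WT cW hW.
exists W; first exact: subset_trans WT TU.
apply/andP; split.
  apply: (mc_sizeN mc); first by clear - p16; lia.
  by apply: leq_trans nWg _; rewrite leq_mul2l leq_exp2l //; apply/orP; right; clear - gk pd p16; lia.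
have cNC : #|NC S W| <= #|hit S v W| + #|S :&: nN v| + 1.
  have s : NC S W \subset hit S v W :|: (S :&: nN v) :|: [set v].
    apply/subsetP=> x; rewrite in_setD => /andP[xc xS].
    rewrite !in_setU in_setI in_nN in_set1 [x \in hit _ _ _]in_set xS xc (eq_sym x) andbT /=.
    by case: (v == x); rewrite ?orbT //; case: (e v x).
  apply: leq_trans (subset_leq_card s) _; apply: leq_trans (leq_card_setU _ _) _.
  by rewrite cards1 leq_add2r; apply: leq_card_setU.
rewrite expnS; apply: (rich_final_arith cNC hW); rewrite -?expnD.
- by rewrite leq_exp2l //; clear - gk; lia.
- by rewrite leq_exp2l //; clear - p16; lia.
- apply: leq_trans (sc_dense sc vS); rewrite leq_mul2l leq_exp2l //.
  by apply/orP; right; clear - p16; lia.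
- by apply: leq_trans (S_pow sc); rewrite leq_exp2l //; clear - p16; lia.
- apply: (@leq_trans (2 ^ 4)); first by [].
  by rewrite leq_exp2l //; clear - p16; lia.
Qed.

(* Iterating rich_subset yields 2^p pairwise complete sets, each of clique number above w / 2^p. *)
Lemma no_scale : False.
Proof.
have main j : j <= 2 ^ p -> exists B, [/\ B \subset S, j * w.+1 <= omg B * 2 ^ p &
    #|NC S B| * 2 ^ p.+1 <= j * #|S|].
  elim: j => [|j IH] jp.
    exists set0; rewrite sub0set !mul0n; split=> //.
    rewrite (_ : NC S set0 = set0) ?cards0 //; apply/setP=> x; rewrite in_setD [RHS]inE.
    by rewrite (_ : x \in com set0) //; apply/comP=> a; rewrite inE.
  have [B [BS oB cB]] := IH (ltnW jp).
  pose U := S :\: NC S B.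
  have NS : NC S B \subset S by apply: subsetDl.
  have U2 : #|S| <= 2 * #|U|.
    have K : 2 * #|NC S B| <= #|S|.
      have q0 : 0 < 2 ^ p by rewrite expn_gt0.
      have : 2 ^ p * (2 * #|NC S B|) <= 2 ^ p * #|S|.
        have : j * #|S| <= 2 ^ p * #|S| by rewrite leq_mul2r ltnW ?orbT.
        by move: cB; rewrite expnS; move: (2 ^ p) => q; clear; lia.
      by rewrite leq_pmul2l.
    by rewrite /U cardsD (setIidPr NS); clear - K; lia.
  have [A AU /andP[oA cA]] := rich_subset (subsetDl _ _) U2.
  have AB : full A B.
    move=> a b /(subsetP AU); rewrite !in_setD negb_and negbK => /andP[/orP[/comP aB _|aS]].
      exact: aB.
    by rewrite (negbTE aS).
  exists (A :|: B); split.
  - by rewrite subUset BS andbT; apply: subset_trans AU (subsetDl _ _).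
  - have := leq_mul (omgU AB) (leqnn (2 ^ p)); move: oA oB; move: (2 ^ p) => q; clear; lia.
  - have s : NC S (A :|: B) \subset NC S A :|: NC S B.
      apply/subsetP=> x; rewrite in_setU !in_setD => /andP[xc ->]; rewrite !andbT -negb_and.
      apply: contra xc => /andP[/comP xA /comP xB]; apply/comP=> a; rewrite in_setU => /orP[|]; [exact: xA|exact: xB].
    have := leq_mul (leq_trans (subset_leq_card s) (leq_card_setU _ _)) (leqnn (2 ^ p.+1)).
    by move: cA cB; move: (2 ^ p.+1) => q; clear; lia.
have [B [_ oB _]] := main _ (leqnn _).
have q0 : 0 < 2 ^ p by rewrite expn_gt0.
have : 2 ^ p * w.+1 <= 2 ^ p * w.
  by apply: leq_trans oB _; rewrite mulnC leq_mul2l omg_w orbT.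
by rewrite leq_pmul2l // ltnn.
Qed.

End Iterate.

Lemma scaled_arith k c n s : 2 ^ k.+2 <= c -> c < n -> n <= 2 * s -> 2 * 2 ^ k <= s.
Proof. by rewrite !expnS; move: (2 ^ k) => q; lia. Qed.

Section Descent.
Variables (G : sgraph) (d : nat).
Hypothesis mc : mincex G d.
Local Notation n := #|G|.
Local Notation w := (omg [set: G]).

Definition scaled p := exists S : {set G}, [/\ 2 ^ (2 * p) <= w,
  forall v, v \in S -> #|S :&: nN v| * 2 ^ (16 * p) <= #|S| & n <= #|S| * 2 ^ (600 * p)].

Lemma scaled16 : scaled 16.
Proof.
have dd := mc_d mc; have [S [S2 Sd]] := V_dense mc.
have S33 : 2 * 2 ^ (2 * 16) <= #|S|.
  apply: scaled_arith _ (mc_nbig mc) S2.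
  by rewrite leq_exp2l //; clear - dd; lia.
exists S; split.
- apply: leq_trans (omg_w S); apply: (greedy_clique Sd _ S33).
  by rewrite -expnS leq_exp2l.
- have E : 16 * 16 = 256 by [].
  by move=> v vS; rewrite E; apply: Sd.
- apply: leq_trans S2 _; rewrite mulnC leq_mul2l; apply/orP; right.
  by rewrite -{1}(expn1 2) leq_exp2l.
Qed.

(** [no_scale] refutes fineness, and a counterexample [S'] to it is a set for scale [2 * p], as 1200
    and 32 are twice 600 and 16. The larger lower bound on [w] comes from a greedy clique in the old
    [S]. *)
Lemma scaled_double p : 16 <= p -> scaled p -> scaled (2 * p).
Proof.
move=> p16 [S [wp Sd Sb]]; have dd := mc_d mc.
case: (classic (forall S' : {set G}, n <= #|S'| * 2 ^ (1200 * p) ->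
    exists2 v, v \in S' & #|S'| < #|S' :&: nN v| * 2 ^ (32 * p))) => [fine|].
  by case: (no_scale (Scale mc p16 wp Sd Sb fine)).
move=> /not_all_ex_not[S' HS].
have [S'b nv] := imply_to_and _ _ HS.
exists S'; split.
- have np := mincex_pow mc wp.
  have S16 : 2 ^ (16 * p) <= #|S|.
    rewrite -[2 ^ (16 * p)]mul1n; apply: (@pow_trans (2 * p * d) (600 * p) (16 * p) 1 n) => //.
      by rewrite mul1n ltnW.
    have : p * (10 * 1000) <= p * d by rewrite leq_mul2l dd orbT.
    by clear; lia.
  have K : 2 * 2 ^ (2 * (2 * p)) <= 2 ^ (16 * p) by rewrite -expnS leq_exp2l //; clear - p16; lia.
  apply: leq_trans (omg_w S); apply: (greedy_clique Sd K).
  exact: leq_trans K S16.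
- move=> v vS; rewrite mulnA (_ : 16 * 2 = 32) // leqNgt; apply/negP=> H.
  by apply: nv; exists v.
- by rewrite mulnA (_ : 600 * 2 = 1200).
Qed.

(** Doubling makes [p] exceed every bound, whereas [2 ^ (2 * p) <= w]. *)
Lemma mincex_false : False.
Proof.
have main i : exists2 p, (16 <= p) && (i <= p) & scaled p.
  elim: i => [|i [p /andP[p16 ip] sp]]; first by exists 16 => //; apply: scaled16.
  exists (2 * p); last exact: scaled_double.
  by clear - p16 ip; lia.
have [p /andP[_ wp] [S [H _ _]]] := main w.
have : 2 * p < 2 ^ (2 * p) by apply: ltn_expl.
by move: (2 ^ (2 * p)) H => q; clear - wp; lia.
Qed.

End Descent.

(** * Induced subgraphs and the existence of a minimal counterexample *)

Section Induced.
Variables (G : sgraph) (U : {set G}).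

Definition ind_adj : rel {x : G | x \in U} := fun a b => adj (val a) (val b).

Lemma ind_sym : symmetric ind_adj.
Proof. by move=> a b; rewrite /ind_adj adj_sym. Qed.

Lemma ind_irr : irreflexive ind_adj.
Proof. by move=> a; rewrite /ind_adj adj_irr. Qed.

Definition induced := SGraph ind_sym ind_irr.

Lemma induced_P5_free : P5_free G -> P5_free induced.
Proof.
move=> PF [f [fi fa]]; apply: PF; exists (fun i => val (f i)); split.
  by move=> i j /val_inj/fi.
by move=> x y; rewrite -(fa x y).
Qed.

Lemma card_induced : #|induced| = #|U|.
Proof. by rewrite card_sig; apply: eq_card => x; rewrite !inE. Qed.

Lemma induced_image (A : {set induced}) : val @: A \subset U.
Proof. by apply/subsetP=> x /imsetP[a _ ->]; apply: (valP a). Qed.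

Lemma alpha_induced : alpha induced <= alf U.
Proof.
apply/bigmax_leqP=> A /stableP sA; rewrite -(card_imset _ val_inj).
apply: stable_le; first exact: induced_image.
by apply/stableP=> x y /imsetP[a aA ->] /imsetP[b bA ->]; apply: (sA a b).
Qed.

Lemma omega_induced : omega induced <= omg U.
Proof.
apply/bigmax_leqP=> A /cliqueP sA; rewrite -(card_imset _ val_inj).
apply: clique_le; first exact: induced_image.
apply/cliqueP=> x y /imsetP[a aA ->] /imsetP[b bA ->] ab; apply: (sA a b) => //.
Qed.

End Induced.

Lemma alf_setT (G : sgraph) : alf [set: G] <= alpha G.
Proof.
have [K [_ sK <-]] := alf_ex [set: G].
exact: (@leq_bigmax_cond _ (fun A : {set G} => stable A) (fun A => #|A|)).
Qed.

Lemma omg_setT (G : sgraph) : omg [set: G] <= omega G.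
Proof.
have [K [_ sK <-]] := omg_ex [set: G].
exact: (@leq_bigmax_cond _ (fun A : {set G} => clique A) (fun A => #|A|)).
Qed.

Lemma alpha_omega_bound d : 100 * 100 <= d ->
  forall G : sgraph, P5_free G -> #|G| <= alpha G * omega G ^ d.
Proof.
move=> dd G; have [k] := ubnP #|G|; elim: k G => // k IH G Gk PF.
rewrite leqNgt; apply/negP=> big; apply: (@mincex_false G d); split=> //.
- exact: P5_mixed PF.
- move=> U UT.
  have cU : #|U| < #|G| by rewrite -cardsT; apply: proper_card; rewrite properT.
  have : #|induced U| <= alpha (induced U) * omega (induced U) ^ d.
    by apply: IH (induced_P5_free PF); rewrite card_induced; apply: leq_trans cU _.
  rewrite card_induced => /leq_trans; apply; apply: leq_mul; first exact: alpha_induced.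
  exact/leq_expl/omega_induced.
- apply: leq_ltn_trans big; apply: leq_mul; first exact: alf_setT.
  exact/leq_expl/omg_setT.
Qed.

Theorem theorem1p4 :
  exists d : nat, 2 <= d /\
    forall G : sgraph, P5_free G -> #|G| <= alpha G * omega G ^ d.
Proof.
exists (100 * 100); split; first by [].
by apply: alpha_omega_bound.
Qed.
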